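(* Consider the random array of data sets described in the context (for each $p$, covariates $x_1,x_2,\dots$ iid in $\mathbb{R}^p$ and responses $y_i\sim\mathrm{Bernoulli}(G(x_i^T\beta_* ))$), with a prior with parameters $(Q_p,v_p)$ for each $p$. Suppose that the following hold. (B1) For each $p$, $0<\lambda_{\min}(\tilde{\mathbb{E}}x_1x_1^T)\le\lambda_{\max}(\tilde{\mathbb{E}}x_1x_1^T)<\infty$. (B2) For each $p$, $\tilde{\mathbb{E}}\|x_1\|_2^4<\infty$. (B3) For each $p$, $\lim_{\delta\to0^+}\sup_{\alpha\in\mathbb{R}^p\setminus\{0\}}\tilde{\mathbb{P}}(|x_1^T\alpha|<\delta\|x_1\|_2\|\alpha\|_2)=0$. (B4) There exists a constant $\ell>0$ (not depending on $p$) such that for each $p$, $$\lambda_{\min}\left[(\tilde{\mathbb{E}}x_1x_1^T)^{-1/2}\bigl(\tilde{\mathbb{E}}x_1x_1^T\bar G(x_1^T\beta_* )\bigr)(\tilde{\mathbb{E}}x_1x_1^T)^{-1/2}\right]>\ell,$$ where $\bar G(x)=G(x)\wedge(1-G(x))$. Then there exists a constant $\rho<1$ (independent of $p$) such that, for each $p$, almost surely, $$\limsup_{n\to\infty}\rho_*(\psi)\le\rho .$$ The result continues to hold if $\rho_*(\psi)$ is replaced by $\rho_*^{\mathrm{TV}}$.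
   Context: Data generation. $G:\mathbb{R}\to(0,1)$ is a function independent of $p$. For each $p$: $\beta_*\in\mathbb{R}^p$ is a fixed true coefficient; $x_1,x_2,\dots$ are iid random vectors in $\mathbb{R}^p$ (with a common distribution that may depend on $p$); given $\{x_i\}$, the $y_i\in\{0,1\}$ are independent with $y_i\sim\mathrm{Bernoulli}(G(x_i^T\beta_* ))$. For each $n$ the data set is the $n\times p$ matrix $X$ with $i$th row $x_i^T$ and $y=(y_1,\dots,y_n)^T$. $\tilde{\mathbb{P}},\tilde{\mathbb{E}}$ denote probability and expectation over the random data; ''almost surely'' refers to $\tilde{\mathbb{P}}$. For each $p$, $v=v_p\in\mathbb{R}^p$ and $Q=Q_p$ is a symmetric $p\times p$ matrix that is positive definite or zero (not depending on $n$). Albert–Chib chain for given $(X,y,Q,v)$. $\Phi$ is the standard normal cdf, $\Sigma=X^TX+Q$. The posterior density is $\pi(\beta|X,y)\propto\prod_{i=1}^n\Phi(x_i^T\beta)^{y_i}(1-\Phi(x_i^T\beta))^{1-y_i}\exp[-\frac12(\beta-v)^TQ(\beta-v)]$, proper if the right side is integrable on $\mathbb{R}^p$; $\Pi$ is the corresponding probability measure. For $a\in\{0,1\}$, $\mathrm{TN}(\mu,1;a)$ is $\mathrm{N}(\mu,1)$ truncated to $(-\infty,0)$ if $a=0$ and to $(0,\infty)$ if $a=1$. When $\Sigma$ is nonsingular, $K(\beta,\cdot)$ is the law of $\tilde\beta$ obtained by drawing independent $Z_i\sim\mathrm{TN}(x_i^T\beta,1;y_i)$, $Z=(Z_1,\dots,Z_n)^T$,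 then $\tilde\beta\sim\mathrm{N}(\Sigma^{-1}(X^TZ+Qv),\Sigma^{-1})$. $K_\beta^m$ is the $m$-step law from $\beta$. $\psi(\beta,\beta')=[(\beta-\beta')^T\Sigma(\beta-\beta')]^{1/2}$; $\mathrm{W}_\psi(\mu,\nu)$ is the infimum of $\int\psi\,d\upsilon$ over couplings $\upsilon$ of $\mu,\nu$. $\rho_*(\psi)\in[0,1]$ is the infimum of $\rho\in[0,1]$ for which there is $M:\mathbb{R}^p\to[0,\infty)$ with $\mathrm{W}_\psi(K_\beta^m,\Pi)\le M(\beta)\rho^m$ for all $m\ge1$, $\beta\in\mathbb{R}^p$ (equal to $1$ if there is no such $\rho$). $\rho_*^{\mathrm{TV}}$ is defined in the same way with $\mathrm{W}_\psi$ replaced by the total variation distance (supremum of discrepancy over measurable sets). By convention these rates are set to $1$ for data sets with $\Sigma$ singular or improper posterior (only the behaviour for large $n$ matters). $\|\cdot\|_2$ is the Euclidean norm; $\lambda_{\min},\lambda_{\max}$ are smallest and largest eigenvalues; $s\wedge t=\min\{s,t\}$. *)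

(* Defs.v *)
From HB Require Import structures.
From mathcomp Require Import all_boot all_order all_algebra.
From mathcomp Require Import all_classical all_reals all_analysis.

Set Implicit Arguments.
Unset Strict Implicit.
Unset Printing Implicit Defensive.
Import Order.TTheory GRing.Theory Num.Theory.
Import numFieldNormedType.Exports.
Local Open Scope classical_set_scope.
Local Open Scope ring_scope.

Definition mx_display : measure_display.
Proof. by constructor. Qed.

(* The sigma-algebra generated by the entries, i.e. the Borel sigma-algebra. *)
Section measurable_matrix.
Context {R : realType} (m n : nat).

Definition mx_cylinders : set (set 'M[R]_(m, n)) :=
  \bigcup_(ij in [set: 'I_m * 'I_n])
    preimage_set_system [set: 'M[R]_(m, n)]
      (fun M : 'M[R]_(m, n) => M ij.1 ij.2) measurable.

Let mx_set0 : <<s mx_cylinders >> set0.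
Proof. exact: sigma_algebra0. Qed.

Let mx_setC A : <<s mx_cylinders >> A -> <<s mx_cylinders >> (~` A).
Proof. exact: sigma_algebraC. Qed.

Let mx_bigcup (F : _^nat) : (forall i, <<s mx_cylinders >> (F i)) ->
  <<s mx_cylinders >> (\bigcup_i (F i)).
Proof. exact: sigma_algebra_bigcup. Qed.

HB.instance Definition _ := @isMeasurable.Build mx_display
  'M[R]_(m, n) <<s mx_cylinders >> mx_set0 mx_setC mx_bigcup.

End measurable_matrix.

Lemma measurable_mx_entry (R : realType) m n (i : 'I_m) (j : 'I_n) :
  measurable_fun [set: 'M[R]_(m, n)] (fun M : 'M[R]_(m, n) => M i j).
Proof.
move=> _ Y mY; apply: sub_sigma_algebra; exists (i, j) => //.
by exists Y.
Qed.

Lemma measurable_fun_mxP d (T : measurableType d) (R : realType) m n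
    (f : T -> 'M[R]_(m, n)) :
  (forall i j, measurable_fun [set: T] (fun t => f t i j)) ->
  measurable_fun [set: T] f.
Proof.
move=> mf; apply: (measurability (mx_cylinders (R := R) (m := m) (n := n))) => //.
move=> _ [_ [[i j] _ [B mB <-]] <-].
rewrite setTI -comp_preimage; have := mf i j measurableT B mB.
by rewrite !setTI.
Qed.

Section cons_measure.
Context {R : realType} (n : nat).

Definition cons_cV (xv : measurableTypeR R * 'cV[R]_n) : 'cV[R]_n.+1 :=
  \col_i (if unlift ord0 i is Some j then xv.2 j ord0 else xv.1).

Definition uncons_cV (v : 'cV[R]_n.+1) : measurableTypeR R * 'cV[R]_n :=
  (v ord0 ord0, \col_j v (lift ord0 j) ord0).

Lemma uncons_cVK : cancel uncons_cV cons_cV.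
Proof.
move=> v; apply/colP => i; rewrite mxE /=.
by case: unliftP => [j|] ->//; rewrite mxE.
Qed.

Lemma cons_cVK : cancel cons_cV uncons_cV.
Proof.
move=> [x v]; rewrite /uncons_cV mxE unlift_none/=; congr pair.
by apply/colP => i; rewrite !mxE liftK.
Qed.

Lemma measurable_cons_cV : measurable_fun setT cons_cV.
Proof.
apply: measurable_fun_mxP => i j; under eq_fun do rewrite mxE.
case: (unlift ord0 i) => [k|]; last exact: measurable_fst.
apply: (measurableT_comp (f := fun v : 'cV[R]_n => v k ord0)) => //.
exact: measurable_mx_entry.
Qed.

Lemma measurable_uncons_cV : measurable_fun setT uncons_cV.
Proof.
apply/measurable_fun_pairP; split; first exact: measurable_mx_entry.
apply: measurable_fun_mxP => i j /=; under eq_fun do rewrite mxE.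
exact: measurable_mx_entry.
Qed.

Variables (m1 : {sigma_finite_measure set (measurableTypeR R) -> \bar R})
  (m2 : {sigma_finite_measure set 'cV[R]_n -> \bar R}).

Definition cons_measure : set 'cV[R]_n.+1 -> \bar R :=
  pushforward (m1 \x m2)%E cons_cV.

HB.instance Definition _ := isMeasurableFun.Build _ _ _ _ _ measurable_cons_cV.

Let cons_measure0 : cons_measure set0 = 0%E.
Proof. exact: measure0. Qed.

Let cons_measure_ge0 A : (0 <= cons_measure A)%E.
Proof. exact: measure_ge0. Qed.

Let cons_measure_sigma_additive : semi_sigma_additive cons_measure.
Proof. exact: measure_semi_sigma_additive. Qed.

HB.instance Definition _ := isMeasure.Build _ _ _ cons_measure
  cons_measure0 cons_measure_ge0 cons_measure_sigma_additive.

Let cons_measure_sigma_finite : sigma_finite setT cons_measure.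
Proof.
have /sigma_finiteP[F [TF ndF Foo]] := sigma_finiteT m1.
have /sigma_finiteP[H [TH ndH Hoo]] := sigma_finiteT m2.
exists (fun k => uncons_cV @^-1` (F k `*` H k)) => [|k].
  rewrite -preimage_bigcup (_ : \bigcup_k _ = setT) ?preimage_setT//.
  apply/seteqP; split=> // -[x v] _.
  have [i _ Fx] : (\bigcup_i F i) x by rewrite -TF.
  have [j _ Hv] : (\bigcup_i H i) v by rewrite -TH.
  exists (maxn i j) => //; split => /=.
  - by move: x Fx; exact/subsetPset/ndF/leq_maxl.
  - by move: v Hv; exact/subsetPset/ndH/leq_maxr.
have [mF Fk] := Foo k; have [mH Hk] := Hoo k; split.
  rewrite -[X in measurable X]setTI; apply: measurable_uncons_cV => //.
  exact: measurableX.
rewrite /= /cons_measure /pushforward -comp_preimage.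
rewrite (_ : _ \o _ = id); last by apply/funext => z; exact: cons_cVK.
by rewrite preimage_id product_measure1E// lte_mul_pinfty// ge0_fin_numE.
Qed.

HB.instance Definition _ := Measure_isSigmaFinite.Build _ _ _ cons_measure
  cons_measure_sigma_finite.

End cons_measure.

(* The product of the mu i, built one coordinate at a time since the library
   only has binary product measures. *)
Fixpoint prod_measure {R : realType} n :
    ('I_n -> {sigma_finite_measure set (measurableTypeR R) -> \bar R}) ->
    {sigma_finite_measure set 'cV[R]_n -> \bar R} :=
  match n with
  | 0 => fun _ => dirac (0 : 'cV[R]_0)
  | n'.+1 => fun mu =>
      cons_measure (mu ord0) (prod_measure (fun i => mu (lift ord0 i)))
  end.

Definition lebesgue_cV {R : realType} n :
    {sigma_finite_measure set 'cV[R]_n -> \bar R} :=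
  @prod_measure R n (fun _ => @lebesgue_measure R).

Section linear_algebra.
Context {R : realType}.

Definition dotv n (u v : 'cV[R]_n) : R := (u^T *m v) ord0 ord0.

Definition norm2 n (u : 'cV[R]_n) : R := Num.sqrt (dotv u u).

Definition qform n (A : 'M[R]_n) (u : 'cV[R]_n) : R := dotv u (A *m u).

Definition posdefmx n (A : 'M[R]_n) : Prop :=
  A^T = A /\ forall u : 'cV[R]_n, u != 0 -> 0 < qform A u.

Definition possemidefmx n (A : 'M[R]_n) : Prop :=
  A^T = A /\ forall u : 'cV[R]_n, 0 <= qform A u.

(* Intended for symmetric matrices of positive size, whose set of eigenvalues is
   real, finite and nonempty. *)
Definition lambda_min n (A : 'M[R]_n) : R := inf [set a | eigenvalue A a].
Definition lambda_max n (A : 'M[R]_n) : R := sup [set a | eigenvalue A a].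

(* The principal square root: the unique positive semidefinite B with B B = A,
   when A is positive semidefinite. *)
Definition sqrtmx n (A : 'M[R]_n) : 'M[R]_n :=
  xget 0 [set B | possemidefmx B /\ B *m B = A].

Definition invsqrtmx n (A : 'M[R]_n) : 'M[R]_n := invmx (sqrtmx A).

End linear_algebra.

Section probability.
Context d (T : measurableType d) (R : realType) (P : probability T R).

Definition mx_integrable m n (M : T -> 'M[R]_(m, n)) : Prop :=
  forall i j, P.-integrable setT (EFin \o (fun w => M w i j)).

Definition mx_expectation m n (M : T -> 'M[R]_(m, n)) : 'M[R]_(m, n) :=
  \matrix_(i, j) fine 'E_P[fun w => M w i j]%E.

Definition mutually_independent d' (U : measurableType d')
    (x : nat -> {RV P >-> U}) : Prop :=
  forall (s : seq nat) (A : nat -> set U), uniq s ->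
    (forall i, measurable (A i)) ->
    P (\bigcap_(i in [set` s]) (x i @^-1` A i)) =
    (\prod_(i <- s) P (x i @^-1` A i))%E.

Definition iid d' (U : measurableType d') (x : nat -> {RV P >-> U}) : Prop :=
  mutually_independent x /\
  forall i A, measurable A -> P (x i @^-1` A) = P (x 0%N @^-1` A).

(* Given the whole sequence (x i), the responses y i are independent and y i
   is Bernoulli (g (x i)): the right-hand side is the integral over an event of
   the sigma-algebra of (x i) of the conditional probability of the first n
   responses.  The measurability of g makes u |-> Bernoulli (g u) a Markov
   kernel. *)
Definition conditionally_bernoulli d' (U : measurableType d')
    (x : nat -> {RV P >-> U}) (y : nat -> {RV P >-> bool}) (g : U -> R) :
    Prop :=
  measurable_fun setT g /\
  forall (n : nat) (b : nat -> bool) (C : set T),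
    <<s \bigcup_i preimage_set_system setT (x i) measurable >> C ->
    P (C `&` [set w | forall i, (i < n)%N -> y i w = b i]) =
    (\int[P]_(w in C)
      (\prod_(i < n) bernoulli_pmf (g (x i w)) (b i))%:E)%E.

End probability.

Section distances.
Context {R : realType} {d} {T : measurableType d}.
Local Open Scope ereal_scope.

Definition couplings (mu nu : set T -> \bar R) : set (probability (T * T)%type R) :=
  [set u | forall A, measurable A ->
    u (A `*` setT) = mu A /\ u (setT `*` A) = nu A].

Definition wasserstein (c : T -> T -> R) (mu nu : set T -> \bar R) : \bar R :=
  ereal_inf [set \int[u]_z (c z.1 z.2)%:E | u in couplings mu nu].

Definition total_variation (mu nu : set T -> \bar R) : \bar R :=
  ereal_sup [set `|mu A - nu A| | A in measurable].

(* D b m is the distance to stationarity after m steps from b. *)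
Definition geometric_rate (D : T -> nat -> \bar R) : R :=
  let S := [set rho : R | (0 <= rho <= 1)%R /\
    exists2 M : T -> R, (forall b, (0 <= M b)%R) &
      forall b m, (0 < m)%N -> D b m <= (M b * rho ^+ m)%:E] in
  if `[< S !=set0 >] then inf S else 1%R.

End distances.

Section normal.
Context {R : realType}.

Definition normal_cdf (t : R) : R := fine (normal_prob 0 1 `]-oo, t]).

Definition trunc_support (a : bool) : set R :=
  if a then `]0, +oo[%classic else `]-oo, 0[%classic.

Lemma measurable_trunc_support a : measurable (trunc_support a).
Proof. by case: a; exact: measurable_itv. Qed.

(* TN(mu, 1; a); the last argument of mnormalize, a default for null or
   infinite total mass, is irrelevant here. *)
Definition truncated_normal (mu : R) (a : bool) :
    probability (measurableTypeR R) R :=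
  mnormalize (mrestr (normal_prob mu 1) (measurable_trunc_support a))
    (normal_prob mu 1).

(* The density of N(m, S) for a positive definite covariance matrix S. *)
Definition mvnormal_pdf n (m : 'cV[R]_n) (S : 'M[R]_n) (b : 'cV[R]_n) : R :=
  (Num.sqrt ((2 * pi) ^+ n * \det S))^-1 *
  expR (- (qform (invmx S) (b - m) / 2)).

Definition mvnormal_prob n (m : 'cV[R]_n) (S : 'M[R]_n) :
    set 'cV[R]_n -> \bar R :=
  fun A => (\int[lebesgue_cV n]_(b in A) (mvnormal_pdf m S b)%:E)%E.

End normal.

Section albert_chib.
Context {R : realType} (n p : nat).
Variables (X : 'M[R]_(n, p)) (y : 'I_n -> bool) (Q : 'M[R]_p) (v : 'cV[R]_p).

Definition ac_Sigma : 'M[R]_p := X^T *m X + Q.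

Definition linpred (b : 'cV[R]_p) (i : 'I_n) : R := (X *m b) i ord0.

(* The exponents y i and ~~ y i are read as the numbers 0 and 1. *)
Definition posterior_weight (b : 'cV[R]_p) : R :=
  (\prod_(i < n) (normal_cdf (linpred b i) ^+ y i *
                  (1 - normal_cdf (linpred b i)) ^+ (~~ y i))) *
  expR (- (qform Q (b - v) / 2)).

Definition proper_posterior : Prop :=
  (lebesgue_cV p).-integrable setT (EFin \o posterior_weight).

Definition posterior : set 'cV[R]_p -> \bar R := fun A =>
  ((\int[lebesgue_cV p]_(b in A) (posterior_weight b)%:E) *
   (fine (\int[lebesgue_cV p]_b (posterior_weight b)%:E))^-1%:E)%E.

Definition ac_kernel (b : 'cV[R]_p) : set 'cV[R]_p -> \bar R := fun A =>
  (\int[prod_measure (fun i => truncated_normal (linpred b i) (y i))]_z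
    mvnormal_prob (invmx ac_Sigma *m (X^T *m z + Q *m v)) (invmx ac_Sigma) A)%E.

Fixpoint ac_kernel_iter (m : nat) (b : 'cV[R]_p) : set 'cV[R]_p -> \bar R :=
  if m is m'.+1 then
    fun A => (\int[ac_kernel b]_b' ac_kernel_iter m' b' A)%E
  else dirac b.

Definition psi (b b' : 'cV[R]_p) : R := Num.sqrt (qform ac_Sigma (b - b')).

(* D is the distance between laws; the rate is set to 1 when the chain or its
   target is not defined. *)
Definition ac_rate
    (D : (set 'cV[R]_p -> \bar R) -> (set 'cV[R]_p -> \bar R) -> \bar R) : R :=
  if `[< ac_Sigma \in unitmx /\ proper_posterior >] then
    geometric_rate (fun b m => D (ac_kernel_iter m b) posterior)
  else 1.

Definition rho_psi : R := ac_rate (wasserstein psi).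

Definition rho_TV : R := ac_rate total_variation.

End albert_chib.

Definition design {R : realType} p n (x : nat -> 'cV[R]_p) : 'M[R]_(n, p) :=
  \matrix_(i < n, j < p) x i j ord0.

(* Main.v *)
Require Import Defs.
From HB Require Import structures.
From mathcomp Require Import all_boot all_order all_algebra.
From mathcomp Require Import all_classical all_reals all_analysis.
From mathcomp Require Import measurable_realfun.
From mathcomp Require Import zify ring lra.
Set Implicit Arguments.
Unset Strict Implicit.
Unset Printing Implicit Defensive.
Import Order.TTheory GRing.Theory Num.Theory.
Import numFieldNormedType.Exports.
Local Open Scope classical_set_scope.
Local Open Scope ring_scope.

(** The chain is driven by uniform variables u_i and one Gaussian noise vector.
Each latent Z_i is a quantile transform of u_i, nondecreasing and
1-Lipschitz in the linear predictor, because the normal distribution function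
Phi is log-concave.  If the observation is misclassified at the midpoint of the
two predictors (y_i = 1 with a nonpositive predictor, or y_i = 0 with a
nonnegative one), then half of the segment lies where Phi is convex
and the squared distance drops by a quarter whenever u_i >= 1 / 2
(tn_map_sqr_contract).  The Gaussian noise is common to both copies and cancels,
and X Sigma^-1 X^T is a contraction.  So, if in every direction the observations
misclassified by any b carry at least a fraction e of the sum of the squared
predictors (overlap), the mean of psi^2 contracts by 1 - e / 8 at each
step (latent_contraction).

The posterior is stationary (posterior_mass_stationary).  Overlap in the
direction b itself dominates the posterior density by a Gaussian one, whence
properness and finite second moments (posterior_second_moment).  Coupling a chain
from b with a stationary one bounds the Wasserstein distance after m steps by a
multiple of sqrt (1 - e / 8) ^ m.  For total variation, the last step draws from
normal laws with a common covariance, whose discrepancy is controlled by the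
distance of the means (mvnormal_prob_lipschitz).  Both rates of a
data set with overlap e are at most sqrt (1 - e / 8) (rho_psi_le, rho_TV_le).

It remains to find an overlap fraction that depends on the constant of (B4)
only.  The pairs (x_i, y_i) are independent and identically distributed, and a
response is misclassified by b with conditional probability at least
min (G, 1 - G), so by (B4) the moment matrix restricted to the observations
misclassified by b is at least l times the full one
(misclassified_moment_ge).  The law of large numbers turns this into an
empirical bound for finitely many b at once.  Passing from a finite net
to all b only affects observations whose predictor is small compared with their
length; by (B3) and the fourth moments (B2) these carry an arbitrarily small share
(bad_moment_le, overlap_unit).  Hence almost surely the overlap is
eventually at least min (l, 1) / 2 (eventually_overlap), in every dimension. *)

(** * Symmetric matrices and quadratic forms *)

Section linear_algebra.
Context {R : realType}.
Implicit Types n : nat.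

Lemma dotvE n (u v : 'cV[R]_n) : dotv u v = \sum_i u i ord0 * v i ord0.
Proof. by rewrite /dotv mxE; apply: eq_bigr => i _; rewrite mxE. Qed.

Lemma dotvC n (u v : 'cV[R]_n) : dotv u v = dotv v u.
Proof. by rewrite !dotvE; apply: eq_bigr => i _; rewrite mulrC. Qed.

Lemma dotvDl n (u v w : 'cV[R]_n) : dotv (u + v) w = dotv u w + dotv v w.
Proof. by rewrite /dotv linearD /= mulmxDl mxE. Qed.

Lemma dotvDr n (u v w : 'cV[R]_n) : dotv w (u + v) = dotv w u + dotv w v.
Proof. by rewrite ![dotv w _]dotvC dotvDl. Qed.

Lemma dotvZl n (a : R) (u v : 'cV[R]_n) : dotv (a *: u) v = a * dotv u v.
Proof. by rewrite /dotv linearZ /= -scalemxAl mxE. Qed.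

Lemma dotvZr n (a : R) (u v : 'cV[R]_n) : dotv u (a *: v) = a * dotv u v.
Proof. by rewrite dotvC dotvZl dotvC. Qed.

Lemma dotvNl n (u v : 'cV[R]_n) : dotv (- u) v = - dotv u v.
Proof. by rewrite -scaleN1r dotvZl mulN1r. Qed.

Lemma dotvNr n (u v : 'cV[R]_n) : dotv u (- v) = - dotv u v.
Proof. by rewrite dotvC dotvNl dotvC. Qed.

Lemma dotv_mulmx m n (A : 'M[R]_(m, n)) (u : 'cV[R]_m) (v : 'cV[R]_n) :
  dotv u (A *m v) = dotv (A^T *m u) v.
Proof. by rewrite /dotv trmx_mul trmxK mulmxA. Qed.

Lemma dotvv_ge0 n (u : 'cV[R]_n) : 0 <= dotv u u.
Proof. by rewrite dotvE sumr_ge0// => i _; rewrite -expr2 sqr_ge0. Qed.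

Lemma dotvv_eq0 n (u : 'cV[R]_n) : (dotv u u == 0) = (u == 0).
Proof.
apply/idP/eqP => [|->]; last by rewrite dotvE big1// => i _; rewrite mxE mul0r.
rewrite dotvE psumr_eq0 => [/allP u0|i _]; last by rewrite -expr2 sqr_ge0.
apply/colP => i; rewrite mxE; apply/eqP.
by have := u0 i (mem_index_enum i); rewrite mulf_eq0 orbb.
Qed.

Lemma dotvv_gt0 n (u : 'cV[R]_n) : (0 < dotv u u) = (u != 0).
Proof. by rewrite lt_def dotvv_eq0 dotvv_ge0 andbT. Qed.

Lemma qformD n (A : 'M[R]_n) (u v : 'cV[R]_n) : A^T = A ->
  qform A (u + v) = qform A u + 2 * dotv u (A *m v) + qform A v.
Proof.
move=> sA; rewrite /qform mulmxDr !dotvDl !dotvDr.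
rewrite (dotv_mulmx A v u) sA (dotvC (A *m v) u); ring.
Qed.

Lemma qformZ n (A : 'M[R]_n) a (u : 'cV[R]_n) : qform A (a *: u) = a ^+ 2 * qform A u.
Proof. by rewrite /qform -scalemxAr dotvZl dotvZr mulrA expr2. Qed.

Lemma qformN n (A : 'M[R]_n) (u : 'cV[R]_n) : qform A (- u) = qform A u.
Proof. by rewrite -scaleN1r qformZ sqrrN expr1n mul1r. Qed.

Lemma qformDm n (A B : 'M[R]_n) (u : 'cV[R]_n) :
  qform (A + B) u = qform A u + qform B u.
Proof. by rewrite /qform mulmxDl dotvDr. Qed.

Lemma qformZm n a (A : 'M[R]_n) (u : 'cV[R]_n) : qform (a *: A) u = a * qform A u.
Proof. by rewrite /qform -scalemxAl dotvZr. Qed.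

Lemma qform_scalar n a (u : 'cV[R]_n) : qform a%:M u = a * dotv u u.
Proof. by rewrite /qform mul_scalar_mx dotvZr. Qed.

Lemma qform_gram m n (X : 'M[R]_(m, n)) (u : 'cV[R]_n) :
  qform (X^T *m X) u = dotv (X *m u) (X *m u).
Proof. by rewrite /qform -mulmxA dotv_mulmx trmxK. Qed.

Lemma qformE n (A : 'M[R]_n) (u : 'cV[R]_n) :
  qform A u = \sum_i \sum_j A i j * (u i ord0 * u j ord0).
Proof.
rewrite /qform dotvE; apply: eq_bigr => i _.
by rewrite mxE mulr_sumr; apply: eq_bigr => j _; rewrite mulrCA.
Qed.

Lemma sqr_entry_le n (u : 'cV[R]_n) i : u i ord0 ^+ 2 <= dotv u u.
Proof.
rewrite dotvE (bigD1 i)//= expr2 lerDl sumr_ge0// => j _.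
by rewrite -expr2 sqr_ge0.
Qed.

Lemma norm_entry_prod_le n (u : 'cV[R]_n) i j : `|u i ord0 * u j ord0| <= dotv u u.
Proof.
have hi := sqr_entry_le u i; have hj := sqr_entry_le u j.
rewrite ler_norml; apply/andP; split.
  have := sqr_ge0 (u i ord0 + u j ord0); nra.
have := sqr_ge0 (u i ord0 - u j ord0); nra.
Qed.

Lemma qform_abs_le n (A : 'M[R]_n) (u : 'cV[R]_n) :
  `|qform A u| <= (\sum_i \sum_j `|A i j|) * dotv u u.
Proof.
rewrite qformE mulr_suml (le_trans (ler_norm_sum _ _ _))// ler_sum// => i _.
rewrite mulr_suml (le_trans (ler_norm_sum _ _ _))// ler_sum// => j _.
by rewrite normrM ler_wpM2l// norm_entry_prod_le.
Qed.

(** Cauchy-Schwarz for a positive semidefinite form, by completing the square. *)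
Lemma psd_CauchySchwarz n (A : 'M[R]_n) (u v : 'cV[R]_n) : possemidefmx A ->
  dotv u (A *m v) ^+ 2 <= qform A u * qform A v.
Proof.
move=> [sA A0].
have key t : 0 <= t ^+ 2 * qform A u + t * (2 * dotv u (A *m v)) + qform A v.
  have := A0 (t *: u + v); rewrite qformD// qformZ dotvZl; lra.
have [Au0|Au0] := eqVneq (qform A u) 0; last first.
  have Au : 0 < qform A u by rewrite lt_def Au0 A0.
  have := key (- (dotv u (A *m v)) / qform A u).
  set d := dotv _ _; set a := qform A u in Au0 Au *; set b := qform A v.
  rewrite (_ : _ + _ + _ = (a * b - d ^+ 2) / a); last by field.
  by rewrite pmulr_lge0 ?invr_gt0// subr_ge0.
rewrite Au0 mul0r.
have [->|d0] := eqVneq (dotv u (A *m v)) 0; first by rewrite expr0n.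
have := key (- (qform A v + 1) / (2 * dotv u (A *m v))).
rewrite Au0 mulr0 add0r divfK ?mulf_neq0//; first by move=> ?; lra.
Qed.

Lemma CauchySchwarz n (u v : 'cV[R]_n) : dotv u v ^+ 2 <= dotv u u * dotv v v.
Proof.
have := @psd_CauchySchwarz n 1%:M u v.
rewrite !qform_scalar !mul1r mul1mx; apply.
by split=> [|w]; rewrite ?trmx1 ?qform_scalar ?mul1r ?dotvv_ge0.
Qed.

Lemma posdef_psd n (A : 'M[R]_n) : posdefmx A -> possemidefmx A.
Proof.
move=> [sA A0]; split=> // u; have [->|/A0/ltW//] := eqVneq u 0.
by rewrite /qform mulmx0 dotvE big1// => i _; rewrite mxE mul0r.
Qed.

Lemma inj_unitmx n (A : 'M[R]_n) :
  (forall u : 'cV[R]_n, A *m u = 0 -> u = 0) -> A \in unitmx.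
Proof.
move=> A0; rewrite -unitmx_tr -row_free_unit -kermx_eq0; apply/eqP/row_matrixP => i.
rewrite row0; apply: trmx_inj; rewrite trmx0; apply: A0.
by apply: trmx_inj; rewrite trmx_mul trmxK trmx0 -row_mul mulmx_ker row0.
Qed.

Lemma posdef_unit n (A : 'M[R]_n) : posdefmx A -> A \in unitmx.
Proof.
move=> [sA A0]; apply: inj_unitmx => u Au; apply/eqP/negPn/negP => /A0.
by rewrite /qform Au dotvE big1 ?ltxx// => i _; rewrite mxE mulr0.
Qed.

Lemma psd_unit_posdef n (A : 'M[R]_n) :
  possemidefmx A -> A \in unitmx -> posdefmx A.
Proof.
move=> pA uA; have [sA A0] := pA; split=> // u u0; rewrite lt_def A0 andbT.
apply: contraNN u0 => /eqP Au0.
have := psd_CauchySchwarz u (A *m u) pA; rewrite Au0 mul0r.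
rewrite dotv_mulmx sA => h.
have : dotv (A *m u) (A *m u) ^+ 2 == 0 by rewrite eq_le h sqr_ge0.
rewrite sqrf_eq0 dotvv_eq0 => /eqP Au; apply/eqP.
by rewrite -(mulKmx uA u) Au mulmx0.
Qed.

Lemma posdef_inv n (A : 'M[R]_n) : posdefmx A -> posdefmx (invmx A).
Proof.
move=> pA; have uA := posdef_unit pA; have [sA A0] := pA; split.
  by rewrite trmx_inv sA.
move=> u u0; have := A0 (invmx A *m u).
rewrite /qform mulKVmx// dotvC; apply.
by apply: contraNneq u0 => h; rewrite -(mulKVmx uA u) h mulmx0.
Qed.

(** The constant is the reciprocal of a bound on the inverse form: by
Cauchy-Schwarz for A, |u|^4 = (u, A (A^-1 u))^2 is at most (u, A u)(u, A^-1 u). *)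
Lemma posdef_coercive n (A : 'M[R]_n) : posdefmx A ->
  exists2 c, 0 < c & forall u, c * dotv u u <= qform A u.
Proof.
move=> pA; have uA := posdef_unit pA; have psA := posdef_psd pA.
set B := \sum_i \sum_j `|invmx A i j|.
have B0 : 0 <= B by do 2 (apply: sumr_ge0 => ? _).
exists (B + 1)^-1 => [|u]; first by rewrite invr_gt0; lra.
have [->|u0] := eqVneq u 0.
  by rewrite (eqP (_ : dotv 0 0 == 0)) ?dotvv_eq0// mulr0; apply: psA.2.
have d0 : 0 < dotv u u by rewrite dotvv_gt0.
have := psd_CauchySchwarz u (invmx A *m u) psA.
rewrite mulKVmx// (_ : qform A (invmx A *m u) = qform (invmx A) u); last first.
  by rewrite /qform mulKVmx// dotvC.
have := qform_abs_le (invmx A) u; rewrite -/B ler_norml => /andP[_ h1] h2.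
rewrite ler_pdivrMl; last by lra.
have A0 := psA.2 u.
have h3 : dotv u u ^+ 2 <= dotv u u * (B * qform A u).
  by rewrite (le_trans h2)// mulrC mulrA ler_wpM2r//; nra.
by move: h3; rewrite expr2 ler_pM2l//; lra.
Qed.

Lemma eigenvalue_bound n (A : 'M[R]_n) a : eigenvalue A a ->
  `|a| <= \sum_i \sum_j `|A i j|.
Proof.
move=> /eigenvalueP[v vA v0].
have u0 : v^T != 0 by rewrite -(trmx0) (inj_eq trmx_inj).
have d0 : 0 < dotv v^T v^T by rewrite dotvv_gt0.
have e : qform A v^T = a * dotv v^T v^T.
  rewrite /qform dotvC /dotv trmx_mul trmxK (_ : _ *m v^T = (v *m A *m v^T)^T).
    by rewrite vA -scalemxAl mxE mxE.
  by rewrite !trmx_mul trmxK mulmxA.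
have := qform_abs_le A v^T.
by rewrite e normrM (ger0_norm (ltW d0)) ler_pM2r.
Qed.

Lemma singular_eigenvalue n (A : 'M[R]_n) a :
  A - a%:M \notin unitmx -> eigenvalue A a.
Proof. by rewrite -row_free_unit -kermx_eq0. Qed.

(** The largest t for which A - t I is positive semidefinite is an eigenvalue:
otherwise A - t I would be coercive and t could be increased. *)
Lemma rayleigh n (A : 'M[R]_n) c : A^T = A ->
  (forall a, eigenvalue A a -> c <= a) -> forall u, c * dotv u u <= qform A u.
Proof.
move=> sA Ac u.
have [->|u0] := eqVneq u 0.
  by rewrite (eqP (_ : dotv 0 0 == 0)) ?dotvv_eq0// mulr0 /qform mulmx0 dotvE
     big1// => i _; rewrite mxE mul0r.
pose E := [set t | forall w, t * dotv w w <= qform A w].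
have Eub : has_ubound E.
  exists (qform A u / dotv u u) => t /(_ u).
  by rewrite ler_pdivlMr ?dotvv_gt0.
have E0 : E !=set0.
  exists (- \sum_i \sum_j `|A i j|) => w.
  by have := qform_abs_le A w; rewrite ler_norml mulNr => /andP[].
have supE : E (sup E).
  move=> w; have [->|w0] := eqVneq w 0.
    by rewrite (eqP (_ : dotv 0 0 == 0)) ?dotvv_eq0// mulr0 /qform mulmx0 dotvE
       big1// => i _; rewrite mxE mul0r.
  rewrite -ler_pdivlMr ?dotvv_gt0//; apply: sup_le_ub => // t /(_ w).
  by rewrite ler_pdivlMr ?dotvv_gt0.
have qB w : qform (A - (sup E)%:M) w = qform A w - sup E * dotv w w.
  by rewrite qformDm -scaleN1r qformZm qform_scalar mulN1r.
apply: le_trans (supE u); rewrite ler_wpM2r ?dotvv_ge0//; apply: Ac.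
apply: singular_eigenvalue; apply/negP => uB.
have : possemidefmx (A - (sup E)%:M).
  split=> [|w]; first by rewrite linearB /= sA tr_scalar_mx.
  by rewrite qB subr_ge0.
move=> /psd_unit_posdef/(_ uB)/posdef_coercive[e e0 He].
have : E (sup E + e) by move=> w; have := He w; rewrite qB; lra.
by move=> /(ub_le_sup Eub); lra.
Qed.

Lemma lambda_min_le n (A : 'M[R]_n) a : eigenvalue A a -> lambda_min A <= a.
Proof.
move=> Aa; apply: ge_inf => //.
exists (- \sum_i \sum_j `|A i j|) => b /= /eigenvalue_bound.
by rewrite ler_norml => /andP[].
Qed.

Lemma lambda_min_rayleigh n (A : 'M[R]_n) c : A^T = A -> c <= lambda_min A ->
  forall u, c * dotv u u <= qform A u.
Proof.
move=> sA cA; apply: rayleigh => // a Aa.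
exact: le_trans cA (lambda_min_le Aa).
Qed.

(** A spectral gap of the whitened matrix is a comparison of quadratic forms;
the square root exists because otherwise the default value 0 would make the
whitened matrix vanish. *)
Lemma whitened_lambda_min n (S M : 'M[R]_n) l : (0 < n)%N -> 0 < l ->
  posdefmx S -> M^T = M ->
  l < lambda_min (invsqrtmx S *m M *m invsqrtmx S) ->
  forall u, l * qform S u <= qform M u.
Proof.
move=> n0 l0 pS sM; rewrite /invsqrtmx /sqrtmx; case: xgetP => [B _ [pB BB]|_]; last first.
  have z0 : (0 : 'M[R]_n) \notin unitmx.
    by rewrite unitmxE; case: n n0 {S M pS sM} => // n _; rewrite det0 unitr0.
  rewrite invmx_out// mul0mx mul0mx => h.
  have : eigenvalue (0 : 'M[R]_n) 0.
    by apply: singular_eigenvalue; rewrite raddf0 subr0.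
  by move=> /lambda_min_le; lra.
move=> /ltW hl u.
have uB : B \in unitmx.
  have := posdef_unit pS; rewrite -BB !unitmxE det_mulmx.
  by rewrite unitrM andbb.
have [sB _] := pB.
have := lambda_min_rayleigh _ hl (B *m u).
rewrite !trmx_mul trmx_inv sB sM mulmxA => /(_ erefl).
have -> : qform (invmx B *m M *m invmx B) (B *m u) = qform M u.
  by rewrite /qform -!mulmxA mulKmx// dotv_mulmx trmx_inv sB mulKmx.
by rewrite -qform_gram sB BB.
Qed.

(** The matrix X S^-1 X^T is a contraction because S dominates X^T X; only the
image S^-1 X^T w of w enters, so no square root of S is needed. *)
Lemma gram_contraction m n (X : 'M[R]_(m, n)) (Q : 'M[R]_n) (w : 'cV[R]_m) :
  let S := X^T *m X + Q in
  possemidefmx Q -> S \in unitmx ->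
  qform S (invmx S *m (X^T *m w)) <= dotv w w.
Proof.
move=> S [sQ Q0] uS; set a := invmx S *m _.
have Sa : S *m a = X^T *m w by rewrite mulKVmx.
have h1 : qform S a = dotv (X *m a) w.
  by rewrite /qform Sa dotv_mulmx trmxK.
have h2 : dotv (X *m a) (X *m a) <= qform S a.
  by rewrite qformDm qform_gram lerDl.
have := dotvv_ge0 (X *m a - w).
rewrite dotvDl !dotvDr !dotvNl !dotvNr (dotvC w) -h1; lra.
Qed.

End linear_algebra.

(** * Integration: densities, Lebesgue measure and finite products *)

Section measure_toolbox.
Context {R : realType}.
Local Open Scope ereal_scope.

Import HBNNSimple.

(** Both sides are limits along simple approximations of g, where they agree
level set by level set. *)
Lemma ge0_integral_density d (T : measurableType d)
    (mu nu : {measure set T -> \bar R}) (f : T -> R) :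
  measurable_fun setT f -> (forall t, 0 <= f t)%R ->
  (forall A, measurable A -> nu A = \int[mu]_(x in A) (f x)%:E) ->
  forall g : T -> \bar R, measurable_fun setT g -> (forall t, 0 <= g t) ->
  \int[nu]_x g x = \int[mu]_x ((f x)%:E * g x).
Proof.
move=> mf f0 nuE g mg g0.
pose g_ := nnsfun_approx measurableT mg.
have mfE : measurable_fun setT (EFin \o f) by exact/measurable_EFinP.
transitivity (limn (fun n => \int[nu]_x (g_ n x)%:E)).
  rewrite -monotone_convergence//.
  - apply: eq_integral => y _; apply/esym/cvg_lim => //.
    by apply: cvg_nnsfun_approx => // *; apply: g0.
  - by move=> n; exact/measurable_EFinP/measurable_funP.
  - by move=> n y _; rewrite lee_fin.
  - by move=> y _ m n mn; rewrite lee_fin; exact/lefP/nd_nnsfun_approx.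
rewrite (_ : (fun n => _) =
    (fun n => \int[mu]_x ((f x)%:E * (g_ n x)%:E))); last first.
  apply/funext => n.
  transitivity (\sum_(k \in range (g_ n))
      \int[nu]_x (k * \1_(g_ n @^-1` [set k]) x)%:E).
    under eq_integral do rewrite fimfunE -fsumEFin//.
    rewrite ge0_integral_fsum//; last first.
    - by move=> y x _; rewrite nnfun_muleindic_ge0.
    - by move=> y; exact/measurable_EFinP/measurable_funM.
  transitivity (\sum_(k \in range (g_ n))
      \int[mu]_x ((f x)%:E * (k * \1_(g_ n @^-1` [set k]) x)%:E)).
    apply: eq_fsbigr => k /set_mem kr.
    have k0 : (0 <= k)%R by case: kr => x _ <-.
    rewrite integralZl_indic_nnsfun// integral_indic// setIT nuE//.
    rewrite -ge0_integralZl_EFin//; last 2 first.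
    - by move=> x _; rewrite lee_fin.
    - exact: measurable_funTS.
    rewrite integral_mkcond; apply: eq_integral => x _.
    rewrite patchE indicE; case: ifPn => xk; last by rewrite mulr0 mule0.
    by rewrite mulr1 muleC.
  rewrite -ge0_integral_fsum//.
  - apply: eq_integral => x _.
    rewrite fimfunE -fsumEFin// ge0_mule_fsumr// => k.
    exact: nnfun_muleindic_ge0.
  - move=> k; apply: emeasurable_funM => //.
    by apply/measurable_EFinP/measurable_funM => //; exact: measurable_indic.
  - move=> k x _; apply: mule_ge0; first by rewrite lee_fin.
    exact: nnfun_muleindic_ge0.
rewrite -monotone_convergence//.
- apply: eq_integral => y _; apply/cvg_lim => //.
  apply: cvgeZl => //; apply: cvg_nnsfun_approx => // *; exact: g0.
- move=> n; apply: emeasurable_funM => //.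
  exact/measurable_EFinP/measurable_funP.
- by move=> n y _; rewrite mule_ge0// lee_fin.
- move=> y _ m n mn; rewrite lee_wpmul2l ?lee_fin//.
  exact/lefP/nd_nnsfun_approx.
Qed.

Lemma lebesgue_measureD (a : R) (A : set R) : measurable A ->
  pushforward lebesgue_measure ((fun x => x + a)%R : _ -> measurableTypeR R) A
  = lebesgue_measure A.
Proof.
move=> mA.
have ma : measurable_fun setT ((fun x => x + a)%R : _ -> measurableTypeR R).
  exact: measurable_funD.
pose mm := isMeasurableFun.Build _ _ _ _ _ ma.
pose F : {mfun _ >-> _} := HB.pack (fun x : R => (x + a)%R : measurableTypeR R) mm.
apply/esym; apply: (@lebesgue_measure_unique R (pushforward lebesgue_measure F)) => //.
move=> _ [[b c]] _ <-.
have e : F @^-1` `]b, c]%classic = `](b - a)%R, (c - a)%R]%classic.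
  by apply/seteqP; split => x /=; rewrite !in_itv/= ltrBlDr lerBrDr.
rewrite -[RHS]/(lebesgue_measure (F @^-1` `]b, c]%classic)) e !lebesgue_measure_itv/= !lte_fin ltrD2r.
by case: ifPn => // _; rewrite -!EFinD; congr EFin; lra.
Qed.

Lemma ge0_integral_lebesgueD (a : R) (f : measurableTypeR R -> \bar R) :
  measurable_fun setT f -> (forall x, 0 <= f x) ->
  \int[lebesgue_measure]_x f (x + a)%R = \int[lebesgue_measure]_x f x.
Proof.
move=> mf f0.
have ma : measurable_fun setT
    ((fun x => x + a)%R : measurableTypeR R -> measurableTypeR R).
  exact: measurable_funD.
have := @ge0_integral_pushforward _ _ _ _ _ _ ma (@lebesgue_measure R) setT f
  measurableT mf (fun y _ => f0 y).
rewrite preimage_setT => <-; apply: eq_measure_integral => A mA _.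
exact: (lebesgue_measureD a mA).
Qed.

Lemma probability_half_lines (P1 P2 : probability (measurableTypeR R) R) :
  (forall t, P1 `]t, +oo[%classic = P2 `]t, +oo[%classic) ->
  forall A, measurable A -> P1 A = P2 A.
Proof.
move=> P12 A mA.
apply: (@measure_unique _ R (measurableTypeR R) (@RGenOInfty.G R)
  (fun n => `](- n%:R)%R, +oo[%classic)) => //.
- exact: RGenOInfty.measurableE.
- move=> _ _ [a ->] [b ->]; exists (Num.max a b).
  by apply/seteqP; split => x /=; rewrite !in_itv/= !andbT gt_max => /andP.
- by move=> n; exists (- n%:R)%R.
- apply/seteqP; split => // x _; exists (Num.bound `|x|%R) => //=.
  rewrite in_itv/= andbT ltrNl; apply: le_lt_trans (archi_boundP (normr_ge0 x)).
  by rewrite -normrN ler_norm.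
- by move=> _ [a ->]; exact: P12.
- by move=> n; rewrite (le_lt_trans (probability_le1 _ _)) ?ltry.
Qed.

Lemma integral_cst_mass1 d (T : measurableType d) (mu : {measure set T -> \bar R})
  (c : \bar R) : mu setT = 1 -> \int[mu]_x cst c x = c.
Proof. by move=> mu1; rewrite integral_cst// mu1 mule1. Qed.

Lemma ge0_integral_prod_measureS n
    (mu : 'I_n.+1 -> {sigma_finite_measure set (measurableTypeR R) -> \bar R})
    (f : 'cV[R]_n.+1 -> \bar R) :
  measurable_fun setT f -> (forall z, 0 <= f z) ->
  \int[prod_measure mu]_z f z =
  \int[mu ord0]_x \int[prod_measure (fun i => mu (lift ord0 i))]_v
    f (cons_cV (x, v)).
Proof.
move=> mf f0.
rewrite -[LHS]/(\int[pushforward (mu ord0 \x prod_measure (fun i => mu (lift ord0 i)))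
   (@cons_cV R n)]_z f z).
rewrite (ge0_integral_pushforward (@measurable_cons_cV R n))//.
rewrite preimage_setT fubini_tonelli1//.
  exact: (measurableT_comp mf (@measurable_cons_cV R n)).
by move=> z; exact: f0.
Qed.

Lemma measurable_prod_measureS n
    (mu : 'I_n.+1 -> {sigma_finite_measure set (measurableTypeR R) -> \bar R})
    (f : 'cV[R]_n.+1 -> \bar R) :
  measurable_fun setT f -> (forall z, 0 <= f z) ->
  measurable_fun setT (fun x =>
  \int[prod_measure (fun i => mu (lift ord0 i))]_v
    f (cons_cV (x, v))).
Proof.
move=> mf f0.
apply: (@measurable_fun_fubini_tonelli_F _ _ _ _ _ _ (fun z => f (cons_cV z))) => //.
exact: (measurableT_comp mf (@measurable_cons_cV R n)).
Qed.

Lemma ge0_integral_prod_measure0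
    (mu : 'I_0 -> {sigma_finite_measure set (measurableTypeR R) -> \bar R})
    (f : 'cV[R]_0 -> \bar R) :
  measurable_fun setT f -> (forall z, 0 <= f z) ->
  \int[prod_measure mu]_z f z = f 0%R.
Proof.
move=> mf f0.
change (\int[dirac (0 : 'cV[R]_0)%R]_z f z = f 0%R).
by rewrite integral_dirac// diracT mul1e.
Qed.

Lemma cons_cV0 n (x : R) (v : 'cV[R]_n) : cons_cV (x, v) ord0 ord0 = x.
Proof. by rewrite mxE unlift_none. Qed.

Lemma cons_cVS n (x : R) (v : 'cV[R]_n) i :
  cons_cV (x, v) (lift ord0 i) ord0 = v i ord0.
Proof. by rewrite mxE liftK. Qed.

Lemma measurable_cons_cVr n (x : measurableTypeR R) :
  measurable_fun setT (fun v : 'cV[R]_n => cons_cV (x, v)).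
Proof.
exact: (measurableT_comp (@measurable_cons_cV R n) (pair1_measurable x)).
Qed.

Lemma prod_measure_setT n
    (mu : 'I_n -> {sigma_finite_measure set (measurableTypeR R) -> \bar R}) :
  (forall i, mu i setT = 1) -> prod_measure mu setT = 1.
Proof.
elim: n mu => [|n IH] mu mu1.
  by change (dirac (0 : 'cV[R]_0)%R [set: 'cV[R]_0] = 1 :> \bar R); rewrite diracT.
rewrite -[LHS](mul1e) -integral_cst// ge0_integral_prod_measureS//.
transitivity (\int[mu ord0]_x (cst 1 x)); last exact/integral_cst_mass1/mu1.
apply: eq_integral => x _; rewrite -[RHS](IH (fun i => mu (lift ord0 i)))//.
by rewrite -[RHS]mul1e -integral_cst.
Qed.

Lemma integral_prod_measure_coord n
    (mu : 'I_n -> {sigma_finite_measure set (measurableTypeR R) -> \bar R}) i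
    (f : measurableTypeR R -> \bar R) :
  (forall i, mu i setT = 1) -> measurable_fun setT f -> (forall x, 0 <= f x) ->
  \int[prod_measure mu]_z f (z i ord0) = \int[mu i]_x f x.
Proof.
move=> mu1 mf f0; elim: n mu mu1 i => [|n IH] mu mu1 i; first by case: i.
rewrite (@ge0_integral_prod_measureS _ _ (fun z => f (z i ord0)))//; last first.
  by apply: (measurableT_comp mf); exact: measurable_mx_entry.
case: (unliftP ord0 i) => [j|] ->.
  transitivity (\int[mu ord0]_x (cst (\int[mu (lift ord0 j)]_x f x) x)); last exact/integral_cst_mass1/mu1.
  apply: eq_integral => x _; under eq_integral => v _ do rewrite cons_cVS.
  exact: (IH (fun i => mu (lift ord0 i))).
apply: eq_integral => x _.
under eq_integral => v _ do rewrite cons_cV0.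
by apply: (@integral_cst_mass1 _ _ _ (f x)); exact: prod_measure_setT.
Qed.

Lemma measurable_prodr_entry n (f : 'I_n -> measurableTypeR R -> R) :
  (forall i, measurable_fun setT (f i)) ->
  measurable_fun setT (fun z : 'cV[R]_n => \prod_i f i (z i ord0))%R.
Proof.
move=> mf; apply: measurable_prod => i _.
by apply: (measurableT_comp (mf i)); exact: measurable_mx_entry.
Qed.

Lemma ge0_integral_prod_measure_density n
    (mu : 'I_n -> {sigma_finite_measure set (measurableTypeR R) -> \bar R})
    (f : 'I_n -> measurableTypeR R -> R) (F : 'cV[R]_n -> \bar R) :
  (forall i, measurable_fun setT (f i)) -> (forall i x, 0 <= f i x)%R ->
  (forall i A, measurable A -> mu i A = \int[lebesgue_measure]_(x in A) (f i x)%:E) ->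
  measurable_fun setT F -> (forall z, 0 <= F z) ->
  \int[prod_measure mu]_z F z =
  \int[lebesgue_cV n]_z ((\prod_i f i (z i ord0))%:E * F z).
Proof.
elim: n mu f F => [|n IH] mu f F mf f0 muE mF F0.
  rewrite !ge0_integral_prod_measure0//.
  - by rewrite big_ord0 mul1e.
  - apply: emeasurable_funM => //; apply/measurable_EFinP.
    exact: measurable_prodr_entry.
  - by move=> z; rewrite mule_ge0// lee_fin prodr_ge0.
have mp k (g : 'I_k -> measurableTypeR R -> R) : (forall i, measurable_fun setT (g i)) ->
    measurable_fun setT (fun z : 'cV[R]_k => (\prod_i g i (z i ord0))%:E).
  by move=> mg; apply/measurable_EFinP; exact: measurable_prodr_entry.
rewrite ge0_integral_prod_measureS// [RHS]ge0_integral_prod_measureS//; last 2 first.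
- by apply: emeasurable_funM => //; exact: mp.
- by move=> z; rewrite mule_ge0// lee_fin prodr_ge0.
rewrite (ge0_integral_density (mf ord0) (f0 ord0) (muE ord0)); last 2 first.
- exact: measurable_prod_measureS.
- by move=> x; exact: integral_ge0.
apply: eq_integral => x _.
have mFx : measurable_fun setT (fun v => F (cons_cV (x, v))).
  exact: (measurableT_comp mF (measurable_cons_cVr x)).
rewrite (IH (fun i => mu (lift ord0 i)) (fun i => f (lift ord0 i)) _
  (fun i => mf _) (fun i => f0 _) (fun i => muE _) mFx)//.
rewrite -ge0_integralZl_EFin//; last 2 first.
- by move=> v _; rewrite mule_ge0// lee_fin prodr_ge0.
- by apply: emeasurable_funM => //; exact: (mp _ (fun i => f (lift ord0 i))).
apply: eq_integral => v _; rewrite muleA -EFinM big_ord_recl cons_cV0.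
congr ((_ * _)%:E * _); apply: eq_bigr => i _; congr (f _ _).
exact/esym/cons_cVS.
Qed.

Lemma measurable_col_map n (phi : 'I_n -> measurableTypeR R -> measurableTypeR R) :
  (forall i, measurable_fun setT (phi i)) ->
  measurable_fun setT (fun u : 'cV[R]_n => \col_i phi i (u i ord0))%R.
Proof.
move=> mphi; apply: measurable_fun_mxP => i j; under eq_fun do rewrite mxE.
by apply: (measurableT_comp (mphi i)); exact: measurable_mx_entry.
Qed.

Lemma ge0_integral_prod_measure_pushforward n
    (mu nu : 'I_n -> {sigma_finite_measure set (measurableTypeR R) -> \bar R})
    (phi : 'I_n -> measurableTypeR R -> measurableTypeR R) (F : 'cV[R]_n -> \bar R) :
  (forall i, measurable_fun setT (phi i)) ->
  (forall i A, measurable A -> mu i A = nu i (phi i @^-1` A)) ->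
  measurable_fun setT F -> (forall z, 0 <= F z) ->
  \int[prod_measure mu]_z F z =
  \int[prod_measure nu]_u F (\col_i phi i (u i ord0))%R.
Proof.
elim: n mu nu phi F => [|n IH] mu nu phi F mphi muE mF F0.
  rewrite !ge0_integral_prod_measure0//; first by congr F; apply/colP => -[].
  by apply: (measurableT_comp mF); exact: measurable_col_map.
rewrite ge0_integral_prod_measureS// [RHS]ge0_integral_prod_measureS//; last first.
  by apply: (measurableT_comp mF); exact: measurable_col_map.
set G := fun x => _.
transitivity (\int[nu ord0]_x G (phi ord0 x)).
  have := @ge0_integral_pushforward _ _ _ _ _ _ (mphi ord0) (nu ord0) setT G
    measurableT.
  rewrite preimage_setT => <-.
  - by apply: eq_measure_integral => A mA _; exact: muE.
  - exact: measurable_prod_measureS.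
  - by move=> x _; exact: integral_ge0.
apply: eq_integral => x _; rewrite /G.
rewrite (IH (fun i => mu (lift ord0 i)) (fun i => nu (lift ord0 i))
  (fun i => phi (lift ord0 i)) _ (fun i => mphi _) (fun i => muE _)
  (measurableT_comp mF (measurable_cons_cVr _)) (fun=> F0 _)).
apply: eq_integral => v _; congr F; apply/colP => i; rewrite !mxE.
by case: (unliftP ord0 i) => [j|] ->; rewrite ?cons_cV0 ?cons_cVS// mxE.
Qed.

Lemma ge0_integral_lebesgue_cVD n (a : 'cV[R]_n) (F : 'cV[R]_n -> \bar R) :
  measurable_fun setT F -> (forall z, 0 <= F z) ->
  \int[lebesgue_cV n]_z F (z + a)%R = \int[lebesgue_cV n]_z F z.
Proof.
move=> mF F0.
rewrite [RHS](@ge0_integral_prod_measure_pushforward _ _ (fun=> lebesgue_measure)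
  (fun i x => (x + a i ord0)%R)) //.
- apply: eq_integral => z _; congr F; apply/colP => i; by rewrite !mxE.
- by move=> i; exact: measurable_funD.
- by move=> i A mA; exact/esym/(lebesgue_measureD (a i ord0) mA).
Qed.

End measure_toolbox.

Section density_measure.
Context d (T : measurableType d) {R : realType}.
Variables (mu : {measure set T -> \bar R}) (f : T -> R).
Hypotheses (mf : measurable_fun setT f) (f0 : forall t, 0 <= f t).
Local Open Scope ereal_scope.

Definition density_measure of measurable_fun setT f & (forall t, (0 <= f t)%R) :
  set T -> \bar R := fun A => \int[mu]_(x in A) (f x)%:E.

Local Notation nu := (density_measure mf f0).

Let nu0 : nu set0 = 0.
Proof. exact: integral_set0. Qed.

Let nu_ge0 A : 0 <= nu A.
Proof. by apply: integral_ge0 => x _; rewrite lee_fin. Qed.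

Let nu_sigma_additive : semi_sigma_additive nu.
Proof.
move=> /= F mF tF mUF; rewrite /density_measure ge0_integral_bigcup//=.
- by apply: is_cvg_ereal_nneg_natsum_cond => k _ _; exact: nu_ge0.
- by apply: measurable_funTS; exact/measurable_EFinP.
- by move=> x _; rewrite lee_fin.
Qed.

HB.instance Definition _ := isMeasure.Build _ _ _ nu nu0 nu_ge0 nu_sigma_additive.

End density_measure.

(** * The standard normal distribution function *)

Section normal_distribution_function.
Context {R : realType}.
Local Notation mu := (@lebesgue_measure R).
Local Notation Phi := (@normal_cdf R).

Lemma normal_pdf1E (m x : R) :
  normal_pdf m 1 x = normal_peak 1 * expR (- (x - m) ^+ 2 / 2).
Proof. by rewrite normal_pdfE ?oner_neq0// /normal_fun expr1n. Qed.

Lemma normal_peak1_gt0 : 0 < normal_peak (1 : R).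
Proof. by rewrite normal_peak_gt0// oner_neq0. Qed.

Lemma normal_pdf1_gt0 (m x : R) : 0 < normal_pdf m 1 x.
Proof. by rewrite normal_pdf1E mulr_gt0// ?expR_gt0// normal_peak1_gt0. Qed.

Lemma measurable_normal_pdf_EFin (m : R) (A : set R) :
  measurable_fun A (fun x => (normal_pdf m 1 x)%:E).
Proof. by apply/measurable_EFinP/measurable_funTS; exact: measurable_normal_pdf. Qed.
#[local] Hint Resolve measurable_normal_pdf_EFin : core.

Lemma normal_prob_integral (m : R) A :
  normal_prob m 1 A = (\int[mu]_(x in A) (normal_pdf m 1 x)%:E)%E.
Proof. by []. Qed.

Lemma normal_pdf_shift (m a x : R) : normal_pdf (m + a) 1 (x + a) = normal_pdf m 1 x.
Proof. by rewrite !normal_pdf1E opprD addrACA subrr addr0. Qed.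

Lemma normal_pdf_opp (m x : R) : normal_pdf (- m) 1 (- x) = normal_pdf m 1 x.
Proof. by rewrite !normal_pdf1E -opprD sqrrN. Qed.

Lemma normal_prob_translate (m a : R) (A : set R) : measurable A ->
  normal_prob (m + a) 1 A = normal_prob m 1 ((fun x => x + a) @^-1` A).
Proof.
move=> mA; rewrite !normal_prob_integral [LHS]integral_mkcond [RHS]integral_mkcond.
rewrite -[LHS](ge0_integral_lebesgueD a).
- apply: eq_integral => x _; rewrite !patchE.
  rewrite (_ : (x \in _ @^-1` A) = (x + a \in A)); last first.
    by apply/idP/idP; rewrite !inE.
  by rewrite normal_pdf_shift.
- exact/(measurable_restrictT _ mA).
- by apply: erestrict_ge0 => x _; rewrite lee_fin normal_pdf_ge0.
Qed.

Lemma normal_prob_reflect (m : R) (A : set R) : measurable A ->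
  normal_prob (- m) 1 A = normal_prob m 1 (-%R @^-1` A).
Proof.
move=> mA; rewrite !normal_prob_integral [LHS]integral_mkcond [RHS]integral_mkcond.
have mN : measurable_fun setT ((fun x => - x) : measurableTypeR R -> measurableTypeR R).
  exact: oppr_measurable.
pose f : measurableTypeR R -> \bar R := (fun x => (normal_pdf (- m) 1 x)%:E) \_ A.
rewrite -[LHS]/(\int[mu]_x f x)%E.
have mf : measurable_fun [set: measurableTypeR R] f.
  exact/(measurable_restrictT _ mA).
have f0 x : (0 <= f x)%E.
  by apply: erestrict_ge0 => y _; rewrite lee_fin normal_pdf_ge0.
have := @ge0_integral_pushforward _ _ _ _ _ _ mN mu setT f measurableT mf
  (fun y _ => f0 y).
rewrite preimage_setT => e.
transitivity (\int[pushforward mu (-%R : measurableTypeR R -> measurableTypeR R)]_y f y)%E.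
  by apply: eq_measure_integral => B mB _; exact/esym/lebesgue_measureN.
rewrite e; apply: eq_integral => x _; rewrite /f /= !patchE.
rewrite (_ : (x \in _ @^-1` A) = (- x \in A)); last first.
  by apply/idP/idP; rewrite !inE.
by rewrite normal_pdf_opp.
Qed.

Lemma le_normal_prob (m m' r : R) (A : set R) : measurable A -> 0 <= r ->
  (forall x, A x -> normal_pdf m 1 x <= r * normal_pdf m' 1 x) ->
  (normal_prob m 1 A <= r%:E * normal_prob m' 1 A)%E.
Proof.
move=> mA r0 h; rewrite !normal_prob_integral -ge0_integralZl_EFin//; last 2 first.
- by move=> x _; rewrite lee_fin normal_pdf_ge0.
- exact: measurable_normal_pdf_EFin.
apply: ge0_le_integral => //.
- by move=> x _; rewrite lee_fin normal_pdf_ge0.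
- exact: measurable_normal_pdf_EFin.
- by apply: measurable_funeM; exact: measurable_normal_pdf_EFin.
Qed.

Lemma normal_prob_le (c : R) (A : set R) : measurable A ->
  (forall x, A x -> normal_pdf 0 1 x <= c) ->
  (normal_prob 0 1 A <= c%:E * mu A)%E.
Proof.
move=> mA h; rewrite -integral_cst// normal_prob_integral.
apply: ge0_le_integral => //.
- by move=> x _; rewrite lee_fin normal_pdf_ge0.
- exact: measurable_normal_pdf_EFin.
Qed.

Lemma normal_prob_ge (c : R) (A : set R) : measurable A -> 0 <= c ->
  (forall x, A x -> c <= normal_pdf 0 1 x) ->
  (c%:E * mu A <= normal_prob 0 1 A)%E.
Proof.
move=> mA c0 h; rewrite -integral_cst// normal_prob_integral.
apply: ge0_le_integral => //.
- exact: measurable_normal_pdf_EFin.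
Qed.

Lemma Phi_fin t : (Phi t)%:E = normal_prob 0 1 `]-oo, t]%classic.
Proof. by rewrite fineK// fin_num_measure. Qed.

Lemma PhiD (m t : R) : (Phi (t + m))%:E = normal_prob (- m) 1 `]-oo, t]%classic.
Proof.
rewrite Phi_fin -(add0r (- m)) normal_prob_translate//; congr normal_prob.
by apply/seteqP; split => x /=; rewrite !in_itv/= lerBlDr.
Qed.

Lemma Phi_itv (a b : R) : a <= b ->
  (Phi b - Phi a)%:E = normal_prob 0 1 `]a, b]%classic.
Proof.
move=> ab; rewrite EFinB !Phi_fin -[X in (X - _)%E = _](_ :
  (normal_prob 0 1 `]-oo, a]%classic + normal_prob 0 1 `]a, b]%classic)%E = _).
  by rewrite [X in (X - _)%E]addeC addeK// fin_num_measure.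
rewrite -measureU//; last first.
  by apply/seteqP; split => // x /=; rewrite !in_itv/= => -[xa /andP[/lt_le_trans/(_ xa)]]; rewrite ltxx.
congr normal_prob; apply/seteqP; split => x /=; rewrite !in_itv/=.
  by move=> [xa|/andP[//]]; exact: le_trans ab.
by move=> ->; rewrite andbT; case: (leP x a) => ?; [left|right].
Qed.

Lemma lebesgue_oc (a b : R) : a <= b -> mu `]a, b]%classic = (b - a)%:E.
Proof.
rewrite le_eqVlt => /orP[/eqP ->|ab].
  by rewrite set_itv_ge ?measure0 ?subrr// bnd_simp ltxx.
by rewrite lebesgue_measure_itv/= lte_fin ab -EFinD.
Qed.

Lemma Phi_incr_le (a b c : R) : a <= b ->
  (forall x, a < x <= b -> normal_pdf 0 1 x <= c) -> Phi b - Phi a <= c * (b - a).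
Proof.
move=> ab h; rewrite -lee_fin Phi_itv// EFinM -lebesgue_oc//.
by apply: normal_prob_le => // x /=; rewrite in_itv/=; exact: h.
Qed.

Lemma Phi_incr_ge (a b c : R) : a <= b -> 0 <= c ->
  (forall x, a < x <= b -> c <= normal_pdf 0 1 x) -> c * (b - a) <= Phi b - Phi a.
Proof.
move=> ab c0 h; rewrite -lee_fin Phi_itv// EFinM -lebesgue_oc//.
by apply: normal_prob_ge => // x /=; rewrite in_itv/=; exact: h.
Qed.

Lemma Phi_lt (a b : R) : a < b -> Phi a < Phi b.
Proof.
move=> ab; rewrite -subr_gt0.
pose c := normal_peak 1 * expR (- (a ^+ 2 + b ^+ 2) / 2) : R.
have c0 : 0 < c by rewrite mulr_gt0// ?expR_gt0// normal_peak1_gt0.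
apply: lt_le_trans (Phi_incr_ge (ltW ab) (ltW c0) _).
  by rewrite mulr_gt0// subr_gt0.
move=> x /andP[ax xb]; rewrite normal_pdf1E ler_pM2l ?normal_peak1_gt0//.
rewrite ler_expR subr0; have [x0|x0] := leP 0 x; nra.
Qed.

Lemma Phi_mono : {mono Phi : a b / a <= b}.
Proof. exact/le_mono/Phi_lt. Qed.

Lemma Phi_smono : {mono Phi : a b / a < b}.
Proof. exact/leW_mono/Phi_mono. Qed.

Lemma Phi_ge0 t : 0 <= Phi t.
Proof. by rewrite fine_ge0. Qed.

Lemma Phi_gt0 t : 0 < Phi t.
Proof. by apply: le_lt_trans (Phi_ge0 (t - 1)) _; apply: Phi_lt; lra. Qed.

Lemma Phi_le1 t : Phi t <= 1.
Proof. by rewrite -lee_fin Phi_fin probability_le1. Qed.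

Lemma Phi_lt1 t : Phi t < 1.
Proof. by apply: lt_le_trans (Phi_le1 (t + 1)); apply: Phi_lt; lra. Qed.

Lemma continuous_Phi : continuous Phi.
Proof.
have lip a b : a <= b -> Phi b - Phi a <= normal_peak 1 * (b - a).
  by move=> ab; apply: Phi_incr_le => // x _; rewrite normal_pdf_ub ?oner_neq0.
move=> x; apply/cvgrPdist_le => e e0; have P0 := @normal_peak1_gt0.
apply/nbhs_ballP; exists (e / normal_peak 1) => [/=|y]; first by rewrite divr_gt0.
rewrite /ball_/= ltr_pdivlMr// mulrC => /ltW h.
apply: le_trans h; case: (leP y x) => yx.
  by rewrite !ger0_norm ?subr_ge0 ?Phi_mono//; exact: lip.
rewrite distrC [X in _ * X]distrC !ger0_norm ?subr_ge0 ?Phi_mono ?(ltW yx)//.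
exact: (lip _ _ (ltW yx)).
Qed.

Lemma Phi_reflect t : 1 - Phi t = Phi (- t).
Proof.
have e : normal_prob 0 1 `]-oo, t[%classic = (Phi t)%:E.
  rewrite Phi_fin !normal_prob_integral.
  by rewrite integral_itv_bndo_bndc.
apply: EFin_inj; rewrite EFinB -e -probability_setC// setCitvl Phi_fin.
rewrite -[in RHS]oppr0 normal_prob_reflect//; congr normal_prob.
by apply/seteqP; split => x /=; rewrite !in_itv/= andbT lerN2.
Qed.

(** For x <= 0 the density at x - t is at most exp(- t^2 / 2) times the density
at x. *)
Lemma Phi_tail t : 0 <= t -> Phi (- t) <= expR (- t ^+ 2 / 2).
Proof.
move=> t0; rewrite -lee_fin -(add0r (- t)) (PhiD (- t) 0) opprK.
apply: (@le_trans _ _ ((expR (- t ^+ 2 / 2))%:E * normal_prob 0 1 `]-oo, 0%R]%classic)%E).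
  apply: le_normal_prob; rewrite ?expR_ge0// => x /=; rewrite in_itv/= => x0.
  rewrite !normal_pdf1E mulrCA ler_pM2l ?normal_peak1_gt0// -expRD ler_expR.
  nra.
by rewrite -[leRHS]mule1 lee_wpmul2l ?lee_fin ?expR_ge0// probability_le1.
Qed.

(** Log-concavity of Phi.  The densities of N(-d, 1) and N(0, 1) have a
decreasing ratio; its value at q separates the two intervals. *)
Lemma Phi_logconcave (q m d : R) : q <= m -> 0 <= d ->
  Phi q * Phi (m + d) <= Phi (q + d) * Phi m.
Proof.
move=> qm d0; pose r := expR (- d * q - d ^+ 2 / 2).
have r0 : 0 <= r by exact: expR_ge0.
have pdfE x : normal_pdf (- d) 1 x =
    expR (- d * x - d ^+ 2 / 2) * normal_pdf 0 1 x.
  rewrite !normal_pdf1E mulrCA -expRD; congr (_ * expR _); lra.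
have h1 : r * Phi q <= Phi (q + d).
  rewrite mulrC -ler_pdivlMr ?expR_gt0// mulrC -lee_fin EFinM (PhiD d q) Phi_fin.
  apply: le_normal_prob; rewrite ?invr_ge0// => x /=; rewrite in_itv/= => xq.
  rewrite -ler_pdivrMl ?invr_gt0 ?expR_gt0// invrK pdfE.
  by rewrite ler_wpM2r ?normal_pdf_ge0// ler_expR lerD2r; nra.
have h2 : Phi (m + d) - Phi (q + d) <= r * (Phi m - Phi q).
  rewrite -lee_fin EFinB (PhiD d m) (PhiD d q) EFinM Phi_itv//.
  have -> : (normal_prob (- d) 1 `]-oo, m] - normal_prob (- d) 1 `]-oo, q] =
     normal_prob (- d) 1 `]q, m])%E.
    transitivity (Phi (m + d) - Phi (q + d))%:E.
      by rewrite EFinB (PhiD d m) (PhiD d q).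
    have qmd : q + d <= m + d by rewrite lerD2r.
    rewrite (Phi_itv qmd).
    have := @normal_prob_translate 0 (- d) `]q, m]%classic (measurable_itv _).
    rewrite add0r => ->; congr normal_prob.
    by apply/seteqP; split => x /=; rewrite !in_itv/= ltrBrDr lerBlDr.
  apply: le_normal_prob => // x /=; rewrite in_itv/= => /andP[qx xm].
  rewrite pdfE ler_wpM2r ?normal_pdf_ge0// ler_expR lerD2r; nra.
have P0 := Phi_ge0 q; have P1 : 0 <= Phi m - Phi q by rewrite subr_ge0 Phi_mono.
nra.
Qed.

Lemma normal_pdf_incr (a b : R) : a <= b -> b <= 0 ->
  normal_pdf 0 1 a <= normal_pdf 0 1 b.
Proof.
move=> ab b0; rewrite !normal_pdf1E ler_pM2l ?normal_peak1_gt0// ler_expR !subr0.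
nra.
Qed.

(** On the negative half-line Phi is convex: its slope over an interval lies
between the densities at the end points, and slopes increase to the right. *)
Lemma Phi_slope (q' q m' m u : R) : 0 < u -> q' <= m' -> q <= m -> q' <= q ->
  m' <= m -> m <= 0 -> Phi q - Phi q' = u * (Phi m - Phi m') ->
  u * (m - m') <= q - q'.
Proof.
move=> u0 qm' qm qq mm m0 e.
have up a b : a <= b -> b <= 0 -> Phi b - Phi a <= normal_pdf 0 1 b * (b - a).
  move=> ab b0; apply: Phi_incr_le => // x /andP[_ xb].
  exact: normal_pdf_incr.
have dn a b : a <= b -> b <= 0 -> normal_pdf 0 1 a * (b - a) <= Phi b - Phi a.
  move=> ab b0; apply: Phi_incr_ge; rewrite ?normal_pdf_ge0// => x /andP[ax xb].
  by apply: normal_pdf_incr; [exact: ltW|exact: le_trans b0].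
have [qm1|qm1] := leP q m'.
  have f0 : 0 < normal_pdf 0 1 m' by exact: normal_pdf1_gt0.
  have h1 := up _ _ qq (le_trans qm m0); have h2 := dn _ _ mm m0.
  have h3 := normal_pdf_incr qm1 (le_trans mm m0).
  rewrite -(ler_pM2l f0); apply: (@le_trans _ _ (u * (Phi m - Phi m'))).
    by rewrite mulrCA ler_pM2l.
  by rewrite -e (le_trans h1)// ler_wpM2r// subr_ge0.
have q0 := le_trans qm m0; have m'0 := le_trans mm m0.
have hA := up _ _ qm' m'0; have hB := up _ _ (ltW qm1) q0.
have hB' := dn _ _ (ltW qm1) q0; have hC := dn _ _ qm m0.
pose s := (Phi q - Phi m') / (q - m').
have qm0 : 0 < q - m' by rewrite subr_gt0.
have sE : Phi q - Phi m' = s * (q - m') by rewrite divfK// gt_eqF.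
have s1 : normal_pdf 0 1 m' <= s by rewrite -(ler_pM2r qm0) -sE.
have s2 : s <= normal_pdf 0 1 q by rewrite -(ler_pM2r qm0) -sE.
have s0 : 0 < s by apply: lt_le_trans s1; exact: normal_pdf1_gt0.
have hA2 : Phi m' - Phi q' <= s * (m' - q').
  by apply: (le_trans hA); rewrite ler_wpM2r// subr_ge0.
have hC2 : s * (m - q) <= Phi m - Phi q.
  by apply: le_trans hC; rewrite ler_wpM2r// subr_ge0.
rewrite -(ler_pM2l s0) mulrCA.
have -> : s * (m - m') = s * (m - q) + s * (q - m') by ring.
have -> : s * (q - q') = s * (q - m') + s * (m' - q') by ring.
rewrite -sE; apply: (@le_trans _ _ (u * (Phi m - Phi m'))).
  by rewrite ler_pM2l// -[leRHS](subrKA (Phi q)) lerD2r.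
by rewrite -e -[leLHS](subrKA (Phi m')) lerD2l.
Qed.

End normal_distribution_function.

(** * Monotone coupling of truncated normal laws *)

Section truncated_normal_coupling.
Context {R : realType}.
Local Notation Phi := (@normal_cdf R).

Lemma Phi_small (s t : R) : 0 < s -> s^-1 <= t -> Phi (- t) <= s.
Proof.
move=> s0 st; have t0 : 0 < t by apply: lt_le_trans st; rewrite invr_gt0.
apply: (le_trans (Phi_tail (ltW t0))).
rewrite mulNr expRN -[leRHS]invrK lef_pV2 ?posrE ?expR_gt0 ?invr_gt0//.
apply: (le_trans st); apply: (le_trans _ (expR_ge1Dx _)).
have := sqr_ge0 (t - 1); rewrite sqrrB; lra.
Qed.

Lemma Phi_surj (s : R) : 0 < s < 1 -> exists q, Phi q = s.
Proof.
move=> /andP[s0 s1].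
pose t := s^-1 + (1 - s)^-1.
have i0 : 0 < s^-1 by rewrite invr_gt0.
have i1 : 0 < (1 - s)^-1 by rewrite invr_gt0 subr_gt0.
have [|||q _ qs] := @IVT R Phi (- t) t s; last by exists q.
- by rewrite /t; lra.
- by apply: continuous_subspaceT => x; exact: continuous_Phi.
- rewrite ge_min le_max; apply/andP; split; apply/orP; [left|right].
    by apply: Phi_small => //; rewrite /t; lra.
  have : Phi (- t) <= 1 - s by apply: Phi_small; rewrite ?subr_gt0// /t; lra.
  by rewrite -Phi_reflect; lra.
Qed.

(** The value 0 outside the open unit interval is a default. *)
Definition normal_quantile (s : R) : R := xget 0 [set q | Phi q = s].

Lemma PhiK (q : R) : normal_quantile (Phi q) = q.
Proof.
rewrite /normal_quantile; case: xgetP => [r _ /= rq|/(_ q erefl)//].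
by apply: (inc_inj Phi_mono).
Qed.

Lemma normal_quantileK (s : R) : 0 < s < 1 -> Phi (normal_quantile s) = s.
Proof. by move=> /Phi_surj[q <-]; rewrite PhiK. Qed.

Lemma measurable_normal_quantile : measurable_fun setT normal_quantile.
Proof.
have -> : normal_quantile = (normal_quantile \_ `]0, 1[%classic).
  apply/funext => s; rewrite patchE; case: ifPn => // sn.
  rewrite /normal_quantile; case: xgetP => // q _ qs; exfalso; move/negP: sn; apply.
  by rewrite inE/= in_itv/= -qs Phi_gt0 Phi_lt1.
apply/(measurable_restrictT _ (measurable_itv _)).
apply: (measurability (@RGenOInfty.G R)) => [|_ [_ [t ->] <-]].
  exact: RGenOInfty.measurableE.
rewrite (_ : _ `&` _ = `]Phi t, 1[%classic); first exact: measurable_itv.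
apply/seteqP; split => s /=; rewrite !in_itv/= andbT.
  by move=> [/[dup] s01 /Phi_surj[q <-]]; rewrite PhiK Phi_smono Phi_lt1 andbT.
move=> /andP[ts s1]; have s0 : 0 < s by exact: lt_trans (Phi_gt0 t) ts.
split; first by rewrite s0.
by rewrite -Phi_smono normal_quantileK ?s0.
Qed.

(** If Z has law N(m, 1) conditioned to be positive, the probability of Z > t
is Phi (m - t) / Phi m for t >= 0: this is Z as a decreasing function of a uniform
variable u.  Outside the unit interval the value m is a default for which
the contraction estimates below still hold. *)
Definition tn_pos (m u : R) : R :=
  if 0 < u <= 1 then m - normal_quantile (u * Phi m) else m.

Lemma tn_quantile_range (m u : R) : 0 < u <= 1 -> 0 < u * Phi m < 1.
Proof.
move=> /andP[u0 u1]; rewrite mulr_gt0 ?Phi_gt0//=.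
by rewrite (le_lt_trans _ (Phi_lt1 m))// ler_piMl ?Phi_ge0.
Qed.

Lemma tn_posE (m u : R) : 0 < u <= 1 ->
  exists2 q, tn_pos m u = m - q & Phi q = u * Phi m.
Proof.
move=> u01; rewrite /tn_pos u01.
by exists (normal_quantile (u * Phi m)) => //; rewrite normal_quantileK ?tn_quantile_range.
Qed.

(** Log-concavity of the normal distribution function makes m - q
nondecreasing in m, monotonicity makes q nondecreasing. *)
Lemma tn_pos_incr (m m' u : R) : m' <= m ->
  0 <= tn_pos m u - tn_pos m' u <= m - m'.
Proof.
move=> mm; have [u01|u01] := boolP (0 < u <= 1); last first.
  by rewrite /tn_pos (negbTE u01); lra.
have [q -> qE] := tn_posE m u01; have [q' -> q'E] := tn_posE m' u01.
have /andP[u0 u1] := u01.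
have qq : q' <= q by rewrite -Phi_mono qE q'E ler_pM2l// Phi_mono.
suff qd : q <= q' + (m - m') by lra.
have qm' : q' <= m'.
  by rewrite -Phi_mono q'E ler_piMl ?Phi_ge0.
have d0 : 0 <= m - m' by rewrite subr_ge0.
rewrite -Phi_mono -(ler_pM2r (Phi_gt0 m')).
apply: le_trans (Phi_logconcave qm' d0).
by rewrite qE q'E addrC subrK -!mulrA [Phi m * _]mulrC.
Qed.

(** Half of the segment lies where Phi is convex; there q increases at least at
rate u. *)
Lemma tn_pos_contract (m m' u : R) : m' <= m -> m + m' <= 0 -> 1 / 2 <= u <= 1 ->
  tn_pos m u - tn_pos m' u <= 3 / 4 * (m - m').
Proof.
move=> mm mm0 /andP[u2 u1]; have u01 : 0 < u <= 1 by lra.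
pose k := Num.min m 0.
have k0 : k <= 0 by rewrite /k ge_min lexx orbT.
have km : k <= m by rewrite /k ge_min lexx.
have mk : m' <= k by rewrite /k le_min mm/=; lra.
have kd : m - m' <= 2 * (k - m').
  by rewrite /k; case: (leP m 0) => m0; rewrite ?(min_idPl m0) ?(min_idPr (ltW m0)); lra.
have /andP[h1 h2] := tn_pos_incr u km.
suff h3 : tn_pos k u - tn_pos m' u <= (1 - u) * (k - m') by nra.
have [q -> qE] := tn_posE k u01; have [q' -> q'E] := tn_posE m' u01.
have qq : q' <= q by rewrite -Phi_mono qE q'E ler_pM2l ?Phi_mono//; lra.
have le_of x r : Phi r = u * Phi x -> r <= x.
  by move=> h; rewrite -Phi_mono h ler_piMl ?Phi_ge0.
have u0 : 0 < u by lra.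
have := Phi_slope u0 (le_of _ _ q'E) (le_of _ _ qE) qq mk k0.
by rewrite qE q'E mulrBr => /(_ erefl); lra.
Qed.

Definition tn_map (a : bool) (m u : R) : R :=
  if a then tn_pos m u else - tn_pos (- m) u.

(** Ties count for both labels, so that the zero vector misclassifies every
observation. *)
Definition misclassified (a : bool) (m : R) : bool :=
  if a then m <= 0 else 0 <= m.

Lemma tn_map_sqr_le (a : bool) (m m' u : R) :
  (tn_map a m u - tn_map a m' u) ^+ 2 <= (m - m') ^+ 2.
Proof.
have h r r' : (tn_pos r u - tn_pos r' u) ^+ 2 <= (r - r') ^+ 2.
  wlog rr : r r' / r' <= r => [hw|].
    by have [|/ltW] := leP r' r => /hw//; rewrite -sqrrN opprB -[leRHS]sqrrN opprB.
  by have /andP[] := tn_pos_incr u rr; nra.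
rewrite /tn_map; case: a => //.
by have := h (- m) (- m'); rewrite -opprD sqrrN -opprD sqrrN.
Qed.

(** For u at least 1 / 2 the distance shrinks by 3 / 4, hence its square at least
by 3 / 4 = 1 - 1 / 4. *)
Lemma tn_map_sqr_contract (a : bool) (m m' u : R) : misclassified a ((m + m') / 2) ->
  (tn_map a m u - tn_map a m' u) ^+ 2 <=
    (1 - \1_`[1 / 2, 1] u / 4) * (m - m') ^+ 2.
Proof.
move=> mis; rewrite indicE; case: (boolP (u \in _)) => [|_]; last first.
  by rewrite mul0r subr0 mul1r tn_map_sqr_le.
rewrite inE/= in_itv/= => u12; rewrite mulr1n.
have h r r' : r + r' <= 0 -> (tn_pos r u - tn_pos r' u) ^+ 2 <= 3 / 4 * (r - r') ^+ 2.
  wlog rr : r r' / r' <= r => [hw|].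
    have [|/ltW] := leP r' r => /hw//.
    by rewrite addrC -[(tn_pos r' u - _) ^+ 2]sqrrN -[(r' - r) ^+ 2]sqrrN !opprB.
  move=> r0; have := tn_pos_contract rr r0 u12.
  by have /andP[] := tn_pos_incr u rr; nra.
move: mis; rewrite /tn_map /misclassified; case: a => mis.
  by have := h m m'; rewrite (_ : 1 - 1 / 4 = 3 / 4 :> R); [apply; lra|lra].
have := h (- m) (- m').
rewrite (_ : (- m - - m') ^+ 2 = (m - m') ^+ 2); last by ring.
rewrite (_ : (- _ - - _) ^+ 2 = (tn_pos (- m) u - tn_pos (- m') u) ^+ 2); last by ring.
by rewrite (_ : 1 - 1 / 4 = 3 / 4 :> R); [apply; lra|lra].
Qed.

Lemma measurable_tn_map (a : bool) :
  measurable_fun setT (fun z : measurableTypeR R * measurableTypeR R => tn_map a z.1 z.2).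
Proof.
have mPhi : measurable_fun setT Phi.
  by apply: continuous_measurable_fun; exact: continuous_Phi.
have h d (T : measurableType d) (f g : T -> R) : measurable_fun setT f ->
    measurable_fun setT g -> measurable_fun setT (fun t => tn_pos (f t) (g t)).
  move=> mf mg; apply: measurable_fun_ifT => //.
  - apply: measurable_and.
      by apply: measurable_fun_ltr => //; exact: measurable_cst.
    by apply: measurable_fun_ler => //; exact: measurable_cst.
  - apply: measurable_funB => //; apply: (measurableT_comp measurable_normal_quantile).
    by apply: measurable_funM => //; exact: measurableT_comp.
case: a; rewrite /tn_map; first by apply: h; [exact: measurable_fst|exact: measurable_snd].
apply: measurable_funN; apply: h; last exact: measurable_snd.
by apply: measurable_funN; exact: measurable_fst.
Qed.

Definition unif : probability (measurableTypeR R) R := uniform_prob (@ltr01 R).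

Lemma unifE (A : set (measurableTypeR R)) : measurable A ->
  unif A = lebesgue_measure (A `&` `[0, 1]%classic).
Proof.
move=> mA; rewrite /unif/= /uniform_prob integral_uniform_pdf.
rewrite (eq_integral (cst 1%E)) => [|x /set_mem[_]/=].
  by rewrite integral_cst ?mul1e//; exact: measurableI.
by rewrite in_itv/= /uniform_pdf => ->; rewrite subr0 invr1.
Qed.

Lemma normal_prob_right_tail (m t : R) :
  normal_prob m 1 `]t, +oo[%classic = (Phi (m - t))%:E.
Proof.
rewrite -[LHS](_ : normal_prob m 1 (~` `]-oo, t]%classic) = _); last by rewrite setCitvl.
have := PhiD (- m) t; rewrite opprK => e.
rewrite probability_setC// -[X in (1 - X)%E]e -EFinB Phi_reflect.
by rewrite opprD opprK addrC.
Qed.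

Lemma mnormalize_mass d (T : measurableType d) (mu : {measure set T -> \bar R})
    (P : probability T R) (A : set T) (c : R) : mu setT = c%:E -> 0 < c ->
  mnormalize mu P A = (mu A * c^-1%:E)%E.
Proof. by move=> muc c0; rewrite /mnormalize muc eqe (gt_eqF c0). Qed.

Lemma truncated_normalE (m : R) (a : bool) (A : set (measurableTypeR R)) :
  measurable A ->
  truncated_normal m a A = (normal_prob m 1 (A `&` trunc_support a) *
     (Phi (if a then m else - m))^-1%:E)%E.
Proof.
move=> mA.
have e : mrestr (normal_prob m 1) (measurable_trunc_support a) setT =
    (Phi (if a then m else - m))%:E.
  rewrite /mrestr setTI; case: a => /=.
    by rewrite normal_prob_right_tail subr0.
  rewrite -[m in LHS]opprK normal_prob_reflect//.
  rewrite (_ : _ @^-1` _ = `]0, +oo[%classic) ?normal_prob_right_tail ?subr0//.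
  by apply/seteqP; split => x /=; rewrite !in_itv/= andbT oppr_lt0.
exact: (mnormalize_mass (normal_prob m 1) A e (Phi_gt0 _)).
Qed.

Lemma lebesgue_sandwich (A : set (measurableTypeR R)) (c : R) : measurable A -> 0 <= c ->
  `]0, c[%classic `<=` A -> A `<=` `[0, c]%classic -> lebesgue_measure A = c%:E.
Proof.
move=> mA c0 h1 h2; apply/eqP; rewrite eq_le; apply/andP; split.
  apply: (@le_trans _ _ (lebesgue_measure `[0, c]%classic)).
    by apply: le_measure => //; rewrite inE.
  rewrite lebesgue_measure_itv/= lte_fin; case: ifPn => _.
    by rewrite -EFinB subr0.
  by rewrite lee_fin.
apply: (@le_trans _ _ (lebesgue_measure `]0, c[%classic)); last first.
  by apply: le_measure => //; rewrite inE.
rewrite lebesgue_measure_itv/= lte_fin; case: ifPn => [_|].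
  by rewrite -EFinB subr0.
by rewrite -leNgt lee_fin.
Qed.

Lemma measurable_tn_map_snd (a : bool) (m : R) :
  measurable_fun setT (tn_map a m : measurableTypeR R -> measurableTypeR R).
Proof. exact: (measurableT_comp (@measurable_tn_map a) (pair1_measurable m)). Qed.

(** Right half-lines determine a law, and their preimages are the intervals
between 0 and a ratio of normal probabilities; label 0 follows by reflection. *)
Lemma tn_map_law (m : R) (a : bool) (A : set (measurableTypeR R)) : measurable A ->
  truncated_normal m a A = unif (tn_map a m @^-1` A).
Proof.
have pos (r : R) (B : set (measurableTypeR R)) : measurable B ->
    truncated_normal r true B = unif (tn_map true r @^-1` B).
  have mT := measurable_tn_map_snd true r.
  pose mm := isMeasurableFun.Build _ _ _ _ _ mT.
  pose F : {mfun measurableTypeR R >-> measurableTypeR R} := HB.pack (tn_map true r) mm.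
  apply: (@probability_half_lines _ (truncated_normal r true) (distribution unif F)) => t.
  rewrite truncated_normalE; last exact: measurable_itv.
  rewrite -[RHS]/(unif (tn_map true r @^-1` `]t, +oo[%classic)) unifE; last first.
    by rewrite -[X in measurable X]setTI; apply: (measurable_tn_map_snd true r measurableT); exact: measurable_itv.
  pose t' := Num.max t 0.
  have t'0 : 0 <= t' by rewrite /t' le_max lexx orbT.
  rewrite (_ : _ `&` _ = `]t', +oo[%classic); last first.
    by apply/seteqP; split => x /=; rewrite !in_itv/= !andbT gt_max => /andP.
  rewrite normal_prob_right_tail -EFinM; apply/esym/lebesgue_sandwich.
  - apply: measurableI; last exact: measurable_itv.
    by rewrite -[X in measurable X]setTI; apply: (measurable_tn_map_snd true r measurableT); exact: measurable_itv.
  - by rewrite divr_ge0 ?Phi_ge0.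
  - move=> u /=; rewrite !in_itv/= andbT => /andP[u0].
    rewrite ltr_pdivlMr ?Phi_gt0// => ut.
    have u1 : u < 1.
      rewrite -(ltr_pM2r (Phi_gt0 r)) mul1r (lt_le_trans ut)// Phi_mono; lra.
    split; last by lra.
    rewrite /tn_map; have [q -> qE] : exists2 q, tn_pos r u = r - q & Phi q = u * Phi r.
      by apply: tn_posE; lra.
    move: ut; rewrite -qE Phi_smono => qt.
    by apply: (@le_lt_trans _ _ t'); [rewrite /t' le_max lexx|lra].
  - move=> u /= []; rewrite !in_itv/= andbT /tn_map => tu /andP[u0 u1]; rewrite u0/=.
    rewrite ler_pdivlMr ?Phi_gt0//.
    have [u00|u00] := eqVneq u 0; first by rewrite u00 mul0r Phi_ge0.
    have u01 : 0 < u <= 1 by rewrite lt_def u00 u0.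
    move: tu; have [q -> qE] := tn_posE r u01 => tu.
    rewrite -qE Phi_mono /t' /Num.max; case: ifPn => _; last by lra.
    by rewrite subr0 -Phi_mono qE ler_piMl ?Phi_ge0.
case: a => [|mA]; first exact: pos.
have mNA : measurable (-%R @^-1` A : set (measurableTypeR R)).
  by rewrite -[X in measurable X]setTI; exact: oppr_measurable.
have mAs : measurable (A `&` trunc_support false).
  by apply: measurableI => //; exact: measurable_itv.
have := normal_prob_reflect (- m) mAs; rewrite opprK => e.
have -> : unif (tn_map false m @^-1` A) = truncated_normal (- m) true (-%R @^-1` A).
  exact/esym/pos.
rewrite (truncated_normalE m false mA) (truncated_normalE (- m) true mNA) e.
congr (_ * _)%E; congr (normal_prob _ _).
by apply/seteqP; split => x /=; rewrite !in_itv/= andbT oppr_lt0.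
Qed.

End truncated_normal_coupling.

(** * Measurability of matrix expressions and Gaussian integrals *)

Section measurable_matrix_functions.
Context d (T : measurableType d) {R : realType}.

Lemma measurable_entry m n (f : T -> 'M[R]_(m, n)) i j :
  measurable_fun setT f -> measurable_fun setT (fun t => f t i j).
Proof. by move=> mf; apply: (measurableT_comp (measurable_mx_entry i j)). Qed.

Lemma measurable_mxD m n (f g : T -> 'M[R]_(m, n)) : measurable_fun setT f ->
  measurable_fun setT g -> measurable_fun setT (fun t => f t + g t).
Proof.
move=> mf mg; apply: measurable_fun_mxP => i j; under eq_fun do rewrite mxE.
by apply: measurable_funD; exact: measurable_entry.
Qed.

Lemma measurable_mxN m n (f : T -> 'M[R]_(m, n)) : measurable_fun setT f ->
  measurable_fun setT (fun t => - f t).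
Proof.
move=> mf; apply: measurable_fun_mxP => i j; under eq_fun do rewrite mxE.
by apply: measurable_funN; exact: measurable_entry.
Qed.

Lemma measurable_mxB m n (f g : T -> 'M[R]_(m, n)) : measurable_fun setT f ->
  measurable_fun setT g -> measurable_fun setT (fun t => f t - g t).
Proof. by move=> mf mg; apply: measurable_mxD => //; exact: measurable_mxN. Qed.

Lemma measurable_mulmxl m n p (A : 'M[R]_(m, n)) (f : T -> 'M[R]_(n, p)) :
  measurable_fun setT f -> measurable_fun setT (fun t => A *m f t).
Proof.
move=> mf; apply: measurable_fun_mxP => i j; under eq_fun do rewrite mxE.
apply: measurable_sum => k; apply: measurable_funM; first exact: measurable_cst.
exact: measurable_entry.
Qed.

Lemma measurable_dotv n (f g : T -> 'cV[R]_n) : measurable_fun setT f ->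
  measurable_fun setT g -> measurable_fun setT (fun t => dotv (f t) (g t)).
Proof.
move=> mf mg; under eq_fun do rewrite dotvE.
by apply: measurable_sum => k; apply: measurable_funM; exact: measurable_entry.
Qed.

Lemma measurable_expR_half (f : T -> R) : measurable_fun setT f ->
  measurable_fun setT (fun t => expR (- (f t / 2))).
Proof.
move=> mf; apply: (measurableT_comp (@measurable_expR R)).
by apply: measurable_funN; apply: measurable_funM => //; exact: measurable_cst.
Qed.

Lemma measurable_qform n (A : 'M[R]_n) (f : T -> 'cV[R]_n) : measurable_fun setT f ->
  measurable_fun setT (fun t => qform A (f t)).
Proof. by move=> mf; apply: measurable_dotv => //; exact: measurable_mulmxl. Qed.

End measurable_matrix_functions.

Section gaussian_integral.
Context {R : realType}.

Lemma integral_gauss1 (a t : R) : 0 < a ->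
  (\int[lebesgue_measure]_x (expR (- (a * (x + t) ^+ 2 / 2)))%:E)%E =
  (Num.sqrt (2 * pi / a))%:E.
Proof.
move=> a0; pose s := Num.sqrt a^-1.
have s2 : s ^+ 2 = a^-1 by rewrite sqr_sqrtr// invr_ge0 ltW.
have s0 : s != 0 by rewrite gt_eqF// sqrtr_gt0 invr_gt0.
have := integral_normal_pdf (- t) s; rewrite normal_pdfE//.
have -> : normal_peak s = (Num.sqrt (2 * pi / a))^-1.
  by rewrite /normal_peak s2; congr (Num.sqrt _)^-1; rewrite -mulr_natl; ring.
have p0 : 0 < Num.sqrt (2 * pi / a) by rewrite sqrtr_gt0 divr_gt0// mulr_gt0// pi_gt0.
under eq_integral do rewrite EFinM.
rewrite ge0_integralZl_EFin//.
- move=> h; transitivity ((Num.sqrt (2 * pi / a))%:E *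
    ((Num.sqrt (2 * pi / a))^-1%:E * \int[lebesgue_measure]_x (normal_fun (- t) s x)%:E))%E.
    rewrite muleA -EFinM divff ?gt_eqF// mul1e; apply: eq_integral => x _.
    rewrite /normal_fun s2 opprK; congr (expR _)%:E.
    by rewrite -mulr_natr; field; rewrite gt_eqF.
  by rewrite h mule1.
- by move=> x _; rewrite lee_fin normal_fun_ge0.
- by apply/measurable_EFinP; exact: measurable_normal_fun.
Qed.

Lemma cons_cV_col_mx n (x : R) (v : 'cV[R]_n) :
  cons_cV (x, v) = col_mx (x%:M : 'cV_1) v :> 'cV[R]_(1 + n).
Proof.
apply/colP => i; rewrite mxE /= mxE; case: splitP => j ij.
  rewrite (_ : i = ord0) ?unlift_none ?ord1 ?mxE ?mulr1n//.
  by apply/val_inj; rewrite /= ij ord1.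
by rewrite (_ : i = lift ord0 j) ?liftK//; apply/val_inj.
Qed.

Lemma dotv_col_mx m n (a b : 'cV[R]_m) (u v : 'cV[R]_n) :
  dotv (col_mx a u) (col_mx b v) = dotv a b + dotv u v.
Proof. by rewrite /dotv tr_col_mx mul_row_col mxE. Qed.

(** The Schur complement of the first diagonal entry. *)
Definition schur n (A : 'M[R]_(1 + n)) : 'M[R]_n :=
  drsubmx A - (A ord0 ord0)^-1 *: (dlsubmx A *m (dlsubmx A)^T).

Lemma ul11 n (A : 'M[R]_(1 + n)) : ulsubmx A = (A ord0 ord0)%:M.
Proof.
rewrite [LHS]mx11_scalar; congr (_%:M); rewrite !mxE; congr (A _ _); exact/val_inj.
Qed.

Lemma ur_sym n (A : 'M[R]_(1 + n)) : A^T = A -> ursubmx A = (dlsubmx A)^T.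
Proof. by move=> sA; rewrite trmx_dlsub sA. Qed.

Lemma qform_cons n (A : 'M[R]_(1 + n)) x (v : 'cV[R]_n) : A^T = A ->
  A ord0 ord0 != 0 ->
  qform A (cons_cV (x, v)) =
  A ord0 ord0 * (x + dotv (dlsubmx A) v / A ord0 ord0) ^+ 2 + qform (schur A) v.
Proof.
move=> sA a0; rewrite cons_cV_col_mx -[in LHS](submxK A) /qform mul_block_col.
rewrite dotv_col_mx dotvDr !dotvDr ul11 (ur_sym sA) /schur mulmxBl dotvDr dotvNr.
set a := A ord0 ord0 in a0 *; set c := dlsubmx A.
have e1 : dotv (x%:M : 'cV_1) (a%:M *m x%:M) = a * x ^+ 2.
  by rewrite dotvE big_ord1 -scalar_mxM !mxE !mulr1n; ring.
have e2 : dotv (x%:M : 'cV_1) (c^T *m v) = x * dotv c v.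
  by rewrite [LHS]dotvE big_ord1 mxE mulr1n.
have e3 : dotv v (c *m x%:M) = x * dotv c v.
  by rewrite mul_mx_scalar dotvZr dotvC.
have e4 : dotv v ((a^-1 *: (c *m c^T)) *m v) = a^-1 * dotv c v ^+ 2.
  rewrite -scalemxAl dotvZr -mulmxA dotv_mulmx; congr (_ * _).
  by rewrite [LHS]dotvE big_ord1 expr2.
rewrite e1 e2 e3 e4; field; exact: a0.
Qed.

Lemma cons_cV_eq0 n x (v : 'cV[R]_n) : cons_cV (x, v) = 0 -> v = 0.
Proof.
move=> h; apply/colP => i; have := congr1 (fun w : 'cV_n.+1 => w (lift ord0 i) ord0) h.
by rewrite cons_cVS !mxE.
Qed.

Lemma posdef_diag0 n (A : 'M[R]_(1 + n)) : posdefmx A -> 0 < A ord0 ord0.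
Proof.
move=> [sA A0]; pose e : 'cV[R]_(1 + n) := cons_cV (1, 0).
have e0 : e != 0.
  apply/eqP => /(congr1 (fun w : 'cV_n.+1 => w ord0 ord0)).
  by rewrite cons_cV0 mxE => /eqP; rewrite oner_eq0.
have := A0 _ e0; rewrite qformE (bigD1 ord0)//= (bigD1 ord0)//= !big1.
- by rewrite cons_cV0 !mulr1 !addr0.
- move=> i i0; rewrite big1// => j _; rewrite [e i _]mxE.
  by case: unliftP i0 => [k|->//] -> _; rewrite mxE mul0r mulr0.
- move=> j j0; rewrite [e j _]mxE.
  by case: unliftP j0 => [k|->//] -> _; rewrite [X in _ * (_ * X)]mxE !mulr0.
Qed.

Lemma schur_posdef n (A : 'M[R]_(1 + n)) : posdefmx A -> posdefmx (schur A).
Proof.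
move=> pA; have a0 := posdef_diag0 pA; have [sA A0] := pA; split.
  rewrite /schur linearB /= linearZ /= trmx_mul trmxK; congr (_ - _).
  by rewrite trmx_drsub sA.
move=> v v0; pose x := - (dotv (dlsubmx A) v / A ord0 ord0).
have := A0 (cons_cV (x, v)); rewrite qform_cons ?gt_eqF// addNr expr0n mulr0 add0r.
by apply; apply: contraNneq v0 => /cons_cV_eq0 ->.
Qed.

Lemma schur_det n (A : 'M[R]_(1 + n)) : posdefmx A ->
  \det A = A ord0 ord0 * \det (schur A).
Proof.
move=> pA; have a0 := posdef_diag0 pA; have [sA _] := pA.
set a := A ord0 ord0 in a0 *; set c := dlsubmx A.
have e : A = block_mx (1%:M : 'M[R]_1) 0 (a^-1 *: c) 1%:M *m
   block_mx (a%:M : 'M[R]_1) c^T 0 (schur A).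
  rewrite mulmx_block !mul1mx !mul0mx !addr0.
  rewrite -[LHS]submxK ul11 (ur_sym sA) -/a -/c; congr block_mx.
    by rewrite -scalemxAl mul_mx_scalar scalerA mulVf ?scale1r ?gt_eqF.
  by rewrite /schur -scalemxAl addrC subrK.
by rewrite [in LHS]e det_mulmx det_lblock det_ublock !det1 !mul1r det_scalar1.
Qed.

(** Completing the square in the first coordinate splits off one Gaussian
integral and leaves the Schur complement. *)
Lemma gaussian_integral0 n (A : 'M[R]_n) : posdefmx A ->
  0 < \det A /\
  (\int[lebesgue_cV n]_b (expR (- (qform A b / 2)))%:E)%E =
  (Num.sqrt ((2 * pi) ^+ n / \det A))%:E.
Proof.
have meas k (B : 'M[R]_k) :
    measurable_fun setT (fun b : 'cV[R]_k => (expR (- (qform B b / 2)))%:E).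
  apply/measurable_EFinP; apply: measurable_expR_half.
  apply: measurable_qform; exact: measurable_id.
elim: n A => [|n IH] A pA.
  rewrite det_mx00 ge0_integral_prod_measure0 => [||z]; last by rewrite lee_fin expR_ge0.
    split; rewrite ?ltr01// expr0 divr1 sqrtr1 /qform mulmx0 dotvE big_ord0.
    by rewrite mul0r oppr0 expR0.
  exact: meas.
have a0 := posdef_diag0 pA; have [sA _] := pA; have pS := schur_posdef pA.
have [dS IS] := IH _ pS.
rewrite schur_det//; split; first exact: mulr_gt0.
set a := A ord0 ord0 in a0 *.
rewrite ge0_integral_prod_measureS => [||z]; last by rewrite lee_fin expR_ge0.
  rewrite (@fubini_tonelli _ _ _ _ _ lebesgue_measure (lebesgue_cV n)
    (fun z => (expR (- (qform A (cons_cV z) / 2)))%:E)); first last.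
  - by move=> z; rewrite lee_fin expR_ge0.
  - exact: (measurableT_comp (meas _ A) (@measurable_cons_cV R n)).
  transitivity (\int[lebesgue_cV n]_v ((Num.sqrt (2 * pi / a))%:E *
      (expR (- (qform (schur A) v / 2)))%:E))%E.
    apply: eq_integral => v _.
    rewrite -(integral_gauss1 (dotv (@dlsubmx R 1 n 1 n A) v / a) a0) muleC.
    rewrite -ge0_integralZl_EFin ?expR_ge0//; last first.
      apply/measurable_EFinP; apply: measurable_expR_half.
      apply: measurable_funM; first exact: measurable_cst.
      by apply: measurable_funX; apply: measurable_funD => //; exact: measurable_cst.
    apply: eq_integral => x _; rewrite qform_cons ?gt_eqF// -/a -EFinM -expRD.
    by congr (expR _)%:E; ring.
  rewrite ge0_integralZl_EFin ?sqrtr_ge0//; last exact: meas.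
  rewrite IS -EFinM -sqrtrM; last by rewrite divr_ge0 ?mulr_ge0 ?pi_ge0 ?ltW.
  by congr (Num.sqrt _)%:E; rewrite exprS; field; rewrite !gt_eqF.
exact: meas.
Qed.

Lemma measurable_mvnormal_pdf n (m : 'cV[R]_n) (S : 'M[R]_n) :
  measurable_fun setT (mvnormal_pdf m S).
Proof.
apply: measurable_funM; first exact: measurable_cst.
apply: measurable_expR_half.
by apply: measurable_qform; apply: measurable_mxB; [exact: measurable_id|exact: measurable_cst].
Qed.

Lemma mvnormal_pdf_ge0 n (m : 'cV[R]_n) (S : 'M[R]_n) b : 0 <= mvnormal_pdf m S b.
Proof. by rewrite mulr_ge0 ?expR_ge0// invr_ge0 sqrtr_ge0. Qed.

Lemma mvnormal_pdf_shift n (m a : 'cV[R]_n) (S : 'M[R]_n) b :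
  mvnormal_pdf (m + a) S (b + a) = mvnormal_pdf m S b.
Proof. by rewrite /mvnormal_pdf opprD addrACA subrr addr0. Qed.

Lemma mvnormal_total n (m : 'cV[R]_n) (S : 'M[R]_n) : posdefmx S ->
  (\int[lebesgue_cV n]_b (mvnormal_pdf m S b)%:E)%E = 1%E.
Proof.
move=> pS; have [dS IS] := gaussian_integral0 (posdef_inv pS).
rewrite -(ge0_integral_lebesgue_cVD m); last 2 first.
- by apply/measurable_EFinP; exact: measurable_mvnormal_pdf.
- by move=> z; rewrite lee_fin mvnormal_pdf_ge0.
have dS0 : 0 < \det S by move: dS; rewrite det_inv invr_gt0.
have c0 : 0 < Num.sqrt ((2 * pi) ^+ n * \det S).
  by rewrite sqrtr_gt0 mulr_gt0// exprn_gt0// mulr_gt0// pi_gt0.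
under eq_integral => b _ do rewrite /mvnormal_pdf addrK EFinM.
rewrite ge0_integralZl_EFin ?invr_ge0 ?sqrtr_ge0//; last first.
  apply/measurable_EFinP; apply: measurable_expR_half.
  by apply: measurable_qform; exact: measurable_id.
by rewrite IS det_inv invrK -EFinM mulVf// gt_eqF.
Qed.

End gaussian_integral.

(** * Total variation between normal laws *)

Section chi_square.
Context dsp (T : measurableType dsp) {R : realType}.

Lemma expR_le1D2 (x : R) : 0 <= x -> x <= 1 / 2 -> expR x <= 1 + 2 * x.
Proof.
move=> x0 x1; have h := expR_ge1Dx (- x); rewrite expRN in h.
have e0 := expR_gt0 x.
have : expR x * (1 + - x) <= 1.
  by rewrite -[leRHS](mulfV (lt0r_neq0 e0)) ler_pM2l.
nra.
Qed.

(** By Cauchy-Schwarz the total variation distance of two densities is at most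
the square root of the integral of (f1 - f2)^2 / f2; the inequality between
arithmetic and geometric means with weight k linearises that root. *)
Lemma chi_square_total_variation (leb : {measure set T -> \bar R}) (f1 f2 f3 : T -> R)
    (d k : R) (A : set T) :
  measurable A -> measurable_fun setT f1 -> measurable_fun setT f2 ->
  measurable_fun setT f3 ->
  (forall b, 0 <= f1 b) -> (forall b, 0 < f2 b) -> (forall b, 0 <= f3 b) ->
  (\int[leb]_b (f1 b)%:E = 1)%E -> (\int[leb]_b (f2 b)%:E = 1)%E ->
  (\int[leb]_b (f3 b)%:E = 1)%E ->
  (forall b, f1 b ^+ 2 = expR d * (f2 b * f3 b)) ->
  0 <= d -> d <= 1 / 2 -> 0 < k ->
  (\int[leb]_(b in A) (f1 b)%:E <=
   \int[leb]_(b in A) (f2 b)%:E + (k + d / k)%:E)%E.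
Proof.
move=> mA mf1 mf2 mf3 f10 f20 f30 If1 If2 If3 f123 d0 d1 k0.
have ki : 0 < k^-1 by rewrite invr_gt0.
pose h b := (k * f2 b + (expR d * f3 b - 2 * f1 b + f2 b) / k) / 2.
have hE b : h b = f1 b - f2 b + (k * f2 b - (f1 b - f2 b)) ^+ 2 / (2 * k * f2 b).
  rewrite /h; have -> : expR d * f3 b = f1 b ^+ 2 / f2 b.
    by rewrite f123; field; rewrite gt_eqF.
  by field; rewrite !gt_eqF.
have f1h b : f1 b <= f2 b + h b.
  rewrite hE; have : 0 <= (k * f2 b - (f1 b - f2 b)) ^+ 2 / (2 * k * f2 b).
    by rewrite divr_ge0 ?sqr_ge0// !mulr_ge0// ltW.
  by lra.
have h0 b : 0 <= h b.
  rewrite /h divr_ge0// addr_ge0//; first by rewrite mulr_ge0// ltW.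
  rewrite divr_ge0 ?(ltW k0)//.
  have -> : expR d * f3 b = f1 b ^+ 2 / f2 b.
    by rewrite f123; field; rewrite gt_eqF.
  rewrite (_ : _ + _ = (f1 b - f2 b) ^+ 2 / f2 b); last by field; rewrite gt_eqF.
  by rewrite divr_ge0 ?sqr_ge0 ?ltW.
have mh : measurable_fun setT h.
  apply: measurable_funM; last exact: measurable_cst.
  apply: measurable_funD; first by apply: measurable_funM => //; exact: measurable_cst.
  apply: measurable_funM; last exact: measurable_cst.
  apply: measurable_funD => //; apply: measurable_funB.
    by apply: measurable_funM => //; exact: measurable_cst.
  by apply: measurable_funM => //; exact: measurable_cst.
have scal (a : R) (f : T -> R) : 0 <= a -> measurable_fun setT f ->
    (forall b, 0 <= f b) ->
    (\int[leb]_b (a * f b)%:E = a%:E * \int[leb]_b (f b)%:E)%E.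
  move=> a0 mf fp; under eq_integral do rewrite EFinM.
  rewrite ge0_integralZl_EFin//; first by move=> b _; rewrite lee_fin.
  exact/measurable_EFinP.
have Ih : (\int[leb]_b (h b)%:E <= (k + d / k)%:E)%E.
  have e : (\int[leb]_b (h b)%:E + k^-1%:E =
      (((k + k^-1) / 2) + expR d / (2 * k))%:E)%E.
    have <- : (\int[leb]_b (k^-1 * f1 b)%:E = k^-1%:E)%E.
      by rewrite scal ?(ltW ki)// If1 mule1.
    rewrite -ge0_integralD//; first last.
    - by apply/measurable_EFinP/measurable_funM => //; exact: measurable_cst.
    - by move=> b _; rewrite lee_fin mulr_ge0// ltW.
    - exact/measurable_EFinP.
    - by move=> b _; rewrite lee_fin.
    transitivity (\int[leb]_b (((k + k^-1) / 2 * f2 b)%:E +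
        (expR d / (2 * k) * f3 b)%:E))%E.
      apply: eq_integral => b _; rewrite -!EFinD /h; congr EFin.
      by field; rewrite gt_eqF.
    have a1 : 0 <= (k + k^-1) / 2 by lra.
    have a2 : 0 <= expR d / (2 * k) by rewrite divr_ge0 ?expR_ge0// mulr_ge0// ltW.
    rewrite ge0_integralD//; first last.
    - by apply/measurable_EFinP/measurable_funM => //; exact: measurable_cst.
    - by move=> b _; rewrite lee_fin mulr_ge0.
    - by apply/measurable_EFinP/measurable_funM => //; exact: measurable_cst.
    - by move=> b _; rewrite lee_fin mulr_ge0// ltW.
    rewrite !scal ?If2 ?If3 ?mule1 ?EFinD// => b; exact: ltW.
  rewrite -(leeD2rE (x := k^-1%:E))// e -EFinD lee_fin.
  have := expR_le1D2 d0 d1.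
  rewrite -(ler_pM2r (_ : 0 < (2 * k)^-1)); last by rewrite invr_gt0 mulr_gt0.
  rewrite (_ : (2 * k)^-1 = k^-1 / 2); last by field; rewrite gt_eqF.
  by nra.
apply: (@le_trans _ _ (\int[leb]_(b in A) ((f2 b)%:E + (h b)%:E))%E).
  apply: ge0_le_integral => //.
  - by move=> b _; rewrite lee_fin.
  - by apply/measurable_EFinP; exact: measurable_funTS.
  - by apply: emeasurable_funD; apply/measurable_EFinP; exact: measurable_funTS.
  - by move=> b _; rewrite -EFinD lee_fin f1h.
rewrite ge0_integralD//; first last.
- by apply/measurable_EFinP; exact: measurable_funTS.
- by move=> b _; rewrite lee_fin.
- by apply/measurable_EFinP; exact: measurable_funTS.
- by move=> b _; rewrite lee_fin ltW.
rewrite leeD2l//; apply: le_trans Ih; apply: ge0_subset_integral => //.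
- exact/measurable_EFinP.
- by move=> b _; rewrite lee_fin.
Qed.

End chi_square.

Section gaussian_total_variation.
Context {R : realType} (n : nat).
Implicit Types (m : 'cV[R]_n) (S : 'M[R]_n).
Local Notation leb := (@lebesgue_cV R n).

Lemma measurable_mvnormal_pdf_EFin m S (A : set 'cV[R]_n) :
  measurable_fun A (fun b => (mvnormal_pdf m S b)%:E).
Proof. by apply: measurable_funTS; apply/measurable_EFinP; exact: measurable_mvnormal_pdf. Qed.

Lemma mvnormal_prob_le1 m S A : posdefmx S -> measurable A ->
  (mvnormal_prob m S A <= 1)%E.
Proof.
move=> pS mA; rewrite -(mvnormal_total m pS); apply: ge0_subset_integral => //.
- exact: measurable_mvnormal_pdf_EFin.
- by move=> x _; rewrite lee_fin mvnormal_pdf_ge0.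
Qed.

Lemma mvnormal_probT m S : posdefmx S -> mvnormal_prob m S setT = 1%E.
Proof. by move=> pS; exact: mvnormal_total. Qed.

(** The chi-square identity: for Gaussian densities with a common covariance
the function f1^2 / f2 is a multiple of the density centred at 2 m1 - m2. *)
Lemma mvnormal_pdf_sqr m1 m2 S b : (invmx S)^T = invmx S ->
  mvnormal_pdf m1 S b ^+ 2 =
  expR (qform (invmx S) (m1 - m2)) *
    (mvnormal_pdf m2 S b * mvnormal_pdf (m1 + (m1 - m2)) S b).
Proof.
move=> sS; rewrite /mvnormal_pdf; set c := (Num.sqrt _)^-1.
set q := qform (invmx S).
have e : 2 * q (b - m1) =
    q (b - m2) + q (b - (m1 + (m1 - m2))) - 2 * q (m1 - m2).
  have -> : b - m2 = (b - m1) + (m1 - m2) by rewrite addrA subrK.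
  have -> : b - (m1 + (m1 - m2)) = (b - m1) + - (m1 - m2) by rewrite opprD addrA.
  move: (b - m1) (m1 - m2) => w z.
  rewrite /q !qformD// qformN mulmxN dotvNr; lra.
have -> : expR (q (m1 - m2)) = expR (- (q (b - m1) / 2)) ^+ 2 /
    (expR (- (q (b - m2) / 2)) * expR (- (q (b - (m1 + (m1 - m2))) / 2))).
  rewrite -expRD -expRN expr2 -!expRD; congr expR; lra.
field; by rewrite !gt_eqF ?expR_gt0.
Qed.

(** When the squared distance of the means exceeds 1 / 2 the right-hand side is at
least 1, so the chi-square bound is only needed for close means. *)
Lemma mvnormal_prob_lipschitz m1 m2 S A (k : R) : posdefmx S -> measurable A ->
  0 < k ->
  (mvnormal_prob m1 S A <= mvnormal_prob m2 S A +
    (k + qform (invmx S) (m1 - m2) / k)%:E)%E.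
Proof.
move=> pS mA k0; have [sI I0] := posdef_psd (posdef_inv pS).
set d := qform (invmx S) (m1 - m2); have d0 : 0 <= d by exact: I0.
have [d1|d1] := leP d (1 / 2); last first.
  apply: (le_trans (mvnormal_prob_le1 _ pS mA)).
  apply: (@le_trans _ _ (k + d / k)%:E).
    rewrite lee_fin -(ler_pM2r k0) mul1r mulrDl divfK ?gt_eqF//.
    have := sqr_ge0 (k - 1 / 2); rewrite sqrrB; nra.
  by rewrite leeDr// integral_ge0// => x _; rewrite lee_fin mvnormal_pdf_ge0.
rewrite /mvnormal_prob; apply: (chi_square_total_variation
  (f3 := mvnormal_pdf (m1 + (m1 - m2)) S)) => //; try exact: measurable_mvnormal_pdf.
- exact: mvnormal_pdf_ge0.
- move=> b; rewrite mulr_gt0 ?expR_gt0// invr_gt0 sqrtr_gt0.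
  rewrite mulr_gt0 ?exprn_gt0 ?mulr_gt0 ?pi_gt0//.
  by have [] := gaussian_integral0 pS.
- exact: mvnormal_pdf_ge0.
- exact: mvnormal_total.
- exact: mvnormal_total.
- exact: mvnormal_total.
- by move=> b; exact: mvnormal_pdf_sqr.
Qed.

Definition gaussian_noise S (pS : posdefmx S) : set 'cV[R]_n -> \bar R :=
  density_measure leb (measurable_mvnormal_pdf 0 S) (mvnormal_pdf_ge0 0 S).

Section noise_measure.
Variables (S : 'M[R]_n) (pS : posdefmx S).

HB.instance Definition _ := Measure.on (gaussian_noise pS).

Let noise_setT : gaussian_noise pS setT = 1%E.
Proof. exact: mvnormal_probT. Qed.

HB.instance Definition _ := @Measure_isProbability.Build _ _ _ (gaussian_noise pS)
  noise_setT.

Lemma mvnormal_prob_noise m A : measurable A ->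
  mvnormal_prob m S A = gaussian_noise pS ((fun b => b + m) @^-1` A).
Proof.
move=> mA; rewrite /gaussian_noise /density_measure /mvnormal_prob [LHS]integral_mkcond.
rewrite [RHS]integral_mkcond -[LHS](ge0_integral_lebesgue_cVD m).
- apply: eq_integral => x _; rewrite !patchE.
  rewrite (_ : (x \in _ @^-1` A) = (x + m \in A)); last first.
    by apply/idP/idP; rewrite !inE.
  by rewrite -(mvnormal_pdf_shift 0 m) add0r.
- by apply/(measurable_restrictT _ mA); exact: measurable_mvnormal_pdf_EFin.
- by apply: erestrict_ge0 => x _; rewrite lee_fin mvnormal_pdf_ge0.
Qed.

End noise_measure.

End gaussian_total_variation.

(** * Contracting random maps *)

Section random_map_chain.
Context d (T : measurableType d) {R : realType}.
Local Open Scope ereal_scope.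
Import HBNNSimple.

(** Simple functions only see measurable sets, so an integral depends on nothing
but the values of the set function there. *)
Lemma eq_set_function_integral (m1 m2 : set T -> \bar R) (f : T -> \bar R) :
  (forall A, measurable A -> m1 A = m2 A) ->
  \int[m1]_x f x = \int[m2]_x f x.
Proof.
move=> m12; have e (h : {nnsfun T >-> R}) : sintegral m1 h = sintegral m2 h.
  by apply: eq_fsbigr => r _; rewrite m12.
rewrite /integral; congr (ereal_sup _ - ereal_sup _);
  by apply/seteqP; split=> _ [h hf <-]; exists h.
Qed.

Implicit Types (K : T -> set T -> \bar R) (c : T -> T -> R).

(** Driving two copies by the same randomness couples them, and this coupling
carries over to compositions and iterates. *)
Definition contracting_random_map K c (r : R) : Prop :=
  exists d' (S : measurableType d') (mu : probability S R) (F : T -> S -> T),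
  [/\ measurable_fun setT (fun z : T * S => F z.1 z.2),
      forall b A, measurable A -> K b A = mu (F b @^-1` A) &
      forall b b', \int[mu]_s (c (F b s) (F b' s))%:E <= (r * c b b')%:E].

Section one_map.
Variables (d' : measure_display) (S : measurableType d') (mu : probability S R).
Variables (d0 : measure_display) (T0 : measurableType d0) (F : T0 -> S -> T).
Hypothesis mF : measurable_fun setT (fun z : T0 * S => F z.1 z.2).

Lemma measurable_map_at b : measurable_fun setT (F b).
Proof. exact: (measurableT_comp mF (pair1_measurable b)). Qed.

Lemma measurable_map_kernel A : measurable A ->
  measurable_fun setT (fun b => mu (F b @^-1` A)).
Proof.
move=> mA.
have mB : measurable ((fun z : T0 * S => F z.1 z.2) @^-1` A).
  by rewrite -[X in measurable X]setTI; exact: mF.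
have := measurable_fun_xsection mu mB.
apply: eq_measurable_fun => b _ /=; congr (mu _).
by apply/seteqP; split => s; rewrite /xsection/= inE.
Qed.

Lemma integral_map_kernel (K : T0 -> set T -> \bar R) b (f : T -> \bar R) :
  (forall A, measurable A -> K b A = mu (F b @^-1` A)) ->
  measurable_fun setT f -> (forall x, 0 <= f x) ->
  \int[K b]_x f x = \int[mu]_s f (F b s).
Proof.
move=> KE mf f0.
have := @ge0_integral_pushforward _ _ _ _ _ _ (measurable_map_at b) mu setT f
  measurableT mf (fun y _ => f0 y).
rewrite preimage_setT => <-.
by apply: eq_set_function_integral => A mA; rewrite KE.
Qed.

End one_map.

Lemma contracting_random_map_measurable K c r A :
  contracting_random_map K c r -> measurable A -> measurable_fun setT (K ^~ A).
Proof.
move=> [d' [S [mu [F [mF KE _]]]]] mA.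
rewrite (_ : K ^~ A = fun b => mu (F b @^-1` A)); last first.
  by apply/funext => b; rewrite KE.
exact: measurable_map_kernel.
Qed.

Lemma contracting_random_map_le1 K c r A b :
  contracting_random_map K c r -> measurable A -> 0 <= K b A <= 1.
Proof.
move=> [d' [S [mu [F [mF KE _]]]]] mA; rewrite KE// measure_ge0/=.
apply: probability_le1; rewrite -[X in measurable X]setTI.
exact: (measurable_map_at mF b).
Qed.

Lemma contracting_random_map_comp K1 K2 c r1 r2 :
  measurable_fun setT (fun z : T * T => c z.1 z.2) ->
  (forall x y, 0 <= c x y)%R -> (0 <= r2)%R ->
  contracting_random_map K1 c r1 -> contracting_random_map K2 c r2 ->
  contracting_random_map (fun b A => \int[K1 b]_x K2 x A) c (r1 * r2).
Proof.
move=> mc c0 r20 [d1 [S1 [mu1 [F1 [mF1 K1E c1]]]]] [d2 [S2 [mu2 [F2 [mF2 K2E c2]]]]].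
pose F b (s : S1 * S2) := F2 (F1 b s.1) s.2.
have mF : measurable_fun setT (fun z : T * (S1 * S2) => F z.1 z.2).
  apply: (measurableT_comp mF2 (g := fun z : T * (S1 * S2) => (F1 z.1 z.2.1, z.2.2))).
  apply/measurable_fun_pairP; split => /=.
    apply: (measurableT_comp mF1 (g := fun z : T * (S1 * S2) => (z.1, z.2.1))).
    apply/measurable_fun_pairP; split => /=; first exact: measurable_fst.
    exact: (measurableT_comp measurable_fst measurable_snd).
  exact: (measurableT_comp measurable_snd measurable_snd).
exists _, (S1 * S2)%type, (mu1 \x mu2), F; split => // [b A mA|b b'].
  rewrite (integral_map_kernel mF1 (K1E b)); last 2 first.
  - rewrite (_ : (fun _ => _) = fun x => mu2 (F2 x @^-1` A)).
      exact: measurable_map_kernel.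
    by apply/funext => x; rewrite K2E.
  - by move=> x; rewrite K2E.
  rewrite /product_measure1 /=; apply: eq_integral => s _.
  rewrite K2E//; congr (mu2 _).
  by apply/seteqP; split => t; rewrite /xsection/= inE.
have mcF : measurable_fun setT (fun s : S1 * S2 => (c (F b s) (F b' s))%:E).
  apply/measurable_EFinP.
  apply: (measurableT_comp mc (g := fun s => (F b s, F b' s))).
  by apply/measurable_fun_pairP; split; apply: measurable_map_at mF _.
rewrite fubini_tonelli1//; last by move=> s; rewrite lee_fin.
have mc1 : measurable_fun setT (fun s => (c (F1 b s) (F1 b' s))%:E).
  apply/measurable_EFinP; apply: (measurableT_comp mc (g := fun s => (F1 b s, F1 b' s))).
  by apply/measurable_fun_pairP; split; apply: measurable_map_at mF1 _.
apply: (@le_trans _ _ (\int[mu1]_s (r2%:E * (c (F1 b s) (F1 b' s))%:E))).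
  apply: ge0_le_integral => //.
  - by move=> s _; apply: integral_ge0 => t _; rewrite lee_fin.
  - by apply: measurable_fun_fubini_tonelli_F => // s; rewrite lee_fin.
  - exact: measurable_funeM.
  - by move=> s _; rewrite -EFinM; exact: (c2 (F1 b s) (F1 b' s)).
rewrite ge0_integralZl_EFin//; last by move=> s _; rewrite lee_fin.
apply: le_trans (lee_wpmul2l _ (c1 b b')) _; first by rewrite lee_fin.
by rewrite -EFinM lee_fin mulrCA mulrA.
Qed.

Variables (K : T -> set T -> \bar R) (Kn : nat -> T -> set T -> \bar R).
Hypothesis Kn0 : forall b, Kn 0 b = dirac b.
Hypothesis KnS : forall m b, Kn m.+1 b = fun A => \int[K b]_x Kn m x A.
Variables (c : T -> T -> R) (r : R).
Hypothesis mc : measurable_fun setT (fun z : T * T => c z.1 z.2).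
Hypothesis c0 : forall x y, (0 <= c x y)%R.
Hypothesis csym : forall x y, c x y = c y x.
Hypothesis r0 : (0 < r)%R.
Hypothesis Kc : contracting_random_map K c r.

Lemma iterate_contracting m : contracting_random_map (Kn m) c (r ^+ m).
Proof.
elim: m => [|m IH].
  exists _, unit, (dirac tt), (fun b _ => b); split => [|b A mA|b b'].
  - exact: measurable_fst.
  - by rewrite Kn0 /dirac !indicE; congr (_%:R%:E); apply/idP/idP; rewrite !inE.
  - by rewrite integral_dirac// diracT mul1e mul1r.
rewrite exprS (_ : Kn m.+1 = fun b A => \int[K b]_x Kn m x A).
  by apply: contracting_random_map_comp => //; rewrite exprn_ge0// ltW.
by apply/funext => b; exact: KnS.
Qed.

Variable (Pi : probability T R).
Hypothesis Pi_stationary : forall A, measurable A -> \int[Pi]_b K b A = Pi A.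

Lemma iterate_stationary m A : measurable A -> \int[Pi]_b Kn m b A = Pi A.
Proof.
move=> mA; elim: m => [|m IH].
  under eq_integral do rewrite Kn0 /dirac.
  by rewrite integral_indic// setIT.
have [d' [S [mu [F [mF KE _]]]]] := Kc.
have mKn : measurable_fun setT (Kn m ^~ A).
  exact: contracting_random_map_measurable (iterate_contracting m) mA.
have Kn_ge0 b : 0 <= Kn m b A.
  by have /andP[] := contracting_random_map_le1 b (iterate_contracting m) mA.
rewrite -IH; transitivity (\int[Pi]_b \int[mu]_s Kn m (F b s) A).
  by apply: eq_integral => b _; rewrite KnS (integral_map_kernel mF (KE b)).
rewrite -(@fubini_tonelli1 _ _ _ _ _ Pi mu (fun z => Kn m (F z.1 z.2) A))//; last first.
  exact: (measurableT_comp mKn mF).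
have := @ge0_integral_pushforward _ _ _ _ _ _ mF (Pi \x mu) setT (Kn m ^~ A)
  measurableT mKn (fun y _ => Kn_ge0 y).
rewrite preimage_setT => <-; apply: eq_measure_integral => B mB _.
rewrite -[RHS]Pi_stationary// /pushforward /= /product_measure1.
apply: eq_integral => b _; rewrite KE//; congr (mu _).
by apply/seteqP; split => s; rewrite /xsection/= inE.
Qed.

Variable (nu : set T -> \bar R).
Hypothesis nuE : forall A, measurable A -> nu A = Pi A.

(** The coupling moves both points with the same random map; the square root is
linearised by 2 sqrt t <= k + t / k. *)
Lemma iterate_wasserstein_le m b (k : R) : (0 < k)%R ->
  wasserstein (fun x y => Num.sqrt (c x y)) (Kn m b) nu <=
  (k / 2)%:E + (r ^+ m / (2 * k))%:E * \int[Pi]_b' (c b b')%:E.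
Proof.
move=> k0; have [d' [S [mu [F [mF KE cF]]]]] := iterate_contracting m.
pose G (z : T * S) := (F b z.2, F z.1 z.2).
have mG : measurable_fun setT G.
  apply/measurable_fun_pairP; split => //=.
  exact: (measurableT_comp (measurable_map_at mF b) measurable_snd).
pose mm := isMeasurableFun.Build _ _ _ _ _ mG.
pose Gm : {mfun _ >-> _} := HB.pack G mm.
pose u : probability (T * T)%type R := distribution (Pi \x mu) Gm.
have ki : (0 < k^-1)%R by rewrite invr_gt0.
have a0 : (0 <= (2 * k)^-1)%R by rewrite invr_ge0 mulr_ge0// ltW.
have mcb (x : T) : measurable_fun setT (fun y => (c x y)%:E).
  by apply/measurable_EFinP; exact: (measurableT_comp mc (pair1_measurable x)).
apply: (@le_trans _ _ (\int[u]_z (Num.sqrt (c z.1 z.2))%:E)).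
  apply: ereal_inf_lbound; exists u => // A mA; split.
  - rewrite -[LHS]/((Pi \x mu) (G @^-1` (A `*` setT))).
    rewrite (_ : _ @^-1` _ = setT `*` (F b @^-1` A)); last first.
      by apply/seteqP; split => -[x s] /=; rewrite /G/=; tauto.
    have mFA : measurable (F b @^-1` A).
      by rewrite -[X in measurable X]setTI; exact: (measurable_map_at mF b).
    rewrite product_measure1E// KE// -[RHS]mul1e; congr (_ * _).
    exact: probability_setT.
  - rewrite -[LHS]/((Pi \x mu) (G @^-1` (setT `*` A))) nuE//.
    rewrite -(iterate_stationary m mA) /= /product_measure1.
    apply: eq_integral => x _; rewrite KE//; congr (mu _).
    by apply/seteqP; split => s; rewrite /xsection/G/= inE/=; tauto.
have mcs : measurable_fun setT (fun z : T * T => (Num.sqrt (c z.1 z.2))%:E).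
  apply/measurable_EFinP; apply: (measurableT_comp _ mc).
  by apply: continuous_measurable_fun; exact: sqrt_continuous.
have -> : \int[u]_z (Num.sqrt (c z.1 z.2))%:E =
    \int[Pi \x mu]_z (Num.sqrt (c (F b z.2) (F z.1 z.2)))%:E.
  have := @ge0_integral_pushforward _ _ _ _ _ _ mG (Pi \x mu) setT _ measurableT mcs.
  by rewrite preimage_setT => <-.
have mcG : measurable_fun setT (fun z : T * S => (c (F b z.2) (F z.1 z.2))%:E).
  by apply/measurable_EFinP; exact: (measurableT_comp mc mG).
apply: (@le_trans _ _ (\int[Pi \x mu]_z ((k / 2)%:E +
    ((2 * k)^-1)%:E * (c (F b z.2) (F z.1 z.2))%:E))).
  apply: ge0_le_integral => //.
  - exact: (measurableT_comp mcs mG).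
  - by apply: emeasurable_funD => //; exact: measurable_funeM.
  - move=> z _; rewrite -EFinM -EFinD lee_fin.
    set t := c _ _; have t0 : (0 <= t)%R by exact: c0.
    have := sqr_ge0 (Num.sqrt t - k); rewrite sqrrB sqr_sqrtr// => h.
    rewrite -subr_ge0 (_ : _ - _ = (t - Num.sqrt t * k *+ 2 + k ^+ 2) / (2 * k))%R.
      by rewrite mulr_ge0.
    by field; rewrite gt_eqF.
rewrite ge0_integralD//; last 3 first.
- by move=> z _; rewrite lee_fin divr_ge0// ltW.
- by move=> z _; rewrite mule_ge0// lee_fin.
- exact: measurable_funeM.
rewrite (_ : \int[Pi \x mu]_z (k / 2)%:E = (k / 2)%:E); last first.
  exact: (integral_cst_mass1 (k / 2)%:E (probability_setT (Pi \x mu))).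
rewrite leeD2l// ge0_integralZl_EFin//; last by move=> z _; rewrite lee_fin.
rewrite fubini_tonelli1//; last by move=> z; rewrite lee_fin.
apply: (@le_trans _ _ (((2 * k)^-1)%:E * \int[Pi]_x ((r ^+ m)%:E * (c b x)%:E))).
  rewrite lee_wpmul2l ?lee_fin//; apply: ge0_le_integral => //.
  - by move=> x _; apply: integral_ge0 => s _; rewrite lee_fin.
  - by apply: measurable_fun_fubini_tonelli_F => // s; rewrite lee_fin.
  - exact: measurable_funeM.
  - by move=> x _; rewrite -EFinM; exact: (cF b x).
rewrite ge0_integralZl_EFin//; last 2 first.
- by move=> x _; rewrite lee_fin.
- by rewrite exprn_ge0// ltW.
by rewrite muleA -EFinM mulrC.
Qed.

(* A bound of the discrepancy by a multiple of sqrt (r c), linearised by a weight k. *)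
Hypothesis K_smoothing : forall b b' A (k : R), measurable A -> (0 < k)%R ->
  K b A <= K b' A + (k + r * c b b' / k)%:E.

(** The smoothing step is taken last, after the coupled maps have brought the two
points together. *)
Lemma iterate_smoothing m b b' A (k : R) : (0 < m)%N -> measurable A -> (0 < k)%R ->
  Kn m b A <= Kn m b' A + (k + r ^+ m * c b b' / k)%:E.
Proof.
move=> m0 mA k0; have ki : (0 < k^-1)%R by rewrite invr_gt0.
have [d' [S [mu [F [mF KE cF]]]]] := Kc.
have mKn j : measurable_fun setT (Kn j ^~ A).
  exact: contracting_random_map_measurable (iterate_contracting j) mA.
have Kn_ge0 j x : 0 <= Kn j x A.
  by have /andP[] := contracting_random_map_le1 x (iterate_contracting j) mA.
case: m m0 => // m _; elim: m b b' => [|m IH] b b'.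
  have e x : Kn 1 x A = K x A.
    rewrite KnS (integral_map_kernel mF (KE x))//.
    under eq_integral do rewrite Kn0 /dirac.
    rewrite KE// -[in RHS](setIT (F x @^-1` A)) -integral_indic//.
    by rewrite -[X in measurable X]setTI; exact: (measurable_map_at mF x).
  by rewrite !e expr1; exact: K_smoothing.
rewrite (KnS m.+1 b) (KnS m.+1 b').
rewrite (integral_map_kernel mF (KE b))// (integral_map_kernel mF (KE b'))//.
have mKF x : measurable_fun setT (fun s => Kn m.+1 (F x s) A).
  exact: (measurableT_comp (mKn _) (measurable_map_at mF x)).
have mcF : measurable_fun setT (fun s => (c (F b s) (F b' s))%:E).
  apply/measurable_EFinP.
  apply: (measurableT_comp mc (g := fun s => (F b s, F b' s))).
  by apply/measurable_fun_pairP; split; apply: measurable_map_at mF _.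
have q0 : (0 <= r ^+ m.+1 / k)%R by rewrite mulr_ge0 ?exprn_ge0 ?ltW.
apply: (@le_trans _ _ (\int[mu]_s (Kn m.+1 (F b' s) A +
    (k%:E + (r ^+ m.+1 / k)%:E * (c (F b s) (F b' s))%:E)))).
  apply: ge0_le_integral => //.
  - apply: emeasurable_funD => //; apply: emeasurable_funD => //.
    exact: measurable_funeM.
  - by move=> s _; rewrite -EFinM -EFinD mulrAC; exact: IH.
have cst_ge0 s : 0 <= k%:E + (r ^+ m.+1 / k)%:E * (c (F b s) (F b' s))%:E.
  by rewrite -EFinM -EFinD lee_fin addr_ge0 ?(ltW k0)// mulr_ge0.
rewrite ge0_integralD//; last first.
  by apply: emeasurable_funD => //; exact: measurable_funeM.
rewrite leeD2l// ge0_integralD//; last 3 first.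
- by move=> s _; rewrite lee_fin ltW.
- by move=> s _; rewrite -EFinM lee_fin mulr_ge0.
- exact: measurable_funeM.
rewrite -[X in X + _]/(\int[mu]_s cst k%:E s) integral_cst// EFinD.
apply: leeD; first by rewrite -[leRHS]mule1 lee_wpmul2l ?lee_fin ?(ltW k0)// probability_le1.
rewrite ge0_integralZl_EFin//; last by move=> s _; rewrite lee_fin.
apply: (le_trans (lee_wpmul2l _ (cF b b'))); first by rewrite lee_fin.
have -> : (r ^+ m.+2 * c b b' / k = r ^+ m.+1 / k * (r * c b b'))%R.
  by rewrite (exprSr r m.+1); ring.
by rewrite EFinM.
Qed.

(** The stationary law is an average of the iterates from all starting points, so
its discrepancy from one of them is at most the average discrepancy. *)
Lemma iterate_total_variation_le m b (k : R) : (0 < m)%N -> (0 < k)%R ->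
  Defs.total_variation (Kn m b) nu <=
  k%:E + (r ^+ m / k)%:E * \int[Pi]_b' (c b b')%:E.
Proof.
move=> m0 k0; apply: ge_ereal_sup => _ [A mA <-]; rewrite nuE//.
have ki : (0 < k^-1)%R by rewrite invr_gt0.
have mKn : measurable_fun setT (Kn m ^~ A).
  exact: contracting_random_map_measurable (iterate_contracting m) mA.
have Kn_ge0 x : 0 <= Kn m x A.
  by have /andP[] := contracting_random_map_le1 x (iterate_contracting m) mA.
have q0 : (0 <= r ^+ m / k)%R by rewrite mulr_ge0 ?exprn_ge0 ?ltW.
have mcb : measurable_fun setT (fun y => (c b y)%:E).
  by apply/measurable_EFinP; exact: (measurableT_comp mc (pair1_measurable b)).
set B := k%:E + _.
have BE : \int[Pi]_x (k%:E + (r ^+ m / k)%:E * (c b x)%:E) = B.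
  rewrite ge0_integralD//; last 3 first.
  - by move=> s _; rewrite lee_fin ltW.
  - by move=> s _; rewrite -EFinM lee_fin mulr_ge0.
  - exact: measurable_funeM.
  rewrite ge0_integralZl_EFin//; last by move=> s _; rewrite lee_fin.
  rewrite -[X in X + _]/(\int[Pi]_x cst k%:E x).
  by rewrite (integral_cst_mass1 k%:E (probability_setT Pi)).
have mB : measurable_fun setT (fun x => k%:E + (r ^+ m / k)%:E * (c b x)%:E).
  by apply: emeasurable_funD => //; exact: measurable_funeM.
have B0 x : 0 <= k%:E + (r ^+ m / k)%:E * (c b x)%:E.
  by rewrite -EFinM -EFinD lee_fin addr_ge0 ?(ltW k0)// mulr_ge0.
have KbE : \int[Pi]_x Kn m b A = Kn m b A.
  exact: (integral_cst_mass1 (Kn m b A) (probability_setT Pi)).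
have h1 : Kn m b A <= Pi A + B.
  rewrite -{1}KbE -(iterate_stationary m mA) -BE -ge0_integralD//.
  apply: ge0_le_integral => //; first exact: emeasurable_funD.
  move=> x _; rewrite -EFinM -EFinD mulrAC.
  exact: iterate_smoothing.
have h2 : Pi A <= Kn m b A + B.
  rewrite -{1}KbE -(iterate_stationary m mA) -BE -ge0_integralD//.
  apply: ge0_le_integral => //; first exact: emeasurable_funD.
  move=> x _; rewrite -EFinM -EFinD mulrAC csym.
  exact: iterate_smoothing.
have f1 : Kn m b A \is a fin_num.
  have /andP[_ h] := contracting_random_map_le1 b (iterate_contracting m) mA.
  by rewrite ge0_fin_numE// (le_lt_trans h)// ltry.
have f2 : Pi A \is a fin_num by exact: fin_num_measure.
rewrite -(fineK f1) -(fineK f2) in h1 h2 *.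
case: B h1 h2 {BE} => [q| |] //=.
  rewrite -!EFinD !lee_fin => h1 h2; rewrite ler_norml; lra.
by move=> _ _; exact: leey.
Qed.

End random_map_chain.

(** * The posterior is stationary for the Albert-Chib chain *)

Section albert_chib_chain.
Context {R : realType} (n p : nat).
Variables (X : 'M[R]_(n, p)) (y : 'I_n -> bool) (Q : 'M[R]_p) (v : 'cV[R]_p).
Local Notation Phi := (@normal_cdf R).
Local Notation S := (ac_Sigma X Q).
Local Notation lp := (linpred X).
Local Notation leb k := (@lebesgue_cV R k).

Definition label_prob (a : bool) (l : R) : R := Phi (if a then l else - l).

Lemma label_prob_gt0 a l : 0 < label_prob a l.
Proof. exact: Phi_gt0. Qed.

Lemma posterior_weightE b : posterior_weight X y Q v b =
  (\prod_i label_prob (y i) (lp b i)) * expR (- (qform Q (b - v) / 2)).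
Proof.
rewrite /posterior_weight; congr (_ * _); apply: eq_bigr => i _.
rewrite /label_prob; case: (y i) => /=; first by rewrite expr1 expr0 mulr1.
by rewrite expr1 expr0 mul1r Phi_reflect.
Qed.

Definition tn_pdf (a : bool) (l x : R) : R :=
  normal_pdf l 1 x * \1_(trunc_support a) x / label_prob a l.

Lemma tn_pdf_ge0 a l x : 0 <= tn_pdf a l x.
Proof.
by rewrite /tn_pdf indicE divr_ge0 ?(ltW (label_prob_gt0 _ _))// mulr_ge0 ?normal_pdf_ge0.
Qed.

Lemma measurable_tn_pdf a l : measurable_fun setT (tn_pdf a l).
Proof.
apply: measurable_funM; last exact: measurable_cst.
apply: measurable_funM; first exact: measurable_normal_pdf.
apply: measurable_indic; exact: (@measurable_trunc_support R a).
Qed.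

Lemma truncated_normal_density a l (A : set (measurableTypeR R)) : measurable A ->
  truncated_normal l a A = (\int[lebesgue_measure]_(x in A) (tn_pdf a l x)%:E)%E.
Proof.
move=> mA; rewrite truncated_normalE// normal_prob_integral.
have i0 : 0 <= (label_prob a l)^-1 by rewrite invr_ge0 ltW// label_prob_gt0.
have mAs : measurable (A `&` trunc_support a).
  by apply: measurableI => //; exact: measurable_trunc_support.
rewrite muleC -ge0_integralZl_EFin//; last 2 first.
- by move=> x _; rewrite lee_fin normal_pdf_ge0.
- exact: measurable_normal_pdf_EFin.
rewrite integral_mkcondr; apply: eq_integral => x _.
rewrite patchE /tn_pdf indicE; case: ifPn => _; last by rewrite mulr0 mul0r.
by rewrite mulr1 -EFinM mulrC.
Qed.

Lemma lpB b b' i : lp b i - lp b' i = lp (b - b') i.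
Proof. by rewrite /linpred mulmxBr !mxE. Qed.

Lemma lp_mid b b' i : (lp b i + lp b' i) / 2 = lp (2^-1 *: (b + b')) i.
Proof. by rewrite /linpred -scalemxAr mulmxDr !mxE mulrC. Qed.

Lemma sum_lp_sqr b : \sum_i lp b i ^+ 2 = dotv (X *m b) (X *m b).
Proof. by rewrite dotvE; apply: eq_bigr => i _; rewrite expr2. Qed.

Lemma measurable_lp : forall i, measurable_fun setT (fun b : 'cV[R]_p => lp b i).
Proof.
by move=> i; apply: measurable_entry; apply: measurable_mulmxl; exact: measurable_id.
Qed.

Lemma measurable_posterior_weight : measurable_fun setT (posterior_weight X y Q v).
Proof.
rewrite (_ : posterior_weight X y Q v = fun b =>
  (\prod_i label_prob (y i) (lp b i)) * expR (- (qform Q (b - v) / 2))); last first.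
  by apply/funext => b; exact: posterior_weightE.
apply: measurable_funM.
  apply: measurable_prod => i _.
  apply: (measurableT_comp (f := Phi)).
    by apply: continuous_measurable_fun; exact: continuous_Phi.
  by case: (y i); [|apply: measurable_funN]; exact: measurable_lp.
apply: measurable_expR_half.
apply: measurable_qform; apply: measurable_mxB; first exact: measurable_id.
exact: measurable_cst.
Qed.

Lemma posterior_weight_gt0 b : 0 < posterior_weight X y Q v b.
Proof.
by rewrite posterior_weightE mulr_gt0 ?expR_gt0// prodr_gt0// => i _; exact: label_prob_gt0.
Qed.

Hypotheses (psdQ : possemidefmx Q) (pS : posdefmx S).

Definition ac_mean (z : 'cV[R]_n) : 'cV[R]_p := invmx S *m (X^T *m z + Q *m v).

Lemma measurable_ac_mean d (T : measurableType d) (f : T -> 'cV[R]_n) :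
  measurable_fun setT f -> measurable_fun setT (fun t => ac_mean (f t)).
Proof.
move=> mf; apply: measurable_mulmxl; apply: measurable_mxD; last exact: measurable_cst.
exact: measurable_mulmxl.
Qed.

(** Completing the square in b: the joint density of (b, z) is, in b, a multiple
of the normal density centred at the posterior mean given z. *)
Lemma complete_square b z :
  dotv (z - X *m b) (z - X *m b) + qform Q (b - v) =
  qform S (b - ac_mean z) + (dotv z z + qform Q v - qform S (ac_mean z)).
Proof.
have uS := posdef_unit pS; have [sS _] := pS; have [sQ _] := psdQ.
have Sm : S *m ac_mean z = X^T *m z + Q *m v by rewrite mulKVmx.
rewrite !qformD// !qformN !mulmxN !dotvNr Sm dotvDl !dotvDr !dotvNl !dotvNr.
rewrite [qform S b]qformDm qform_gram (dotv_mulmx X^T) trmxK (dotvC z (X *m b)).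
ring.
Qed.

(** The unnormalised joint density of the data augmentation: the coefficient
vector b and latent normal variables z whose signs are the responses. *)
Definition joint_density (b : 'cV[R]_p) (z : 'cV[R]_n) : R :=
  posterior_weight X y Q v b * \prod_i tn_pdf (y i) (lp b i) (z i ord0).

(** The unnormalised marginal density of the latent variables. *)
Definition latent_weight (z : 'cV[R]_n) : R :=
  (\prod_i \1_(trunc_support (y i)) (z i ord0)) * normal_peak 1 ^+ n *
  expR (- ((dotv z z + qform Q v - qform S (ac_mean z)) / 2)) *
  Num.sqrt ((2 * pi) ^+ p * \det (invmx S)).

Lemma joint_densityE b z :
  joint_density b z = latent_weight z * mvnormal_pdf (ac_mean z) (invmx S) b.
Proof.
have s0 : Num.sqrt ((2 * pi) ^+ p * \det (invmx S)) != 0.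
  rewrite gt_eqF// sqrtr_gt0 mulr_gt0 ?exprn_gt0 ?mulr_gt0 ?pi_gt0//.
  by have [] := gaussian_integral0 (posdef_inv pS).
rewrite /joint_density /latent_weight /mvnormal_pdf invmxK posterior_weightE.
have -> : \prod_i tn_pdf (y i) (lp b i) (z i ord0) =
    (\prod_i \1_(trunc_support (y i)) (z i ord0)) * normal_peak 1 ^+ n *
    expR (- (dotv (z - X *m b) (z - X *m b) / 2)) /
    \prod_i label_prob (y i) (lp b i).
  rewrite /tn_pdf big_split /= big_split /= prodfV; congr (_ / _).
  rewrite mulrC -mulrA; congr (_ * _).
  under eq_bigr do rewrite normal_pdf1E.
  rewrite big_split /= prodr_const card_ord; congr (_ * _).
  rewrite -expR_sum; congr expR.
  rewrite dotvE mulr_suml -sumrN; apply: eq_bigr => i _.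
  have -> : (z - X *m b) i ord0 = z i ord0 - lp b i by rewrite /linpred !mxE.
  by rewrite -expr2 mulNr.
have -> : expR (- (qform S (b - ac_mean z) / 2)) =
    expR (- (dotv (z - X *m b) (z - X *m b) / 2)) * expR (- (qform Q (b - v) / 2))
    / expR (- ((dotv z z + qform Q v - qform S (ac_mean z)) / 2)).
  rewrite -expRN -!expRD; congr expR; have := complete_square b z; lra.
have P0 : \prod_i label_prob (y i) (lp b i) != 0.
  by rewrite gt_eqF// prodr_gt0// => i _; exact: label_prob_gt0.
have E0 : expR (- ((dotv z z + qform Q v - qform S (ac_mean z)) / 2)) != 0.
  by rewrite gt_eqF// expR_gt0.
by field; rewrite P0 E0 s0.
Qed.

Lemma latent_weight_ge0 z : 0 <= latent_weight z.
Proof.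
rewrite /latent_weight !mulr_ge0 ?expR_ge0 ?sqrtr_ge0 ?exprn_ge0 ?normal_peak_ge0//.
by apply: prodr_ge0 => i _; rewrite indicE.
Qed.

Lemma measurable_latent_weight : measurable_fun setT latent_weight.
Proof.
have mid k : measurable_fun setT (fun z : 'cV[R]_k => z) by exact: measurable_id.
apply: measurable_funM; last exact: measurable_cst.
apply: measurable_funM.
  apply: measurable_funM; last exact: measurable_cst.
  apply: (measurable_prodr_entry (f := fun i x => \1_(trunc_support (y i)) x)) => i.
  apply: measurable_indic; exact: (@measurable_trunc_support R (y i)).
apply: measurable_expR_half.
apply: measurable_funB; last by apply: measurable_qform; exact: measurable_ac_mean.
by apply: measurable_funD; [exact: measurable_dotv|exact: measurable_cst].
Qed.

Lemma measurable_joint_density :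
  measurable_fun setT (fun w : 'cV[R]_p * 'cV[R]_n => joint_density w.1 w.2).
Proof.
under eq_fun do rewrite joint_densityE.
apply: measurable_funM.
  exact: (measurableT_comp measurable_latent_weight measurable_snd).
apply: measurable_funM; first exact: measurable_cst.
apply: measurable_expR_half.
apply: measurable_qform; apply: measurable_mxB; first exact: measurable_fst.
by apply: measurable_ac_mean; exact: measurable_snd.
Qed.

Lemma joint_density_ge0 b z : 0 <= joint_density b z.
Proof. by rewrite joint_densityE mulr_ge0 ?latent_weight_ge0 ?mvnormal_pdf_ge0. Qed.

Local Open Scope ereal_scope.

Let pSi : posdefmx (invmx S) := posdef_inv pS.

Lemma measurable_mvnormal_prob_mean A : measurable A ->
  measurable_fun setT (fun z => mvnormal_prob (ac_mean z) (invmx S) A).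
Proof.
move=> mA; rewrite (_ : (fun _ => _) = fun z =>
  gaussian_noise pSi ((fun w => w + ac_mean z)%R @^-1` A)); last first.
  by apply/funext => z; rewrite (mvnormal_prob_noise pSi).
apply: (@measurable_map_kernel _ _ R _ _ (gaussian_noise pSi) _ _
  (fun (z : 'cV[R]_n) (w : 'cV[R]_p) => w + ac_mean z)%R) => //.
apply: measurable_mxD; first exact: measurable_snd.
by apply: measurable_ac_mean; exact: measurable_fst.
Qed.

Lemma mvnormal_prob_ge0 k m (V : 'M[R]_k) A : 0 <= mvnormal_prob m V A.
Proof. by apply: integral_ge0 => b _; rewrite lee_fin mvnormal_pdf_ge0. Qed.

Lemma integral_latent b (f : 'cV[R]_n -> \bar R) :
  measurable_fun setT f -> (forall z, 0 <= f z) ->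
  (posterior_weight X y Q v b)%:E *
    \int[prod_measure (fun i => truncated_normal (lp b i) (y i))]_z f z =
  \int[leb n]_z ((joint_density b z)%:E * f z).
Proof.
move=> mf f0; rewrite (@ge0_integral_prod_measure_density _ _ _
  (fun i x => tn_pdf (y i) (lp b i) x))//; last 3 first.
- by move=> i; exact: measurable_tn_pdf.
- by move=> i x; exact: tn_pdf_ge0.
- by move=> i A mA; exact: truncated_normal_density.
rewrite -ge0_integralZl_EFin//.
- by apply: eq_integral => z _; rewrite muleA -EFinM.
- by move=> z _; rewrite mule_ge0// lee_fin prodr_ge0// => i _; exact: tn_pdf_ge0.
- apply: emeasurable_funM => //; apply/measurable_EFinP.
  apply: (measurable_prodr_entry (f := fun i x => tn_pdf (y i) (lp b i) x)) => i.
  exact: measurable_tn_pdf.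
- exact/ltW/posterior_weight_gt0.
Qed.

(** Both (b, z) -> z and (b, z) -> b are conditional draws from the joint density,
so the b-marginal is left invariant. *)
Lemma posterior_mass_stationary A : measurable A ->
  \int[leb p]_b ((posterior_weight X y Q v b)%:E * ac_kernel X y Q v b A) =
  \int[leb p]_(b in A) (posterior_weight X y Q v b)%:E.
Proof.
move=> mA.
pose H z := mvnormal_prob (ac_mean z) (invmx S) A.
have mH : measurable_fun setT H by exact: measurable_mvnormal_prob_mean.
have H0 z : 0 <= H z by exact: mvnormal_prob_ge0.
have HE z : mvnormal_prob (ac_mean z) (invmx S) A = H z by [].
clearbody H.
have mJ : measurable_fun setT
    (fun w : 'cV[R]_p * 'cV[R]_n => (joint_density w.1 w.2)%:E).
  by apply/measurable_EFinP; exact: measurable_joint_density.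
transitivity (\int[leb p]_b \int[leb n]_z ((joint_density b z)%:E * H z)).
  apply: eq_integral => b _; rewrite -integral_latent//; congr (_ * _).
  by apply: eq_integral => z _; exact: HE.
rewrite (@fubini_tonelli _ _ _ _ _ (leb p) (leb n)
  (fun w => (joint_density w.1 w.2)%:E * H w.2)); first last.
- by move=> w; rewrite mule_ge0// lee_fin joint_density_ge0.
- apply: emeasurable_funM; first exact: mJ.
  exact: (measurableT_comp mH measurable_snd).
pose ind (b : 'cV[R]_p) := (\1_A b)%:E : \bar R.
have mi : measurable_fun setT ind by apply/measurable_EFinP; exact: measurable_indic.
have ind0 b : 0 <= ind b by rewrite lee_fin indicE.
transitivity (\int[leb n]_z \int[leb p]_b ((joint_density b z)%:E * ind b)).
  apply: eq_integral => z _ /=.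
  have lw0 := latent_weight_ge0 z.
  transitivity ((latent_weight z)%:E * H z).
    transitivity (\int[leb p]_b (((latent_weight z)%:E * H z) *
        (mvnormal_pdf (ac_mean z) (invmx S) b)%:E)).
      by apply: eq_integral => b _; rewrite joint_densityE EFinM muleAC.
    rewrite ge0_integralZl//.
    - by rewrite (mvnormal_total _ pSi) mule1.
    - exact: measurable_mvnormal_pdf_EFin.
    - by move=> b _; rewrite lee_fin mvnormal_pdf_ge0.
    - by rewrite mule_ge0.
  rewrite -HE /mvnormal_prob integral_mkcond -ge0_integralZl_EFin//; last 2 first.
  - by move=> b _; apply: erestrict_ge0 => b' _; rewrite lee_fin mvnormal_pdf_ge0.
  - by apply/(measurable_restrictT _ mA); exact: measurable_mvnormal_pdf_EFin.
  apply: eq_integral => b _; rewrite patchE joint_densityE /ind indicE.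
  by case: ifPn => _; rewrite ?mule1 ?mule0.
rewrite -(@fubini_tonelli _ _ _ _ _ (leb p) (leb n)
  (fun w => (joint_density w.1 w.2)%:E * ind w.1)); first last.
- by move=> w; rewrite mule_ge0// lee_fin joint_density_ge0.
- apply: emeasurable_funM; first exact: mJ.
  exact: (measurableT_comp mi measurable_fst).
rewrite [RHS]integral_mkcond; apply: eq_integral => b _ /=.
rewrite -(@integral_latent b (fun=> ind b))//.
rewrite -[X in _ * X]/(\int[_]_z cst (ind b) z) integral_cst_mass1; last first.
  by apply: prod_measure_setT => i; exact: probability_setT.
by rewrite patchE /ind indicE; case: ifPn => _; rewrite ?mule1 ?mule0.
Qed.

End albert_chib_chain.

(** * Contraction of the Albert-Chib chain under overlap *)

Section uniform_upper_half.
Context {R : realType}.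
Local Open Scope ereal_scope.

Lemma unif_upper_half : unif `[(1 / 2)%R, 1%R]%classic = (1 / 2)%:E :> \bar R.
Proof.
rewrite unifE; last exact: measurable_itv.
rewrite (_ : _ `&` _ = `[(1 / 2)%R, 1%R]%classic :> set R); last first.
  by apply/seteqP; split => x /=; rewrite !in_itv/=; lra.
rewrite lebesgue_measure_itv/= lte_fin (_ : 1 / 2 < 1 :> R)%R; last by lra.
by rewrite -EFinD; congr EFin; lra.
Qed.

Lemma integral_upper_half (g : bool) (a : R) : (0 <= a)%R ->
  \int[unif]_x ((1 - g%:R * \1_`[1 / 2, 1]%classic x / 4) * a)%:E = ((1 - g%:R / 8) * a)%:E.
Proof.
move=> a0; case: g; last first.
  rewrite [RHS](_ : _ = a%:E); last by rewrite mul0r subr0 mul1r.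
  under eq_integral do rewrite !mul0r subr0 mul1r.
  exact: (integral_cst_mass1 a%:E (probability_setT unif)).
have mI : measurable (`[(1 / 2)%R, 1%R]%classic : set (measurableTypeR R)).
  exact: measurable_itv.
transitivity (\int[unif]_x ((3 / 4 * a)%:E +
    (a / 4)%:E * (\1_(~` `[(1 / 2)%R, 1%R]%classic) x)%:E)).
  apply: eq_integral => x _; rewrite -EFinM -EFinD; congr EFin.
  rewrite !indicE in_setC; case: (x \in _); rewrite /= ?mulr1n ?mulr0n; lra.
have mC : measurable (~` `[(1 / 2)%R, 1%R]%classic : set (measurableTypeR R)).
  exact: measurableC.
rewrite ge0_integralD//; last 3 first.
- by move=> x _; rewrite lee_fin; lra.
- by move=> x _; rewrite -EFinM lee_fin mulr_ge0 ?indicE//; lra.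
- by apply: measurable_funeM; apply/measurable_EFinP; exact: measurable_indic.
rewrite -[X in X + _]/(\int[unif]_x cst (3 / 4 * a)%:E x).
rewrite (integral_cst_mass1 _ (probability_setT unif)).
rewrite ge0_integralZl_EFin//; last 2 first.
- by apply/measurable_EFinP; exact: measurable_indic.
- by lra.
have -> : \int[unif]_x (\1_(~` `[(1 / 2)%R, 1%R]%classic) x)%:E = (1 / 2)%:E :> \bar R.
  rewrite integral_indic// setIT.
  transitivity (1 - unif `[(1 / 2)%R, 1%R]%classic : \bar R).
    exact: (probability_setC unif mI).
  by rewrite unif_upper_half -EFinB; congr EFin; lra.
by rewrite -EFinM -EFinD [(true%:R)%R](_ : _ = 1%R)//; congr EFin; lra.
Qed.

End uniform_upper_half.

Section uniform_vector.
Context {R : realType} (n : nat).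
Local Open Scope ereal_scope.

Definition unif_cV : set 'cV[R]_n -> \bar R := prod_measure (fun=> unif).

HB.instance Definition _ := Measure.on unif_cV.

Let unif_cV_setT : unif_cV setT = 1.
Proof. by apply: prod_measure_setT => i; exact: probability_setT. Qed.

HB.instance Definition _ := @Measure_isProbability.Build _ _ _ unif_cV unif_cV_setT.

End uniform_vector.
Arguments unif_cV {R} n _.

Section albert_chib_contraction.
Context {R : realType} (n p : nat).
Variables (X : 'M[R]_(n, p)) (y : 'I_n -> bool) (Q : 'M[R]_p) (v : 'cV[R]_p).
Local Notation S := (ac_Sigma X Q).
Local Notation lp := (linpred X).

(** A quantitative form of the classical condition for the existence of the
maximum likelihood estimate, that no direction b separates the two classes. *)
Definition overlap (e : R) : Prop := forall a b : 'cV[R]_p,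
  e * (\sum_i lp a i ^+ 2) <=
  \sum_(i | misclassified (y i) (lp b i)) lp a i ^+ 2.

Hypotheses (psdQ : possemidefmx Q) (pS : posdefmx S).

Let pSi : posdefmx (invmx S) := posdef_inv pS.

Definition latent (b : 'cV[R]_p) (u : 'cV[R]_n) : 'cV[R]_n :=
  \col_i tn_map (y i) (lp b i) (u i ord0).

Definition ac_map (b : 'cV[R]_p) (s : 'cV[R]_n * 'cV[R]_p) : 'cV[R]_p :=
  s.2 + ac_mean X Q v (latent b s.1).

Lemma measurable_latent :
  measurable_fun setT (fun w : 'cV[R]_p * 'cV[R]_n => latent w.1 w.2).
Proof.
apply: measurable_fun_mxP => i j; under eq_fun do rewrite mxE.
apply: (measurableT_comp (@measurable_tn_map R (y i))
  (g := fun w : 'cV[R]_p * 'cV[R]_n => (lp w.1 i, w.2 i ord0))).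
apply/measurable_fun_pairP; split => /=.
  exact: (measurableT_comp (measurable_lp X i) measurable_fst).
exact: (measurableT_comp (measurable_mx_entry i ord0) measurable_snd).
Qed.

Lemma measurable_ac_map :
  measurable_fun setT (fun w : 'cV[R]_p * ('cV[R]_n * 'cV[R]_p) => ac_map w.1 w.2).
Proof.
apply: measurable_mxD; first exact: (measurableT_comp measurable_snd measurable_snd).
apply: measurable_ac_mean.
apply: (measurableT_comp measurable_latent
  (g := fun w : 'cV[R]_p * ('cV[R]_n * 'cV[R]_p) => (w.1, w.2.1))).
apply/measurable_fun_pairP; split => /=; first exact: measurable_fst.
exact: (measurableT_comp measurable_fst measurable_snd).
Qed.

Local Open Scope ereal_scope.

Lemma measurable_latent_at b : measurable_fun setT (latent b).
Proof. exact: (measurableT_comp measurable_latent (pair1_measurable b)). Qed.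

Lemma ac_kernel_latent b A : measurable A -> ac_kernel X y Q v b A =
  \int[unif_cV n]_u mvnormal_prob (ac_mean X Q v (latent b u)) (invmx S) A.
Proof.
move=> mA; rewrite /ac_kernel (@ge0_integral_prod_measure_pushforward _ _ _
  (fun=> unif) (fun i => tn_map (y i) (lp b i)))//.
- by move=> i; exact: measurable_tn_map_snd.
- by move=> i B mB; exact: tn_map_law.
- exact: measurable_mvnormal_prob_mean.
- by move=> z; exact: mvnormal_prob_ge0.
Qed.

Lemma ac_kernel_map b A : measurable A -> ac_kernel X y Q v b A =
  (unif_cV n \x gaussian_noise pSi) (ac_map b @^-1` A).
Proof.
move=> mA; transitivity (\int[unif_cV n]_u
  mvnormal_prob (ac_mean X Q v (latent b u)) (invmx S) A).
  exact: ac_kernel_latent.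
transitivity (\int[unif_cV n]_u
  gaussian_noise pSi (xsection (ac_map b @^-1` A) u)); last by [].
apply: eq_integral => u _; rewrite (mvnormal_prob_noise pSi)//; congr (_ _).
by apply/seteqP; split => w; rewrite /xsection/= inE.
Qed.

Lemma latent_sqr_le b b' u :
  (dotv (latent b u - latent b' u) (latent b u - latent b' u) <=
   \sum_i (1 - (misclassified (y i) (lp (2^-1 *: (b + b')) i))%:R *
      \1_`[1 / 2, 1] (u i ord0) / 4) * lp (b - b') i ^+ 2)%R.
Proof.
rewrite dotvE; apply: ler_sum => i _; rewrite -expr2.
have -> : ((latent b u - latent b' u) i ord0 =
    tn_map (y i) (lp b i) (u i ord0) - tn_map (y i) (lp b' i) (u i ord0))%R.
  by rewrite !mxE.
rewrite -lp_mid -lpB; case: (boolP (misclassified _ _)) => [mis|_].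
  by rewrite [(true%:R * _)%R]mul1r; exact: tn_map_sqr_contract.
by rewrite !mul0r subr0 mul1r; exact: tn_map_sqr_le.
Qed.

Lemma ac_mean_sqr_le b b' u :
  (qform S (ac_mean X Q v (latent b u) - ac_mean X Q v (latent b' u)) <=
   dotv (latent b u - latent b' u) (latent b u - latent b' u))%R.
Proof.
have -> : (ac_mean X Q v (latent b u) - ac_mean X Q v (latent b' u) =
    invmx S *m (X^T *m (latent b u - latent b' u)))%R.
  rewrite /ac_mean -mulmxBr; congr (_ *m _).
  by rewrite opprD addrACA subrr addr0 mulmxBr.
by apply: gram_contraction => //; exact: posdef_unit.
Qed.

(** A coordinate misclassified at the midpoint of b and b' loses at least a quarter
of its squared distance for half of the uniform values, that is an eighth on
average; overlap at the midpoint makes this a fraction of the whole. *)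
Lemma latent_contraction e b b' : (e <= 1)%R -> overlap e ->
  \int[unif_cV n]_u
    (qform S (ac_mean X Q v (latent b u) - ac_mean X Q v (latent b' u)))%:E <=
  ((1 - e / 8) * qform S (b - b'))%:E.
Proof.
move=> e1 ov.
pose g i := misclassified (y i) (lp (2^-1 *: (b + b')) i).
pose h (i : 'I_n) (x : R) : R :=
  ((1 - (g i)%:R * \1_`[1 / 2, 1] x / 4) * lp (b - b') i ^+ 2)%R.
have h0 i x : (0 <= h i x)%R.
  rewrite /h mulr_ge0 ?sqr_ge0// indicE.
  by case: (g i); case: (_ \in _); rewrite /= ?mulr1n ?mulr0n; lra.
have mh i : measurable_fun setT (EFin \o h i).
  apply/measurable_EFinP; apply: measurable_funM; last exact: measurable_cst.
  apply: measurable_funB; first exact: measurable_cst.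
  apply: measurable_funM; last exact: measurable_cst.
  apply: measurable_funM; first exact: measurable_cst.
  by apply: measurable_indic; exact: measurable_itv.
have mhu i : measurable_fun setT (fun u : 'cV[R]_n => (h i (u i ord0))%:E).
  exact: (measurableT_comp (mh i) (measurable_mx_entry i ord0)).
apply: (@le_trans _ _ (\int[unif_cV n]_u \sum_i (h i (u i ord0))%:E)).
  apply: ge0_le_integral => //.
  - by move=> u _; rewrite lee_fin; exact: (posdef_psd pS).2.
  - apply/measurable_EFinP; apply: measurable_qform.
    by apply: measurable_mxB; apply: measurable_ac_mean; exact: measurable_latent_at.
  - exact: emeasurable_sum.
  - move=> u _; rewrite sumEFin lee_fin; apply: (le_trans (ac_mean_sqr_le b b' u)).
    exact: latent_sqr_le.
rewrite ge0_integral_sum//; last by move=> i u _; rewrite lee_fin.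
rewrite (eq_bigr (fun i => ((1 - (g i)%:R / 8) * lp (b - b') i ^+ 2)%:E)); last first.
  move=> i _; rewrite -(integral_upper_half (g i) (sqr_ge0 (lp (b - b')%R i))).
  rewrite (@integral_prod_measure_coord _ _ (fun=> unif) i (EFin \o h i))//.
  - by move=> j; exact: probability_setT.
  - exact: mh.
  - by move=> x; rewrite lee_fin.
rewrite sumEFin lee_fin.
have := ov (b - b')%R (2^-1 *: (b + b'))%R.
rewrite [X in (_ <= X)%R -> _]big_mkcond/= => ov'.
have hQ : (\sum_i lp (b - b') i ^+ 2 <= qform S (b - b'))%R.
  by rewrite sum_lp_sqr [leRHS]qformDm qform_gram lerDl; exact: psdQ.2.
have -> : (\sum_i (1 - (g i)%:R / 8) * lp (b - b') i ^+ 2 = \sum_i lp (b - b') i ^+ 2 -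
    (\sum_i (if g i then lp (b - b') i ^+ 2 else 0)) / 8)%R.
  rewrite mulr_suml -sumrB; apply: eq_bigr => i _.
  by case: (g i); rewrite /= ?mulr1n ?mulr0n; lra.
set t := (\sum_i lp (b - b') i ^+ 2)%R in ov' hQ *.
apply: (@le_trans _ _ ((1 - e / 8) * t)%R); first by rewrite -/t; lra.
by rewrite ler_wpM2l//; lra.
Qed.

(** The Gaussian noise is common to both copies and cancels. *)
Lemma ac_map_contracting e : (e <= 1)%R -> overlap e ->
  contracting_random_map (ac_kernel X y Q v) (fun b b' => qform S (b - b')) (1 - e / 8).
Proof.
move=> e1 ov; exists _, ('cV[R]_n * 'cV[R]_p)%type, (unif_cV n \x gaussian_noise pSi), ac_map.
split; first exact: measurable_ac_map.
- by move=> b A mA; exact: ac_kernel_map.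
- move=> b b'; apply: le_trans (latent_contraction b b' e1 ov).
  have q0 x : (0 <= qform S x)%R by exact: (posdef_psd pS).2.
  rewrite fubini_tonelli1//; last first.
  - by move=> s; rewrite lee_fin.
  - apply/measurable_EFinP/measurable_qform/measurable_mxB;
      exact: (measurable_map_at measurable_ac_map).
  rewrite le_eqVlt; apply/orP; left; apply/eqP; apply: eq_integral => u _.
  rewrite /fubini_F /=.
  transitivity (\int[gaussian_noise pSi]_w cst (qform S
      (ac_mean X Q v (latent b u) - ac_mean X Q v (latent b' u)))%:E w).
    by apply: eq_integral => w _; rewrite /ac_map/= opprD addrACA subrr add0r.
  exact: (integral_cst_mass1 _ (probability_setT (gaussian_noise pSi))).
Qed.

(** Given the latent variables, the two transition laws are normal with a common
covariance and means that are close on average. *)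
Lemma ac_kernel_smoothing e b b' A (k : R) : (e <= 1)%R -> overlap e -> measurable A -> (0 < k)%R ->
  ac_kernel X y Q v b A <= ac_kernel X y Q v b' A +
    (k + (1 - e / 8) * qform S (b - b') / k)%:E.
Proof.
move=> e1 ov mA k0; rewrite !ac_kernel_latent//.
have q0 x : (0 <= qform S x)%R by exact: (posdef_psd pS).2.
have ki : (0 <= k^-1)%R by rewrite invr_ge0 ltW.
pose D u := qform S (ac_mean X Q v (latent b u) - ac_mean X Q v (latent b' u)).
have D0 u : (0 <= D u)%R by exact: q0.
have mD : measurable_fun setT (fun u => (D u)%:E).
  apply/measurable_EFinP/measurable_qform/measurable_mxB;
    by apply: measurable_ac_mean; exact: measurable_latent_at.
have mN x : measurable_fun setT
    (fun u => mvnormal_prob (ac_mean X Q v (latent x u)) (invmx S) A).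
  exact: (measurableT_comp (measurable_mvnormal_prob_mean v pS mA) (measurable_latent_at x)).
have ID := latent_contraction b b' e1 ov.
apply: (@le_trans _ _ (\int[unif_cV n]_u
   (mvnormal_prob (ac_mean X Q v (latent b' u)) (invmx S) A +
    (k%:E + (k^-1)%:E * (D u)%:E)))).
  apply: ge0_le_integral => //.
  - by move=> u _; exact: mvnormal_prob_ge0.
  - apply: emeasurable_funD => //; apply: emeasurable_funD => //.
    exact: measurable_funeM.
  - move=> u _; rewrite -EFinM -EFinD [(k^-1 * _)%R]mulrC /D.
    have := mvnormal_prob_lipschitz (ac_mean X Q v (latent b u))
      (ac_mean X Q v (latent b' u)) pSi mA k0.
    by rewrite invmxK.
have kD u : 0 <= k%:E + (k^-1)%:E * (D u)%:E.
  by rewrite -EFinM -EFinD lee_fin addr_ge0 ?mulr_ge0// ltW.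
rewrite ge0_integralD//; last 2 first.
- by move=> u _; exact: mvnormal_prob_ge0.
- by apply: emeasurable_funD => //; exact: measurable_funeM.
rewrite leeD2l// ge0_integralD//; last 3 first.
- by move=> u _; rewrite lee_fin ltW.
- by move=> u _; rewrite mule_ge0// lee_fin.
- exact: measurable_funeM.
rewrite -[X in X + _]/(\int[unif_cV n]_x cst k%:E x).
rewrite (integral_cst_mass1 _ (probability_setT (unif_cV n))).
rewrite ge0_integralZl_EFin//; last by move=> u _; rewrite lee_fin.
rewrite EFinD leeD2l//; apply: (le_trans (lee_wpmul2l _ ID)); first by rewrite lee_fin.
by rewrite -EFinM mulrC.
Qed.

End albert_chib_contraction.

(** * Convergence rates for a fixed data set *)

Section albert_chib_rate.
Context {R : realType} (n p : nat).
Variables (X : 'M[R]_(n, p)) (y : 'I_n -> bool) (Q : 'M[R]_p) (v : 'cV[R]_p).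
Local Notation S := (ac_Sigma X Q).
Local Notation lp := (linpred X).
Local Notation w := (posterior_weight X y Q v).
Local Notation leb := (@lebesgue_cV R p).

Hypotheses (psdQ : possemidefmx Q) (pX : posdefmx (X^T *m X)).
Variable (e : R).
Hypotheses (e0 : 0 < e) (e1 : e <= 1) (ov : overlap X y e).

Lemma ac_Sigma_posdef : posdefmx S.
Proof.
have [sX X0] := pX; have [sQ Q0] := psdQ; split.
  by rewrite /ac_Sigma linearD /= sX sQ.
by move=> u u0; rewrite qformDm ltr_wpDr// X0.
Qed.
Let pS := ac_Sigma_posdef.

(** A misclassified observation with linear predictor l contributes a factor at
most exp(- l^2 / 2); overlap in the direction b itself makes these factors
a Gaussian weight. *)
Lemma posterior_weight_le b : w b <= expR (- (e / 2 * qform (X^T *m X) b)).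
Proof.
rewrite posterior_weightE -[leRHS]mulr1; apply: ler_pM.
- by apply: prodr_ge0 => i _; exact/ltW/label_prob_gt0.
- exact: expR_ge0.
- apply: (@le_trans _ _ (\prod_i expR (- ((misclassified (y i) (lp b i))%:R *
      lp b i ^+ 2 / 2)))).
    apply: ler_prod => i _; rewrite (ltW (label_prob_gt0 _ _))/= /label_prob.
    case: (boolP (misclassified _ _)) => [|_]; last first.
      by rewrite mul0r mul0r oppr0 expR0 Phi_le1.
    rewrite /misclassified mulr1n mul1r; case: (y i) => l0.
      have := @Phi_tail R (- lp b i); rewrite opprK sqrrN mulNr; apply; lra.
    by have := Phi_tail l0; rewrite mulNr.
  rewrite -expR_sum ler_expR sumrN lerN2 qform_gram -sum_lp_sqr.
  have := ov b b; rewrite [X in _ <= X -> _]big_mkcond/= => h.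
  rewrite -mulr_suml.
  have -> : \sum_i (misclassified (y i) (lp b i))%:R * lp b i ^+ 2 =
      \sum_i (if misclassified (y i) (lp b i) then lp b i ^+ 2 else 0).
    by apply: eq_bigr => i _; case: (misclassified _ _); rewrite ?mulr1n ?mul1r ?mul0r.
  lra.
- by rewrite -[leRHS]expR0 ler_expR oppr_le0 divr_ge0//; exact: psdQ.2.
Qed.

Let posdefZ (c : R) : 0 < c -> posdefmx (c *: (X^T *m X)).
Proof.
move=> c0; have [sX X0] := pX; split; first by rewrite linearZ /= sX.
by move=> u u0; rewrite qformZm mulr_gt0// X0.
Qed.

(** The quadratic growth is absorbed by half of the exponent, since t <= exp t. *)
Lemma posterior_second_moment b0 : exists M : R,
  (\int[leb]_b (w b * (1 + qform S (b0 - b)))%:E <= M%:E)%E.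
Proof.
have [c c0 Hc] := posdef_coercive pX.
pose s := \sum_i \sum_j `|S i j|.
have s0 : 0 <= s by do 2 (apply: sumr_ge0 => ? _).
have [sS S0] := posdef_psd pS.
have qS u : qform S u <= s / c * qform (X^T *m X) u.
  have := qform_abs_le S u; rewrite ler_norml -/s => /andP[_ h].
  apply: (le_trans h); rewrite -mulrA ler_wpM2l// ler_pdivlMl//.
have [dG IG] := gaussian_integral0 (posdefZ (divr_gt0 e0 (ltr0Sn R 1))).
set g0 := fun b : 'cV[R]_p => expR (- (qform ((e / 2) *: (X^T *m X)) b / 2)) in IG.
pose K := 1 + 2 * qform S b0 + 8 * (s / c) / e.
have K0 : 0 <= K.
  rewrite /K !addr_ge0// ?mulr_ge0 ?S0 ?invr_ge0 ?(ltW c0) ?(ltW e0)//.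
have wle b : w b * (1 + qform S (b0 - b)) <= K * g0 b.
  set t := qform (X^T *m X) b.
  have t0 : 0 <= t by exact: (posdef_psd pX).2.
  have h1 : qform S (b0 - b) <= 2 * qform S b0 + 2 * (s / c * t).
    have := S0 (b0 + b); have := qS b; rewrite -/t qformD// [qform S (b0 - b)]qformD//.
    rewrite qformN mulmxN dotvNr; lra.
  have g0E : g0 b = expR (- (e / 4 * t)).
    by rewrite /g0 qformZm -/t; congr expR; field.
  have h2 : w b <= g0 b * g0 b.
    apply: (le_trans (posterior_weight_le b)); rewrite g0E -expRD ler_expR -/t; lra.
  have h3 : e / 4 * t * g0 b <= 1.
    rewrite g0E expRN ler_pdivrMr ?expR_gt0// mul1r.
    by apply: le_trans (expR_ge1Dx _); rewrite lerDr.
  have g1 : g0 b <= 1 by rewrite g0E -[leRHS]expR0 ler_expR oppr_le0 mulr_ge0// divr_ge0// ltW.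
  have gp : 0 <= g0 b by exact: expR_ge0.
  have q0 : 0 <= qform S (b0 - b) by exact: S0.
  have sc : 0 <= s / c by rewrite divr_ge0// ltW.
  apply: (@le_trans _ _ (g0 b * g0 b * (1 + 2 * qform S b0 + 2 * (s / c * t)))).
    by apply: ler_pM => //; [exact/ltW/posterior_weight_gt0|lra|lra].
  rewrite -mulrA [K * _]mulrC ler_wpM2l//.
  have Sb0 := S0 b0.
  have h4 : g0 b * t <= 4 / e.
    rewrite -(ler_pM2l (_ : 0 < e / 4)); last by rewrite divr_gt0.
    rewrite (_ : e / 4 * (4 / e) = 1); last by field; rewrite gt_eqF.
    by have -> : e / 4 * (g0 b * t) = e / 4 * t * g0 b by ring.
  rewrite mulrDr mulrDr mulr1 /K; apply: lerD; first apply: lerD => //.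
    by rewrite ler_piMl// mulr_ge0.
  rewrite (_ : g0 b * _ = 2 * (s / c) * (g0 b * t)); last by ring.
  rewrite (_ : 8 * (s / c) / e = 2 * (s / c) * (4 / e)); last by ring.
  by rewrite ler_wpM2l// mulr_ge0.
have mg0 : measurable_fun setT (fun b => (g0 b)%:E).
  apply/measurable_EFinP; apply: measurable_expR_half.
  by apply: measurable_qform; exact: measurable_id.
have mSb : measurable_fun setT (fun b : 'cV[R]_p => qform S (b0 - b)%R).
  apply: measurable_qform; apply: measurable_mxB; first exact: measurable_cst.
  exact: measurable_id.
eexists; apply: (@le_trans _ _ (\int[leb]_b (K%:E * (g0 b)%:E))%E); last first.
  rewrite ge0_integralZl_EFin//.
  - by rewrite IG -EFinM.
  - by move=> b _; rewrite lee_fin expR_ge0.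
apply: ge0_le_integral => //.
- move=> b _; rewrite lee_fin mulr_ge0 ?(ltW (posterior_weight_gt0 _ _ _ _ _))//.
  by rewrite addr_ge0.
- apply/measurable_EFinP; apply: measurable_funM.
    exact: measurable_posterior_weight.
  by apply: measurable_funD => //; exact: measurable_cst.
- exact: measurable_funeM.
- by move=> b _; rewrite -EFinM lee_fin; exact: wle.
Qed.

Let mw : measurable_fun setT w := measurable_posterior_weight X y Q v.
Let w0 b : 0 <= w b. Proof. exact/ltW/posterior_weight_gt0. Qed.
Let q0 u : 0 <= qform S u. Proof. exact: (posdef_psd pS).2. Qed.

Lemma posterior_mass_fin : (\int[leb]_b (w b)%:E < +oo)%E.
Proof.
have [M HM] := posterior_second_moment 0.
apply: (@le_lt_trans _ _ M%:E); last by rewrite ltry.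
apply: le_trans HM; apply: ge0_le_integral => //.
- by move=> b _; rewrite lee_fin.
- exact/measurable_EFinP.
- apply/measurable_EFinP; apply: measurable_funM => //.
  apply: measurable_funD; first exact: measurable_cst.
  apply: measurable_qform; apply: measurable_mxB; first exact: measurable_cst.
  exact: measurable_id.
- by move=> b _; rewrite lee_fin ler_peMr// lerDl.
Qed.

Lemma proper : proper_posterior X y Q v.
Proof.
apply/integrableP; split; first exact/measurable_EFinP.
rewrite (eq_integral (fun b => (w b)%:E)) ?posterior_mass_fin// => b _ /=.
by rewrite ger0_norm.
Qed.

Lemma posterior_mass_gt0 : (0 < \int[leb]_b (w b)%:E)%E.
Proof.
have Iw0 : (0 <= \int[leb]_b (w b)%:E)%E by apply: integral_ge0 => b _; rewrite lee_fin.
rewrite lt_neqAle Iw0 andbT eq_sym; apply/eqP => I0.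
have : (\int[leb]_b `|(w b)%:E| = 0)%E.
  by rewrite -I0; apply: eq_integral => b _ /=; rewrite ger0_norm.
move/ae_eq_integral_abs => /(_ measurableT) h.
have /h ae0 : measurable_fun setT (fun b => (w b)%:E) by exact/measurable_EFinP.
have [dG IG] := gaussian_integral0 pX.
have : (\int[leb]_b (expR (- (qform (X^T *m X) b / 2)))%:E = \int[leb]_b cst 0 b)%E.
  apply: ae_eq_integral => //.
    apply/measurable_EFinP; apply: measurable_expR_half.
    by apply: measurable_qform; exact: measurable_id.
  apply: filterS ae0 => b /(_ I)/= [wb0]; exfalso.
  by have := posterior_weight_gt0 X y Q v b; rewrite wb0 ltxx.
rewrite IG integral0 => -[] /eqP; apply/negP; rewrite gt_eqF// sqrtr_gt0 divr_gt0//.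
by rewrite exprn_gt0// mulr_gt0// pi_gt0.
Qed.

Local Open Scope ereal_scope.

Let r : R := (1 - e / 8)%R.
Let r0 : (0 < r)%R.
Proof. by rewrite subr_gt0 ltr_pdivrMr// mul1r (le_lt_trans e1)// ltr1n. Qed.
Let r1 : (r < 1)%R. Proof. by rewrite gtrBl divr_gt0. Qed.
Let rho : R := Num.sqrt r.

(** The normalised posterior, in the form required by the coupling bounds:
a stationary probability with finite second moments. *)
Lemma posterior_probability : exists2 Pi : probability 'cV[R]_p R,
  (forall A, measurable A -> posterior X y Q v A = Pi A) &
  (forall A, measurable A -> \int[Pi]_b ac_kernel X y Q v b A = Pi A) /\
  (forall b, exists2 M : R, (0 <= M)%R & \int[Pi]_b' (qform S (b - b'))%:E <= M%:E).
Proof.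
set c := fine (\int[leb]_b (w b)%:E).
have cE : \int[leb]_b (w b)%:E = c%:E.
  by rewrite fineK// ge0_fin_numE ?posterior_mass_fin// ltW// posterior_mass_gt0.
have c0 : (0 < c)%R by rewrite -lte_fin -cE posterior_mass_gt0.
have ci : (0 <= c^-1)%R by rewrite invr_ge0 ltW.
pose Pi : probability 'cV[R]_p R :=
  mnormalize (density_measure leb mw w0) (dirac (0 : 'cV[R]_p)%R).
have PiE A : Pi A = (\int[leb]_(b in A) (w b)%:E) * c^-1%:E.
  exact: (mnormalize_mass (mu := density_measure leb mw w0) _ A cE c0).
have mwc : measurable_fun setT (fun b => w b / c)%R.
  by apply: measurable_funM => //; exact: measurable_cst.
have wc0 b : (0 <= w b / c)%R by rewrite mulr_ge0.
have Pid A : measurable A -> Pi A = \int[leb]_(b in A) (w b / c)%:E.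
  move=> mA; rewrite PiE muleC -ge0_integralZl_EFin//.
  - by apply: eq_integral => b _; rewrite -EFinM mulrC.
  - by move=> b _; rewrite lee_fin.
  - by apply/measurable_EFinP; exact: measurable_funTS.
have intPi (g : 'cV[R]_p -> \bar R) : measurable_fun setT g -> (forall b, 0 <= g b) ->
    \int[Pi]_b g b = (c^-1)%:E * \int[leb]_b ((w b)%:E * g b).
  move=> mg g0; rewrite (ge0_integral_density mwc wc0 Pid)//.
  rewrite -ge0_integralZl_EFin//.
  - by apply: eq_integral => b _; rewrite muleA -EFinM mulrC.
  - by move=> b _; rewrite mule_ge0// lee_fin.
  - by apply: emeasurable_funM => //; exact/measurable_EFinP.
exists Pi => [A mA|]; first by rewrite PiE.
split=> [A mA|b].
  have crm := ac_map_contracting v psdQ pS e1 ov.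
  rewrite intPi.
  - by rewrite posterior_mass_stationary// PiE muleC.
  - exact: contracting_random_map_measurable crm mA.
  - by move=> b; have /andP[] := contracting_random_map_le1 b crm mA.
have [M HM] := posterior_second_moment b.
have mSb : measurable_fun setT (fun b' : 'cV[R]_p => qform S (b - b')%R).
  apply: measurable_qform; apply: measurable_mxB; first exact: measurable_cst.
  exact: measurable_id.
have IM : \int[leb]_b' ((w b')%:E * (qform S (b - b'))%:E) <= M%:E.
  apply: le_trans HM; apply: ge0_le_integral => //.
  - by move=> b' _; rewrite -EFinM lee_fin mulr_ge0.
  - by apply: emeasurable_funM; exact/measurable_EFinP.
  - apply/measurable_EFinP; apply: measurable_funM => //.
    by apply: measurable_funD => //; exact: measurable_cst.
  - by move=> b' _; rewrite -EFinM lee_fin ler_wpM2l// lerDr.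
have M0 : (0 <= M)%R.
  rewrite -lee_fin; apply: le_trans IM; apply: integral_ge0 => b' _.
  by rewrite -EFinM lee_fin mulr_ge0.
exists (c^-1 * M)%R; first by rewrite mulr_ge0.
rewrite intPi.
- by rewrite EFinM lee_wpmul2l// lee_fin.
- exact/measurable_EFinP.
- by move=> b'; rewrite lee_fin.
Qed.

Lemma rho_bound (D : 'cV[R]_p -> nat -> \bar R) :
  (forall b, exists2 M : R, (0 <= M)%R & forall m, (0 < m)%N ->
     D b m <= (M * rho ^+ m)%:E) -> (geometric_rate D <= rho)%R.
Proof.
move=> DM; rewrite /geometric_rate.
have rho1 : (0 <= rho <= 1)%R.
  by rewrite /rho sqrtr_ge0/= -[leRHS]sqrtr1 ler_sqrt// ltW.
have Srho : [set rho : R | (0 <= rho <= 1)%R /\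
    exists2 M : 'cV[R]_p -> R, (forall b, (0 <= M b)%R) &
      forall b m, (0 < m)%N -> D b m <= (M b * rho ^+ m)%:E] rho.
  split => //.
  have h b : exists M : R, (0 <= M)%R /\ forall m, (0 < m)%N ->
     D b m <= (M * rho ^+ m)%:E by have [M] := DM b; exists M.
  have [M HM] := choice h.
  by exists M => b; [exact: (HM b).1|exact: (HM b).2].
case: asboolP => [_|ne]; last by exfalso; apply: ne; exists rho.
by apply: ge_inf => //; exists 0%R => x /= [/andP[]].
Qed.

Lemma rho_psi_le : (rho_psi X y Q v <= rho)%R.
Proof.
have [Pi PiE [Pist PiM]] := posterior_probability.
rewrite /rho_psi /ac_rate; case: asboolP => [_|np]; last first.
  by exfalso; apply: np; split; [exact: posdef_unit|exact: proper].
apply: rho_bound => b; have [M M0 HM] := PiM b.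
exists (2^-1 + M / 2)%R; first by rewrite addr_ge0 ?divr_ge0.
move=> m m0.
have c0 (x z : 'cV[R]_p) : (0 <= qform S (x - z))%R by exact: (posdef_psd pS).2.
have mc : measurable_fun setT (fun z : 'cV[R]_p * 'cV[R]_p => qform S (z.1 - z.2)).
  by apply: measurable_qform; apply: measurable_mxB; [exact: measurable_fst|exact: measurable_snd].
have k0 : (0 < rho ^+ m)%R by rewrite exprn_gt0// /rho sqrtr_gt0.
have := iterate_wasserstein_le (Kn := ac_kernel_iter X y Q v)
  (fun=> erefl) (fun _ _ => erefl) mc c0 r0 (ac_map_contracting v psdQ pS e1 ov)
  Pist PiE m b k0.
move=> h; apply: (le_trans h).
have rm : (r ^+ m = rho ^+ m * rho ^+ m)%R.
  by rewrite -expr2 exprAC sqr_sqrtr// ltW.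
apply: (@le_trans _ _ ((rho ^+ m / 2)%:E + (r ^+ m / (2 * rho ^+ m))%:E * M%:E)).
  by rewrite leeD2l// lee_wpmul2l// lee_fin divr_ge0 ?exprn_ge0 ?mulr_ge0 ?ltW.
rewrite -EFinM -EFinD lee_fin rm le_eqVlt; apply/orP; left; apply/eqP.
by field; rewrite gt_eqF.
Qed.

Lemma rho_TV_le : (rho_TV X y Q v <= rho)%R.
Proof.
have [Pi PiE [Pist PiM]] := posterior_probability.
rewrite /rho_TV /ac_rate; case: asboolP => [_|np]; last first.
  by exfalso; apply: np; split; [exact: posdef_unit|exact: proper].
apply: rho_bound => b; have [M M0 HM] := PiM b.
exists (1 + M)%R; first by rewrite addr_ge0.
move=> m m0.
have c0 (x z : 'cV[R]_p) : (0 <= qform S (x - z))%R by exact: (posdef_psd pS).2.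
have csym (x z : 'cV[R]_p) : qform S (x - z) = qform S (z - x).
  by rewrite -opprB qformN.
have mc : measurable_fun setT (fun z : 'cV[R]_p * 'cV[R]_p => qform S (z.1 - z.2)).
  by apply: measurable_qform; apply: measurable_mxB; [exact: measurable_fst|exact: measurable_snd].
have k0 : (0 < rho ^+ m)%R by rewrite exprn_gt0// /rho sqrtr_gt0.
have sm x x' A (k : R) : measurable A -> (0 < k)%R ->
   ac_kernel X y Q v x A <= ac_kernel X y Q v x' A + (k + r * qform S (x - x') / k)%:E.
  by move=> mA kp; exact: ac_kernel_smoothing.
have := iterate_total_variation_le (Kn := ac_kernel_iter X y Q v)
  (fun=> erefl) (fun _ _ => erefl) mc c0 csym r0 (ac_map_contracting v psdQ pS e1 ov)
  Pist PiE sm b m0 k0.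
move=> h; apply: (le_trans h).
have rm : (r ^+ m = rho ^+ m * rho ^+ m)%R.
  by rewrite -expr2 exprAC sqr_sqrtr// ltW.
apply: (@le_trans _ _ ((rho ^+ m)%:E + (r ^+ m / rho ^+ m)%:E * M%:E)).
  rewrite leeD2l// lee_wpmul2l// lee_fin.
  by apply: divr_ge0; [exact/exprn_ge0/ltW|exact: ltW].
rewrite -EFinM -EFinD lee_fin rm le_eqVlt; apply/orP; left; apply/eqP.
by field; rewrite gt_eqF.
Qed.

End albert_chib_rate.

(** * A law of large numbers for uncorrelated sequences *)

Section law_of_large_numbers.
Context d (T : measurableType d) (R : realType) (P : probability T R).
Variables (h : nat -> T -> R) (c V : R).
Hypotheses (mh : forall i, measurable_fun setT (h i)) (h0 : forall i t, 0 <= h i t).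
Hypothesis mean_h : forall i, (\int[P]_t (h i t)%:E = c%:E)%E.
Hypothesis mean_hh : forall i j, i != j -> (\int[P]_t (h i t * h j t)%:E = (c ^+ 2)%:E)%E.
Hypothesis mean_sqr : forall i, (\int[P]_t (h i t ^+ 2)%:E <= V%:E)%E.

Let V0 : 0 <= V.
Proof.
rewrite -lee_fin; apply: le_trans (mean_sqr 0%N).
by apply: integral_ge0 => t _; rewrite lee_fin sqr_ge0.
Qed.

Let c0 : 0 <= c.
Proof. by rewrite -lee_fin -(mean_h 0%N); apply: integral_ge0 => t _; rewrite lee_fin. Qed.

Let msum s : measurable_fun setT (fun t => \sum_(i <- s) h i t).
Proof. by apply: measurable_sum. Qed.

Let sum0 s t : 0 <= \sum_(i <- s) h i t.
Proof. by apply: sumr_ge0. Qed.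

Lemma mean_sum s : (\int[P]_t (\sum_(i <- s) h i t)%:E = ((size s)%:R * c)%:E)%E.
Proof.
under eq_integral do rewrite -sumEFin.
rewrite ge0_integral_sum//.
- rewrite (eq_bigr (fun=> c%:E)); last by move=> i _; exact: mean_h.
  rewrite sumEFin; congr EFin.
  by rewrite big_const_seq count_predT iter_addr addr0 mulr_natl.
- by move=> i; exact/measurable_EFinP.
- by move=> i t _; rewrite lee_fin.
Qed.

Lemma mean_sqr_sum s : uniq s ->
  (\int[P]_t ((\sum_(i <- s) h i t) ^+ 2)%:E <=
    ((size s)%:R * V + (size s)%:R ^+ 2 * c ^+ 2)%:E)%E.
Proof.
elim: s => [_|i s IH] /=.
  rewrite (eq_integral (fun=> 0%E)) ?integral0; last by move=> t _; rewrite big_nil expr0n.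
  by rewrite expr0n !mul0r addr0.
move=> /andP[nis us].
have cross : (\int[P]_t (h i t * \sum_(j <- s) h j t)%:E = ((size s)%:R * c ^+ 2)%:E)%E.
  under eq_integral do rewrite mulr_sumr -sumEFin.
  rewrite ge0_integral_sum//.
  - rewrite (eq_big_seq (fun=> (c ^+ 2)%:E)); last first.
      by move=> j js; apply: mean_hh; apply: contraNneq nis => ->.
    rewrite sumEFin; congr EFin.
    by rewrite big_const_seq count_predT iter_addr addr0 mulr_natl.
  - by move=> j; apply/measurable_EFinP; exact: measurable_funM.
  - by move=> j t _; rewrite lee_fin mulr_ge0.
rewrite (eq_integral (fun t => (h i t ^+ 2)%:E + (2%:E * (h i t * \sum_(j <- s) h j t)%:E +
    ((\sum_(j <- s) h j t) ^+ 2)%:E))%E); last first.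
  by move=> t _; rewrite big_cons -EFinM -!EFinD; congr EFin; ring.
have mS := msum s.
rewrite ge0_integralD//; last 4 first.
- by move=> t _; rewrite lee_fin sqr_ge0.
- by apply/measurable_EFinP; exact: measurable_funX.
- by move=> t _; rewrite -EFinM -EFinD lee_fin addr_ge0 ?sqr_ge0 ?mulr_ge0.
- apply: emeasurable_funD; first apply: measurable_funeM;
    apply/measurable_EFinP; [exact: measurable_funM|exact: measurable_funX].
rewrite ge0_integralD//; last 4 first.
- by move=> t _; rewrite -EFinM lee_fin !mulr_ge0.
- by apply: measurable_funeM; apply/measurable_EFinP; exact: measurable_funM.
- by move=> t _; rewrite lee_fin sqr_ge0.
- by apply/measurable_EFinP; exact: measurable_funX.
rewrite ge0_integralZl_EFin//; last 2 first.
- by move=> t _; rewrite lee_fin mulr_ge0.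
- by apply/measurable_EFinP; exact: measurable_funM.
rewrite cross; apply: (le_trans (leeD (mean_sqr i) (leeD (lexx _) (IH us)))).
rewrite -EFinM -!EFinD lee_fin -natr1.
have := sqr_ge0 c; set k := (size s)%:R; lra.
Qed.

(** Nonnegativity lets the variance be bounded without signed integrals:
(S - k c)^2 + 2 k c S = S^2 + (k c)^2 holds between nonnegative functions. *)
Lemma variance_sum s : uniq s ->
  (\int[P]_t ((\sum_(i <- s) h i t - (size s)%:R * c) ^+ 2)%:E <= ((size s)%:R * V)%:E)%E.
Proof.
move=> us; set k := (size s)%:R; set S := fun t => \sum_(i <- s) h i t.
have mS : measurable_fun setT S := msum s.
have k0 : 0 <= k * c by rewrite mulr_ge0.
have mSD : measurable_fun setT (fun t => S t - k * c).
  by apply: measurable_funB => //; exact: measurable_cst.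
have : (\int[P]_t ((S t - k * c) ^+ 2)%:E + (2 * (k * c) * (k * c))%:E <=
        (k * V)%:E + (2 * (k * c) * (k * c))%:E)%E.
  have -> : (\int[P]_t ((S t - k * c) ^+ 2)%:E + (2 * (k * c) * (k * c))%:E =
             \int[P]_t (S t ^+ 2)%:E + ((k * c) ^+ 2)%:E)%E.
    transitivity (\int[P]_t (((S t - k * c) ^+ 2)%:E + (2 * (k * c))%:E * (S t)%:E))%E.
      rewrite ge0_integralD//; last 4 first.
      - by move=> t _; rewrite lee_fin sqr_ge0.
      - by apply/measurable_EFinP; exact: measurable_funX.
      - by move=> t _; rewrite -EFinM lee_fin; apply: mulr_ge0; [exact: mulr_ge0|exact: sum0].
      - by apply: measurable_funeM; exact/measurable_EFinP.
      rewrite ge0_integralZl_EFin//.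
      - by rewrite mean_sum -EFinM.
      - by move=> t _; rewrite lee_fin; exact: sum0.
      - exact/measurable_EFinP.
      - by rewrite mulr_ge0.
    transitivity (\int[P]_t ((S t ^+ 2)%:E + (cst ((k * c) ^+ 2)%:E) t))%E.
      by apply: eq_integral => t _; rewrite -EFinM -!EFinD; congr EFin; ring.
    rewrite ge0_integralD//; last 3 first.
    - by move=> t _; rewrite lee_fin sqr_ge0.
    - by apply/measurable_EFinP; exact: measurable_funX.
    - by move=> t _; rewrite lee_fin sqr_ge0.
    by congr (_ + _)%E; exact: (integral_cst_mass1 _ (probability_setT P)).
  have := mean_sqr_sum us; rewrite -/k => h2.
  apply: (le_trans (leeD h2 (lexx _))).
  by rewrite -!EFinD lee_fin; lra.
by rewrite leeD2rE.
Qed.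

Let dev m n t := \sum_(i <- iota m n) h i t - n%:R * c.

Let devD m n t : dev 0 (m + n) t = dev 0 m t + dev m n t.
Proof. by rewrite /dev iotaD big_cat/= natrD; ring. Qed.

Let variance_dev m n : (\int[P]_t (dev m n t ^+ 2)%:E <= (n%:R * V)%:E)%E.
Proof. by have := variance_sum (iota_uniq m n); rewrite size_iota. Qed.

(* All the deviations along the block between two consecutive squares, scaled
so that the square of the n-th one is at most 2 n^2 times the sum. *)
Let blk k t := (dev 0 (k.+1 ^ 2) t ^+ 2 +
  \sum_(j < (2 * k.+1).+1) dev (k.+1 ^ 2) j t ^+ 2) / k.+1%:R ^+ 4.

Let blk0 k t : 0 <= blk k t.
Proof.
by rewrite divr_ge0// addr_ge0 ?sqr_ge0//; apply: sumr_ge0 => j _; exact: sqr_ge0.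
Qed.

Let mdev m n : measurable_fun setT (dev m n).
Proof. by apply: measurable_funB => //; exact: measurable_cst. Qed.

Let mblk k : measurable_fun setT (blk k).
Proof.
apply: measurable_funM; last exact: measurable_cst.
apply: measurable_funD; first exact: measurable_funX.
by apply: measurable_sum => j; exact: measurable_funX.
Qed.

Let mean_blk k : (\int[P]_t (blk k t)%:E <= (20 * V * (k.+1%:R^-1 - k.+2%:R^-1))%:E)%E.
Proof.
set K : R := k.+1%:R; have K0 : 0 < K by rewrite ltr0Sn.
have K1 : 1 <= K by rewrite ler1n.
rewrite (eq_integral (fun t => (K ^+ 4)^-1%:E * ((dev 0 (k.+1 ^ 2) t ^+ 2)%:E +
  \sum_(j < (2 * k.+1).+1) (dev (k.+1 ^ 2) j t ^+ 2)%:E)))%E; last first.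
  by move=> t _; rewrite sumEFin -EFinD -EFinM /blk mulrC.
have msq m n : measurable_fun setT (fun t => (dev m n t ^+ 2)%:E).
  by apply/measurable_EFinP; exact: measurable_funX.
have sq0 m n t : (0 <= (dev m n t ^+ 2)%:E)%E by rewrite lee_fin sqr_ge0.
have ms : measurable_fun setT (fun t =>
    (\sum_(j < (2 * k.+1).+1) (dev (k.+1 ^ 2) j t ^+ 2)%:E)%E).
  by apply: emeasurable_sum => j; exact: msq.
rewrite ge0_integralZl_EFin//; last 3 first.
- by move=> t _; rewrite adde_ge0//; apply: sume_ge0.
- by apply: emeasurable_funD.
- by rewrite invr_ge0 exprn_ge0// ltW.
rewrite ge0_integralD//; last by move=> t _; apply: sume_ge0.
rewrite ge0_integral_sum//.
apply: (@le_trans _ _ ((K ^+ 4)^-1%:E * ((K ^+ 2 * V)%:E +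
    \sum_(j < (2 * k.+1).+1) ((3 * K) * V)%:E))%E).
  apply: lee_wpmul2l; first by rewrite lee_fin invr_ge0 exprn_ge0// ltW.
  apply: leeD; first by apply: le_trans (variance_dev _ _) _; rewrite natrX.
  apply: lee_sum => j _; apply: le_trans (variance_dev _ _) _.
  rewrite lee_fin ler_wpM2r//.
  have : (j%:R <= (2 * k.+1)%:R :> R) by rewrite ler_nat -ltnS.
  rewrite natrM -/K; lra.
rewrite sumEFin sumr_const card_ord -EFinD -EFinM lee_fin -[X in _ + X]mulr_natr.
rewrite -(natr1 (2 * k.+1)) natrM -/K.
have -> : k.+2%:R = K + 1 :> R by rewrite -natr1.
rewrite ler_pdivrMl ?exprn_gt0//.
have -> : K ^+ 4 * (20 * V * (K^-1 - (K + 1)^-1)) = 20 * V * (K ^+ 3 / (K + 1)).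
  by field; rewrite !gt_eqF// addr_gt0.
have h1 : K ^+ 2 / 2 <= K ^+ 3 / (K + 1).
  rewrite ler_pdivlMr ?addr_gt0// -subr_ge0.
  have -> : K ^+ 3 - K ^+ 2 / 2 * (K + 1) = K ^+ 2 * (K - 1) / 2 by field.
  by rewrite divr_ge0// mulr_ge0 ?sqr_ge0// subr_ge0.
have h2 : K <= K ^+ 2 by rewrite expr2 ler_peMl// ltW.
have h3 : 20 * V * (K ^+ 2 / 2) <= 20 * V * (K ^+ 3 / (K + 1)).
  by rewrite ler_wpM2l// mulr_ge0.
apply: le_trans h3.
have -> : K ^+ 2 * V + 3 * K * V * (2 * K + 1) = V * (7 * K ^+ 2 + 3 * K) by ring.
have -> : 20 * V * (K ^+ 2 / 2) = V * (10 * K ^+ 2) by field.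
by rewrite ler_wpM2l//; lra.
Qed.

Let blk_summable : {ae P, forall t, (\sum_(k <oo) (blk k t)%:E < +oo)%E}.
Proof.
have S0 t : (0 <= \sum_(k <oo) (blk k t)%:E)%E.
  by apply: nneseries_ge0 => k _ _; rewrite lee_fin.
have mS : measurable_fun setT (fun t => (\sum_(k <oo) (blk k t)%:E)%E).
  apply: ge0_emeasurable_sum => [k t _ _|k _]; first by rewrite lee_fin.
  exact/measurable_EFinP.
have IS : (\int[P]_t (\sum_(k <oo) (blk k t)%:E) <= (20 * V)%:E)%E.
  rewrite integral_nneseries//; last 2 first.
  - by move=> k; exact/measurable_EFinP.
  - by move=> k t _; rewrite lee_fin.
  apply: lime_le.
    by apply: is_cvg_nneseries => k _ _; apply: integral_ge0 => t _; rewrite lee_fin.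
  apply: nearW => n; apply: (@le_trans _ _ (20 * V * (1 - n.+1%:R^-1))%:E).
    elim: n => [|n IH]; first by rewrite big_geq// invr1 subrr mulr0.
    rewrite big_nat_recr//=; apply: (le_trans (leeD IH (mean_blk n))).
    by rewrite -EFinD lee_fin le_eqVlt; apply/orP; left; apply/eqP; ring.
  by rewrite lee_fin ler_piMr ?mulr_ge0// gerBl.
have iS : P.-integrable setT (fun t => (\sum_(k <oo) (blk k t)%:E)%E).
  apply/integrableP; split => //.
  rewrite (eq_integral (fun t => (\sum_(k <oo) (blk k t)%:E)%E)).
    by apply: (le_lt_trans IS); rewrite ltry.
  by move=> t _; rewrite gee0_abs.
have := integrable_ae measurableT iS.
by apply: filterS => t /(_ I); rewrite ge0_fin_numE.
Qed.

Lemma square_bracket n : (0 < n)%N ->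
  exists2 k, (k.+1 ^ 2 <= n)%N & (n < k.+2 ^ 2)%N.
Proof.
elim: n => // -[|n] IH _; first by exists 0%N.
have [k k1 k2] := IH isT.
have [lt|ge] := ltnP n.+2 (k.+2 ^ 2); first by exists k => //; exact: leqW.
exists k.+1 => //; apply: (@leq_ltn_trans (k.+2 ^ 2)) => //.
by rewrite ltn_sqr.
Qed.

Let blk_cvg t : (\sum_(k <oo) (blk k t)%:E < +oo)%E -> blk ^~ t @ \oo --> 0.
Proof.
move=> fin; apply: cvg_series_cvg_0; apply: nondecreasing_is_cvgn.
  apply/nondecreasing_seqP => n.
  by rewrite /series/= big_nat_recr//= lerDl.
have fn : (\sum_(k <oo) (blk k t)%:E)%E \is a fin_num.
  by rewrite ge0_fin_numE//; apply: nneseries_ge0 => k _ _; rewrite lee_fin.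
exists (fine (\sum_(k <oo) (blk k t)%:E)%E) => _ [n _ <-].
rewrite -lee_fin fineK// /series/= -sumEFin.
by apply: nneseries_lim_ge => k _ _; rewrite lee_fin.
Qed.

(** Rajchman's argument: the variance of the n-th deviation is at most n V, so
the scaled sums of squared deviations over the blocks between consecutive
squares have summable expectations, hence tend to zero. *)
Lemma pairwise_lln : {ae P, forall t, (fun n => n%:R^-1 * \sum_(i < n) h i t) @ \oo --> c}.
Proof.
apply: filterS blk_summable => t /blk_cvg bt.
apply/cvgrPdist_le => e e0.
have e2 : 0 < e ^+ 2 / 2 by rewrite divr_gt0// exprn_gt0.
have /cvgrPdist_le/(_ _ e2)[K _ HK] := bt.
exists (K.+1 ^ 2)%N => // n /= Kn.
have n0 : (0 < n)%N by apply: leq_trans Kn; rewrite sqrn_gt0.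
have [k kn nk] := square_bracket n0.
have Kk : (K <= k)%N.
  by rewrite -ltnS -ltnS -ltn_sqr; exact: leq_ltn_trans Kn nk.
have := HK _ Kk; rewrite sub0r normrN ger0_norm// => bk.
have nR : 0 < n%:R :> R by rewrite ltr0n.
have -> : c - n%:R^-1 * \sum_(i < n) h i t = - (n%:R^-1 * dev 0 n t).
  rewrite /dev -[iota 0 n]/(iota 0 n) -(subn0 n) -/(index_iota 0 n) big_mkord subn0.
  by field; rewrite gt_eqF.
rewrite normrN normrM gtr0_norm ?invr_gt0// ler_pdivrMl//.
have ne0 : 0 <= n%:R * e by rewrite mulr_ge0// ltW.
rewrite -[leRHS]ger0_norm// -ler_sqr ?nnegrE// !real_normK ?num_real//.
set K2 : R := (k.+1 ^ 2)%:R; pose q : R := k.+1%:R ^+ 4.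
have q0 : 0 < q by rewrite exprn_gt0.
have jb : (n - k.+1 ^ 2 < (2 * k.+1).+1)%N by move: nk kn; rewrite -!mulnn; lia.
have dE : dev 0 n t = dev 0 (k.+1 ^ 2) t + dev (k.+1 ^ 2) (n - k.+1 ^ 2) t.
  by rewrite -devD subnKC.
have bE : dev 0 (k.+1 ^ 2) t ^+ 2 + dev (k.+1 ^ 2) (n - k.+1 ^ 2) t ^+ 2 <= q * blk k t.
  rewrite /blk -/q mulrCA divff ?gt_eqF// mulr1 lerD2l.
  rewrite (bigD1 (Ordinal jb))//= lerDl; apply: sumr_ge0 => j _; exact: sqr_ge0.
have qn : q <= n%:R ^+ 2.
  by rewrite /q (exprM _ 2 2) -natrX lerXn2r ?nnegrE// ler_nat.
have h1 : q * blk k t <= n%:R ^+ 2 * (e ^+ 2 / 2).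
  by apply: ler_pM => //; exact: ltW.
rewrite dE exprMn; have := sqr_ge0 (dev 0 (k.+1 ^ 2) t - dev (k.+1 ^ 2) (n - k.+1 ^ 2) t).
have -> : n%:R ^+ 2 * e ^+ 2 = 2 * (n%:R ^+ 2 * (e ^+ 2 / 2)) by field.
lra.
Qed.

End law_of_large_numbers.

(** * The strong law for pairwise independent sequences *)

Section independent_sequences.
Context d (T : measurableType d) (R : realType) (P : probability T R).
Local Open Scope ereal_scope.

(** Independence says that the joint law is the product of the marginals, to which
the theorem of Tonelli applies. *)
Lemma independent_integral d1 d2 (U1 : measurableType d1) (U2 : measurableType d2)
    (X : T -> U1) (Y : T -> U2) (f : U1 -> \bar R) (g : U2 -> \bar R) :
  measurable_fun setT X -> measurable_fun setT Y ->
  (forall A B, measurable A -> measurable B ->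
    P (X @^-1` A `&` Y @^-1` B) = P (X @^-1` A) * P (Y @^-1` B)) ->
  measurable_fun setT f -> measurable_fun setT g ->
  (forall u, 0 <= f u) -> (forall u, 0 <= g u) ->
  \int[P]_t (f (X t) * g (Y t)) = \int[P]_t f (X t) * \int[P]_t g (Y t).
Proof.
move=> mX mY ind mf mg f0 g0.
pose X' : {mfun T >-> U1} := HB.pack X (isMeasurableFun.Build _ _ _ _ _ mX).
pose Y' : {mfun T >-> U2} := HB.pack Y (isMeasurableFun.Build _ _ _ _ _ mY).
have mXY : measurable_fun setT (fun t => (X t, Y t)) by exact: measurable_fun_pair.
pose Z : {mfun T >-> (U1 * U2)%type} := HB.pack (fun t => (X t, Y t))
  (isMeasurableFun.Build _ _ _ _ _ mXY).
have mF : measurable_fun setT (fun z : U1 * U2 => f z.1 * g z.2).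
  by apply: emeasurable_funM;
    [apply: measurableT_comp mf _|apply: measurableT_comp mg _].
have F0 (z : U1 * U2) : 0 <= f z.1 * g z.2 by rewrite mule_ge0.
transitivity (\int[distribution P Z]_z (f z.1 * g z.2)).
  by rewrite ge0_integral_pushforward// preimage_setT.
transitivity (\int[distribution P X' \x distribution P Y']_z (f z.1 * g z.2)).
  apply: eq_measure_integral => A mA _.
  apply/esym; apply: (product_measure_unique _ mA) => B C mB mC.
  exact: ind mB mC.
rewrite fubini_tonelli1// /fubini_F/=.
transitivity (\int[distribution P X']_x (f x * \int[distribution P Y']_y g y)).
  by apply: eq_integral => x _; rewrite ge0_integralZl.
rewrite ge0_integralZr//; last by apply: integral_ge0.
by congr (_ * _); rewrite ge0_integral_pushforward// preimage_setT.
Qed.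

Lemma same_law_integral d1 (U : measurableType d1) (X Y : T -> U) (f : U -> \bar R) :
  measurable_fun setT X -> measurable_fun setT Y ->
  (forall A, measurable A -> P (X @^-1` A) = P (Y @^-1` A)) ->
  measurable_fun setT f -> (forall u, 0 <= f u) ->
  \int[P]_t f (X t) = \int[P]_t f (Y t).
Proof.
move=> mX mY law mf f0.
pose X' : {mfun T >-> U} := HB.pack X (isMeasurableFun.Build _ _ _ _ _ mX).
pose Y' : {mfun T >-> U} := HB.pack Y (isMeasurableFun.Build _ _ _ _ _ mY).
transitivity (\int[distribution P X']_u f u).
  by rewrite ge0_integral_pushforward// preimage_setT.
transitivity (\int[distribution P Y']_u f u).
  by apply: eq_measure_integral => A mA _; exact: law.
by rewrite ge0_integral_pushforward// preimage_setT.
Qed.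

Section strong_law.
Context d1 (W : measurableType d1) (Z : nat -> T -> W).
Hypothesis mZ : forall i, measurable_fun setT (Z i).
Hypothesis indZ : forall i j A B, i != j -> measurable A -> measurable B ->
  P (Z i @^-1` A `&` Z j @^-1` B) = P (Z i @^-1` A) * P (Z j @^-1` B).
Hypothesis lawZ : forall i A, measurable A -> P (Z i @^-1` A) = P (Z 0%N @^-1` A).

Lemma mean_fin_sqr (h : W -> R) : measurable_fun setT h -> (forall u, 0 <= h u)%R ->
  \int[P]_t (h (Z 0%N t) ^+ 2)%:E < +oo -> \int[P]_t (h (Z 0%N t))%:E < +oo.
Proof.
move=> mh h0 fin.
have mhZ : measurable_fun setT (fun t => h (Z 0%N t)) by exact: measurableT_comp mh _.
have mh2 : measurable_fun setT (fun t => (h (Z 0%N t) ^+ 2)%:E).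
  by apply/measurable_EFinP; exact: measurable_funX.
apply: (@le_lt_trans _ _ (\int[P]_t ((h (Z 0%N t) ^+ 2)%:E + cst 1%:E t))).
  apply: ge0_le_integral => //.
  - by move=> t _; rewrite lee_fin.
  - exact/measurable_EFinP.
  - exact: emeasurable_funD.
  - move=> t _; rewrite -EFinD lee_fin.
    have := sqr_ge0 (h (Z 0%N t) - 1)%R; have := h0 (Z 0%N t); nra.
rewrite ge0_integralD//; last by move=> t _; rewrite lee_fin sqr_ge0.
by rewrite (integral_cst_mass1 _ (probability_setT P)) lte_add_pinfty// ltry.
Qed.

Lemma strong_law_nonneg (h : W -> R) : measurable_fun setT h -> (forall u, 0 <= h u)%R ->
  \int[P]_t (h (Z 0%N t) ^+ 2)%:E < +oo ->
  {ae P, forall t, (fun n => n%:R^-1 * \sum_(i < n) h (Z i t))%R @ \oo -->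
    fine (\int[P]_t (h (Z 0%N t))%:E)}.
Proof.
move=> mh h0 fin2; have fin1 := mean_fin_sqr mh h0 fin2.
have mh2 : measurable_fun setT (fun u => (h u ^+ 2)%:E).
  by apply/measurable_EFinP; exact: measurable_funX.
have mhE : measurable_fun setT (fun u => (h u)%:E) by exact/measurable_EFinP.
have hE0 u : 0 <= (h u)%:E by rewrite lee_fin.
have I0 : 0 <= \int[P]_t (h (Z 0%N t))%:E by apply: integral_ge0.
have mean i : \int[P]_t (h (Z i t))%:E = (fine (\int[P]_t (h (Z 0%N t))%:E))%:E.
  rewrite fineK ?ge0_fin_numE//.
  by apply: (same_law_integral (mZ i) (mZ 0%N) _ mhE hE0) => A mA; exact: lawZ.
apply: (@pairwise_lln _ _ _ P (fun i t => h (Z i t)) _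
  (fine (\int[P]_t (h (Z 0%N t) ^+ 2)%:E))) => [i|//|//|i j ij|i].
- exact: measurableT_comp mh _.
- under eq_integral do rewrite EFinM.
  rewrite (independent_integral (f := fun u => (h u)%:E) (g := fun u => (h u)%:E)
    (mZ i) (mZ j))//.
    by rewrite (mean i) (mean j) -EFinM expr2.
  by move=> A B; exact: indZ.
- rewrite fineK; last first.
    by rewrite ge0_fin_numE//; apply: integral_ge0 => t _; rewrite lee_fin sqr_ge0.
  rewrite le_eqVlt; apply/orP; left; apply/eqP.
  apply: (same_law_integral (mZ i) (mZ 0%N)) mh2 _ => [A mA|u]; first exact: lawZ.
  by rewrite lee_fin sqr_ge0.
Qed.

Lemma strong_law (h : W -> R) : measurable_fun setT h ->
  \int[P]_t (h (Z 0%N t) ^+ 2)%:E < +oo ->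
  {ae P, forall t, (fun n => n%:R^-1 * \sum_(i < n) h (Z i t))%R @ \oo -->
    fine (\int[P]_t (h (Z 0%N t))%:E)}.
Proof.
move=> mh fin2.
have part (k : W -> R) : measurable_fun setT k -> (forall u, 0 <= k u <= `|h u|)%R ->
    \int[P]_t (k (Z 0%N t) ^+ 2)%:E < +oo.
  move=> mk kh; apply: le_lt_trans fin2; apply: ge0_le_integral => //.
  - by move=> t _; rewrite lee_fin sqr_ge0.
  - apply/measurable_EFinP; apply: measurable_funX; exact: measurableT_comp mk _.
  - apply/measurable_EFinP; apply: measurable_funX; exact: measurableT_comp mh _.
  - move=> t _; have /andP[k0 kle] := kh (Z 0%N t).
    by rewrite lee_fin -[leRHS]real_normK ?num_real// lerXn2r ?nnegrE.
have hp u : (0 <= h^\+ u <= `|h u|)%R.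
  by rewrite funrpos_ge0/= /funrpos ge_max normr_ge0 ler_norm.
have hn u : (0 <= h^\- u <= `|h u|)%R.
  by rewrite funrneg_ge0/= /funrneg ge_max normr_ge0 -normrN ler_norm.
have mp : measurable_fun setT (h^\+)%R by exact: measurable_funrpos.
have mn : measurable_fun setT (h^\-)%R by exact: measurable_funrneg.
have finp := mean_fin_sqr mp (fun u => proj1 (andP (hp u))) (part _ mp hp).
have finn := mean_fin_sqr mn (fun u => proj1 (andP (hn u))) (part _ mn hn).
have Lp := strong_law_nonneg mp (fun u => proj1 (andP (hp u))) (part _ mp hp).
have Ln := strong_law_nonneg mn (fun u => proj1 (andP (hn u))) (part _ mn hn).
apply: filterS2 Lp Ln => t tp tn.
have -> : fine (\int[P]_t (h (Z 0%N t))%:E) =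
   (fine (\int[P]_t ((h^\+)%R (Z 0%N t))%:E) - fine (\int[P]_t ((h^\-)%R (Z 0%N t))%:E))%R.
  rewrite integralE fineB.
  - by congr (fine _ - fine _)%R; apply: eq_integral => s _;
      rewrite ?funeposE ?funenegE /funrpos /funrneg EFin_max.
  - rewrite ge0_fin_numE; last by apply: integral_ge0.
    rewrite (eq_integral (fun t => ((h^\+)%R (Z 0%N t))%:E))// => s _.
    by rewrite funeposE /funrpos EFin_max.
  - rewrite ge0_fin_numE; last by apply: integral_ge0.
    rewrite (eq_integral (fun t => ((h^\-)%R (Z 0%N t))%:E))// => s _.
    by rewrite funenegE /funrneg EFin_max.
have -> : (fun n => n%:R^-1 * \sum_(i < n) h (Z i t))%R =
    (fun n => n%:R^-1 * \sum_(i < n) (h^\+)%R (Z i t) - n%:R^-1 * \sum_(i < n) (h^\-)%R (Z i t))%R.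
  apply/funext => n; rewrite -mulrBr -sumrB; congr (_ * _)%R.
  by apply: eq_bigr => i _; rewrite -[in LHS](funrposBneg h).
exact: cvgB.
Qed.

End strong_law.
End independent_sequences.

(** * Covariates and responses form an iid sequence of pairs *)

Section bernoulli_responses.
Context d (T : measurableType d) (R : realType) (P : probability T R).
Context dU (U : measurableType dU).
Variables (x : nat -> {RV P >-> U}) (y : nat -> {RV P >-> bool}) (g : U -> R).
Hypotheses (iidx : iid x) (cby : conditionally_bernoulli x y g).
Hypothesis g01 : forall u, 0 < g u < 1.
Local Open Scope ereal_scope.

Let q (a : bool) (u : U) : R := bernoulli_pmf (g u) a.
Let sigma_x := <<s \bigcup_i preimage_set_system setT (x i) measurable >>.

Let q_ge0 a u : (0 <= q a u)%R.
Proof. by have /andP[g0 g1] := g01 u; case: a; rewrite /q/= ?subr_ge0 ltW. Qed.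

Let q_sum u : (\sum_(a : bool) q a u = 1)%R.
Proof. by rewrite big_bool /q/= addrC subrK. Qed.

Let mg : measurable_fun setT g := cby.1.

Let mq a : measurable_fun setT (q a).
Proof. by case: a => //; apply: measurable_funB => //; exact: measurable_cst. Qed.

Let mqx a i : measurable_fun setT (fun w => q a (x i w)).
Proof. exact: measurableT_comp (mq a) _. Qed.

Let sigma_x_measurable C : sigma_x C -> measurable C.
Proof.
apply: smallest_sub; first exact: sigma_algebra_measurable.
move=> A [i _ [B mB <-]]; exact: measurable_funP.
Qed.

Let sigma_x_preimage i A : measurable A -> sigma_x (x i @^-1` A).
Proof.
move=> mA; apply: sub_sigma_algebra; exists i => //.
by exists A => //; rewrite setTI.
Qed.

Let sigma_xI A B : sigma_x A -> sigma_x B -> sigma_x (A `&` B).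
Proof.
exact: (@measurableI _ (g_sigma_algebraType
  (\bigcup_i preimage_set_system setT (x i) measurable)) A B).
Qed.

Let in_preimage i A w : (w \in x i @^-1` A) = (x i w \in A).
Proof. by apply/idP/idP; rewrite !inE. Qed.

(** Summing over all response vectors compatible with the constraints. *)
Lemma responses_in n (F : nat -> pred bool) C : sigma_x C ->
  P (C `&` [set w | forall i, (i < n)%N -> F i (y i w)]) =
  \int[P]_(w in C) (\prod_(i < n) \sum_(b | F i b) q b (x i w))%:E.
Proof.
move=> sC; have mC := sigma_x_measurable sC.
pose s := enum (family (fun i : 'I_n => F i)).
pose nth_b (f : {ffun 'I_n -> bool}) i := oapp f false (insub i).
pose E (f : {ffun 'I_n -> bool}) :=
  C `&` [set w | forall i, (i < n)%N -> y i w = nth_b f i].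
have nthE f (i : 'I_n) : nth_b f i = f i by rewrite /nth_b valK.
have mE f : measurable (E f).
  apply: measurableI => //.
  rewrite (_ : [set w | _] = \bigcap_(i in [set i | (i < n)%N]) (y i @^-1` [set nth_b f i]))//.
  by apply: bigcap_measurableType => i _; exact: measurable_funPTI.
have -> : C `&` [set w | forall i, (i < n)%N -> F i (y i w)] = \bigcup_(f in [set` s]) E f.
  apply/seteqP; split => [w [Cw yF]|w [f /= fs [Cw yf]]].
    exists [ffun i : 'I_n => y i w].
      by rewrite /= mem_enum; apply/familyP => i; rewrite ffunE; exact: yF.
    by split => // i il; rewrite (nthE _ (Ordinal il)) ffunE.
  split => // i il; rewrite (yf _ il) (nthE _ (Ordinal il)).
  by move: fs; rewrite mem_enum => /familyP/(_ (Ordinal il)).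
rewrite measure_fin_bigcup//; last first.
  move=> f1 f2 _ _ [w [[_ w1] [_ w2]]]; apply/ffunP => i.
  by rewrite -!nthE -w1// -w2.
rewrite -fsbig_seq ?enum_uniq//.
transitivity (\sum_(f <- s) \int[P]_(w in C) (\prod_(i < n) q (f i) (x i w))%:E).
  apply: eq_bigr => f _; rewrite [LHS](cby.2 n (nth_b f) C sC).
  apply: eq_integral => w _; congr EFin; apply: eq_bigr => i _.
  by rewrite nthE.
rewrite -ge0_integral_sum//.
- apply: eq_integral => w _; rewrite sumEFin; congr EFin.
  by rewrite bigA_distr_big_dep/= big_enum.
- move=> f; apply/measurable_EFinP; apply: measurable_funTS.
  by apply: measurable_prod => i _; exact: mqx.
- by move=> f w _; rewrite lee_fin prodr_ge0.
Qed.

Lemma two_responses_in i j (Fi Fj : pred bool) C : i != j -> sigma_x C ->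
  P (C `&` [set w | Fi (y i w) /\ Fj (y j w)]) =
  \int[P]_(w in C) ((\sum_(b | Fi b) q b (x i w)) * (\sum_(b | Fj b) q b (x j w)))%:E.
Proof.
move=> ij sC; pose n := (maxn i j).+1.
have lin : (i < n)%N by rewrite ltnS leq_maxl.
have ljn : (j < n)%N by rewrite ltnS leq_maxr.
pose F k : pred bool := if k == i then Fi else if k == j then Fj else predT.
have Fi_ : F i = Fi by rewrite /F eqxx.
have Fj_ : F j = Fj by rewrite /F eqxx eq_sym (negbTE ij).
have -> : [set w | Fi (y i w) /\ Fj (y j w)] =
    [set w | forall k, (k < n)%N -> F k (y k w)].
  apply/seteqP; split => [w [yi yj] k _|w yF] /=.
    by rewrite /F; case: eqP => [->//|_]; case: eqP => [->|].
  by split; [have := yF _ lin; rewrite Fi_|have := yF _ ljn; rewrite Fj_].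
rewrite responses_in//; apply: eq_integral => w _; congr EFin.
rewrite (bigD1 (Ordinal lin))//= Fi_; congr (_ * _)%R.
rewrite (bigD1 (Ordinal ljn))/=; last by rewrite -val_eqE/= eq_sym.
rewrite Fj_ [X in (_ * X)%R]big1 ?mulr1// => k /andP[ki kj].
by rewrite /F -val_eqE/= in ki *; rewrite (negbTE ki) -val_eqE/= in kj *;
  rewrite (negbTE kj) q_sum.
Qed.

Lemma response_is i a C : sigma_x C ->
  P (C `&` y i @^-1` [set a]) = \int[P]_(w in C) (q a (x i w))%:E.
Proof.
move=> sC; have ii : i != i.+1 by rewrite neq_ltn ltnSn.
have -> : y i @^-1` [set a] = [set w | pred1 a (y i w) /\ predT (y i.+1 w)].
  by apply/seteqP; split => w /=; [move=> ->|move=> [/eqP]].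
rewrite (two_responses_in _ _ ii sC).
by apply: eq_integral => w _; rewrite big_pred1_eq q_sum mulr1.
Qed.

Let Z i w := (x i w, y i w).

Let mZ i : measurable_fun setT (Z i).
Proof. exact: measurable_fun_pair. Qed.

(* The conditional probability, given the covariate u, that the pair falls in A
and its response is a. *)
Let k (A : set (U * bool)) a u : R := (\1_(ysection A a) u * q a u)%R.

Let mk A a : measurable A -> measurable_fun setT (k A a).
Proof.
by move=> mA; apply: measurable_funM => //; apply: measurable_indic; exact: measurable_ysection.
Qed.

Let k_ge0 A a u : (0 <= k A a u)%R. Proof. by rewrite mulr_ge0. Qed.

Let split_response i E : measurable E ->
  P E = P (E `&` y i @^-1` [set true]) + P (E `&` y i @^-1` [set false]).
Proof.
move=> mE; rewrite -measureU//.
- congr (P _); rewrite -setIUr; apply/seteqP; split => [w Ew|w []//].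
  by split=> //=; case: (y i w); [left|right].
- by apply: measurableI => //; exact: measurable_funPTI.
- by apply: measurableI => //; exact: measurable_funPTI.
- by apply/seteqP; split => // w [[_ /= ->] []].
Qed.

Let pair_slice i A a : Z i @^-1` A `&` y i @^-1` [set a] =
  x i @^-1` (ysection A a) `&` y i @^-1` [set a].
Proof.
apply/seteqP; split => w [/= Aw ya]; split => //.
  by rewrite /ysection/= mem_set// -ya.
by have := set_mem Aw; rewrite -ya.
Qed.

Lemma pair_law i A : measurable A ->
  P (Z i @^-1` A) = \int[P]_w (k A true (x i w))%:E + \int[P]_w (k A false (x i w))%:E.
Proof.
move=> mA; have mE : measurable (Z i @^-1` A) by rewrite -[X in measurable X]setTI; exact: mZ.
have slice a : P (Z i @^-1` A `&` y i @^-1` [set a]) = \int[P]_w (k A a (x i w))%:E.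
  have mAa : measurable (ysection A a) by exact: measurable_ysection.
  rewrite pair_slice response_is; last exact: sigma_x_preimage.
  rewrite integral_mkcond; apply: eq_integral => w _.
  rewrite patchE /k indicE in_preimage; case: (x i w \in _) => //=.
    by rewrite mul1r.
  by rewrite mul0r.
by rewrite (split_response i mE) !slice.
Qed.

Lemma pairs_same_law i A : measurable A -> P (Z i @^-1` A) = P (Z 0%N @^-1` A).
Proof.
move=> mA; rewrite !pair_law//.
by congr (_ + _); apply: (same_law_integral (f := fun u => (k A _ u)%:E)) => //;
  solve [exact: iidx.2|exact/measurable_EFinP/mk|by move=> u; rewrite lee_fin].
Qed.

(** Splitting over the values of both responses reduces the claim to independence
of the covariates, weighted by the conditional probabilities. *)
Lemma pairs_independent i j A B : i != j -> measurable A -> measurable B ->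
  P (Z i @^-1` A `&` Z j @^-1` B) = P (Z i @^-1` A) * P (Z j @^-1` B).
Proof.
move=> ij mA mB.
have ind C D : measurable C -> measurable D ->
    P (x i @^-1` C `&` x j @^-1` D) = P (x i @^-1` C) * P (x j @^-1` D).
  move=> mC mD.
  pose S l := if l == i then C else D.
  have Si : S i = C by rewrite /S eqxx.
  have Sj : S j = D by rewrite /S eq_sym (negbTE ij).
  have := iidx.1 [:: i; j] S; rewrite /= inE ij/= => /(_ isT).
  rewrite big_cons big_seq1 Si Sj => <-; last by move=> l; rewrite /S; case: ifP.
  congr (P _); apply/seteqP; split => [w [Cw Dw] l /=|w h].
    by rewrite !inE => /orP[]/eqP ->; rewrite ?Si ?Sj.
  by split; [have := h i; rewrite Si|have := h j; rewrite Sj]; apply => /=;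
    rewrite !inE eqxx ?orbT.
have mZA i' A' : measurable A' -> measurable (Z i' @^-1` A').
  by move=> mA'; rewrite -[X in measurable X]setTI; exact: mZ.
have slice a b : P ((Z i @^-1` A `&` Z j @^-1` B) `&` y i @^-1` [set a] `&` y j @^-1` [set b]) =
   \int[P]_w (k A a (x i w))%:E * \int[P]_w (k B b (x j w))%:E.
  have mAa : measurable (ysection A a) by exact: measurable_ysection.
  have mBb : measurable (ysection B b) by exact: measurable_ysection.
  have -> : (Z i @^-1` A `&` Z j @^-1` B) `&` y i @^-1` [set a] `&` y j @^-1` [set b] =
    (x i @^-1` (ysection A a) `&` x j @^-1` (ysection B b)) `&`
      [set w | pred1 a (y i w) /\ pred1 b (y j w)].
    have -> : [set w | pred1 a (y i w) /\ pred1 b (y j w)] =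
        y i @^-1` [set a] `&` y j @^-1` [set b].
      by apply/seteqP; split => w /= [/eqP h /eqP h'].
    by rewrite -setIA setIACA pair_slice pair_slice -setIACA.
  rewrite (two_responses_in _ _ ij); last by apply: sigma_xI; exact: sigma_x_preimage.
  rewrite -(independent_integral (f := fun u => (k A a u)%:E) (g := fun u => (k B b u)%:E)
     (X := x i) (Y := x j)) => //; last 4 first.
  - exact/measurable_EFinP/mk.
  - exact/measurable_EFinP/mk.
  - by move=> u; rewrite lee_fin.
  - by move=> u; rewrite lee_fin.
  rewrite integral_mkcond; apply: eq_integral => w _.
  rewrite patchE !big_pred1_eq -EFinM /k !indicE in_setI !in_preimage.
  by case: (x i w \in _) => /=; case: (x j w \in _) => /=; rewrite ?mul1r ?mul0r ?mulr0.
have mAB : measurable (Z i @^-1` A `&` Z j @^-1` B) by apply: measurableI; exact: mZA.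
have mABa a : measurable ((Z i @^-1` A `&` Z j @^-1` B) `&` y i @^-1` [set a]).
  by apply: measurableI => //; exact: measurable_funPTI.
rewrite (split_response i mAB) (split_response j (mABa true)) (split_response j (mABa false)).
rewrite !slice !pair_law//.
have I0 i' A' a : 0 <= \int[P]_w (k A' a (x i' w))%:E.
  by apply: integral_ge0 => w _; rewrite lee_fin.
by rewrite [RHS]ge0_muleDl ?I0// [X in _ = X + _]ge0_muleDr ?I0// [X in _ = _ + X]ge0_muleDr ?I0.
Qed.

(** The response is integrated out: the law of the covariate on the event that
the response is a has the conditional probability of a as its density. *)
Lemma integral_pair (f : U -> bool -> \bar R) :
  (forall a, measurable_fun setT (f ^~ a)) -> (forall u a, 0 <= f u a) ->
  \int[P]_w f (x 0%N w) (y 0%N w) =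
  \int[P]_w ((q true (x 0%N w))%:E * f (x 0%N w) true + (q false (x 0%N w))%:E * f (x 0%N w) false).
Proof.
move=> mf f0.
have my a : measurable (y 0%N @^-1` [set a]) by exact: measurable_funPTI.
have mfx a : measurable_fun setT (fun w => f (x 0%N w) a).
  exact: measurableT_comp (mf a) _.
have part a : \int[P]_(w in y 0%N @^-1` [set a]) f (x 0%N w) (y 0%N w) =
    \int[P]_w ((q a (x 0%N w))%:E * f (x 0%N w) a).
  transitivity (\int[mrestr P (my a)]_w f (x 0%N w) a).
    rewrite (ge0_integral_density (mu := P) (f := \1_(y 0%N @^-1` [set a])))//.
      rewrite [LHS]integral_mkcond; apply: eq_integral => w _.
      rewrite patchE indicE; case: ifPn => [|_]; last by rewrite mul0e.
      by rewrite inE => /= ->; rewrite mul1e.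
    by move=> A mA; rewrite integral_indic// setIC.
  have mx0 : measurable_fun setT (x 0%N) by exact: measurable_funP.
  pose nu := [the measure U R of pushforward (mrestr P (my a)) (x 0%N)].
  transitivity (\int[nu mx0]_u f u a).
    by rewrite ge0_integral_pushforward// preimage_setT.
  have mqf : measurable_fun setT (fun u => (q a u)%:E * f u a).
    by apply: emeasurable_funM => //; exact/measurable_EFinP.
  have qf0 u : 0 <= (q a u)%:E * f u a by rewrite mule_ge0// lee_fin.
  rewrite (ge0_integral_density (mu := distribution P (x 0%N)) (mq a))//.
    by rewrite ge0_integral_pushforward// preimage_setT.
  move=> A mA; transitivity (P (x 0%N @^-1` A `&` y 0%N @^-1` [set a])) => //.
  rewrite response_is; last exact: sigma_x_preimage.
  rewrite ge0_integral_pushforward//.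
  - by apply/measurable_EFinP; apply: measurable_funTS.
  - by move=> u _; rewrite lee_fin.
have -> : \int[P]_w f (x 0%N w) (y 0%N w) =
   \int[P]_(w in y 0%N @^-1` [set true] `|` y 0%N @^-1` [set false]) f (x 0%N w) (y 0%N w).
  congr (integral _ _ _); apply/seteqP; split => w _ //=.
  by case: (y 0%N w); [left|right].
rewrite ge0_integral_setU//.
- rewrite !part ge0_integralD//.
  + by move=> w _; rewrite mule_ge0// lee_fin.
  + by apply: emeasurable_funM => //; exact/measurable_EFinP.
  + by move=> w _; rewrite mule_ge0// lee_fin.
  + by apply: emeasurable_funM => //; exact/measurable_EFinP.
- apply: measurable_funTS.
  rewrite (_ : (fun w => _) = (fun w => if y 0%N w then f (x 0%N w) true else f (x 0%N w) false)).
    exact: measurable_fun_ifT.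
  by apply/funext => w; case: (y 0%N w).
- by rewrite disj_set2E; apply/eqP/seteqP; split => // w [/= -> ].
Qed.

End bernoulli_responses.

(** * From finitely many directions to all directions *)

Section direction_net.
Context {R : realType} (p : nat).
Implicit Types b c u : 'cV[R]_p.

Lemma norm2_ge0 u : 0 <= norm2 u. Proof. exact: sqrtr_ge0. Qed.

Lemma sqr_norm2 u : norm2 u ^+ 2 = dotv u u.
Proof. by rewrite sqr_sqrtr// dotvv_ge0. Qed.

Definition grid_point N (f : {ffun 'I_p -> 'I_(2 * N).+1}) : 'cV[R]_p :=
  \col_i ((f i)%:R / N%:R - 1).

Lemma grid_point_near N b : (0 < N)%N -> dotv b b = 1 -> exists f : {ffun 'I_p -> 'I_(2 * N).+1},
  dotv (b - grid_point f) (b - grid_point f) <= p%:R / N%:R ^+ 2.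
Proof.
move=> N0 b1; have NR : 0 < N%:R :> R by rewrite ltr0n.
pose t i := Num.truncn ((b i ord0 + 1) * N%:R).
have bi i : -1 <= b i ord0 <= 1.
  rewrite -ler_norml -(expr_le1 (n := 2))// real_normK ?num_real//.
  by rewrite -b1 sqr_entry_le.
have ti i : (t i)%:R <= (b i ord0 + 1) * N%:R < (t i).+1%:R.
  by apply: truncn_itv; apply: mulr_ge0; [have := bi i; lra|exact: ltW].
have tN i : (t i < (2 * N).+1)%N.
  rewrite ltnS -(ler_nat R) natrM; have /andP[h _] := ti i; apply: (le_trans h).
  by rewrite ler_pM2r//; have := bi i; lra.
exists [ffun i => Ordinal (tN i)]; rewrite dotvE.
apply: (@le_trans _ _ (\sum_(i < p) N%:R ^- 2)).
  apply: ler_sum => i _; rewrite !mxE !ffunE/= -expr2.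
  have -> : b i ord0 - ((t i)%:R / N%:R - 1) = ((b i ord0 + 1) * N%:R - (t i)%:R) / N%:R.
    by field; rewrite gt_eqF.
  rewrite exprMn exprVn ler_piMl ?invr_ge0 ?exprn_ge0//.
  by have := ti i; rewrite -natr1 => h; rewrite expr_le1//; lra.
by rewrite sumr_const card_ord -[leLHS]mulr_natl.
Qed.

(** The error is relative to the length of the approximating vector, which is the
scale on which small linear predictors are excluded below. *)
Lemma direction_net (delta : R) : 0 < delta ->
  exists (K : finType) (beta : K -> 'cV[R]_p), (forall k, beta k != 0) /\
  forall b, dotv b b = 1 -> exists k,
    dotv (b - beta k) (b - beta k) <= delta ^+ 2 * dotv (beta k) (beta k).
Proof.
move=> d0; pose m := Num.min 1 (delta ^+ 2) / 4.
have m0 : 0 < m by rewrite divr_gt0// lt_min ltr01 exprn_gt0.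
pose N := (Num.truncn (p%:R / m)).+1.
have NR : 0 < N%:R :> R by rewrite ltr0n.
have pN : p%:R / N%:R ^+ 2 <= m.
  have h : p%:R / m < N%:R by apply: truncnS_gt.
  rewrite ler_pdivrMr ?exprn_gt0// mulrC -ler_pdivrMr//; apply: (le_trans (ltW h)).
  by rewrite expr2 ler_peMl ?ler1n// ltW.
exists {f : {ffun 'I_p -> 'I_(2 * N).+1} | grid_point f != 0}.
exists (fun f => grid_point (val f)); split=> [[f]//|b b1].
have [f Hf] := grid_point_near (ltn0Sn _ : (0 < N)%N) b1.
set g := grid_point f in Hf.
have h1 : dotv (b - g) (b - g) <= m by exact: le_trans Hf pN.
have ming : m <= 1 / 4 /\ m <= delta ^+ 2 / 4.
  by rewrite /m !ler_pM2r// !ge_min !lexx orbT.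
have gg : 1 / 4 <= dotv g g.
  have := dotvv_ge0 (b - g - g); have [m1 _] := ming; move: h1 b1.
  rewrite !(dotvDl, dotvDr, dotvNl, dotvNr) (dotvC g b); lra.
have g0 : g != 0 by rewrite -dotvv_gt0; lra.
exists (exist (fun f : {ffun 'I_p -> 'I_(2 * N).+1} => grid_point f != 0) f g0); rewrite /= -/g; apply: (le_trans h1).
have [_ m2] := ming; apply: (le_trans m2); rewrite ler_wpM2l ?sqr_ge0//; lra.
Qed.

(** A perturbation smaller than the modulus of a linear predictor cannot change
its sign. *)
Lemma misclassified_near (a : bool) (delta : R) u b c : 0 <= delta ->
  dotv (b - c) (b - c) <= delta ^+ 2 * dotv c c ->
  delta * norm2 u * norm2 c <= `|dotv u c| ->
  misclassified a (dotv u c) -> misclassified a (dotv u b).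
Proof.
move=> d0 bc uc mis.
have h : `|dotv u (b - c)| <= `|dotv u c|.
  apply: le_trans uc; rewrite -ler_sqr ?nnegrE ?mulr_ge0 ?norm2_ge0//.
  rewrite real_normK ?num_real// !exprMn !sqr_norm2.
  apply: (le_trans (CauchySchwarz _ _)).
  by rewrite -mulrA mulrCA ler_wpM2l// dotvv_ge0.
move: h mis; rewrite dotvDr dotvNr /misclassified.
case: a => /[swap] h; [rewrite (ler0_norm h)|rewrite (ger0_norm h)];
  rewrite ler_norml; lra.
Qed.

Lemma misclassifiedZ (a : bool) (t l : R) : 0 < t ->
  misclassified a (t * l) = misclassified a l.
Proof. by move=> t0; rewrite /misclassified; case: a; rewrite ?pmulr_rle0 ?pmulr_rge0. Qed.

End direction_net.

Section overlap_of_net.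
Context {R : realType} (p : nat) (K : finType) (beta : K -> 'cV[R]_p).
Variables (delta : R) (S : 'M[R]_p) (c l eta : R).
Hypotheses (d0 : 0 < delta) (l0 : 0 < l) (l1 : l <= 1).
Hypothesis net : forall b, dotv b b = 1 -> exists k,
  dotv (b - beta k) (b - beta k) <= delta ^+ 2 * dotv (beta k) (beta k).
Hypothesis coercive : forall u, c * dotv u u <= qform S u.
Hypothesis small : 2 * eta + l / 2 * eta <= l / 2 * c.
Hypothesis small' : eta < c.
Variables (n : nat) (x : nat -> 'cV[R]_p) (y : nat -> bool).
Hypothesis n0 : (0 < n)%N.

Let mis i b : bool := misclassified (y i) (dotv (x i) b).
Let bad i k : bool := `|dotv (x i) (beta k)| < delta * norm2 (x i) * norm2 (beta k).

Hypothesis mis_mean : forall k a, l * qform S a - eta * dotv a a <=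
  n%:R^-1 * \sum_(i < n) (mis i (beta k))%:R * dotv (x i) a ^+ 2.
Hypothesis gram_mean : forall a,
  `|n%:R^-1 * (\sum_(i < n) dotv (x i) a ^+ 2) - qform S a| <= eta * dotv a a.
Hypothesis bad_mean : forall k,
  n%:R^-1 * \sum_(i < n) (bad i k)%:R * dotv (x i) (x i) <= eta.

Let nR : 0 < n%:R :> R. Proof. by rewrite ltr0n. Qed.

Lemma linpred_design b i : linpred (design n x) b i = dotv (x i) b.
Proof. by rewrite /linpred mxE dotvE; apply: eq_bigr => j _; rewrite mxE. Qed.

Lemma gram_design a : qform ((design n x)^T *m design n x) a = \sum_(i < n) dotv (x i) a ^+ 2.
Proof.
rewrite qform_gram dotvE; apply: eq_bigr => i _.
by rewrite -[(_ *m _) i ord0]/(linpred (design n x) a i) linpred_design expr2.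
Qed.

Lemma gram_posdef : posdefmx ((design n x)^T *m design n x).
Proof.
split; first by rewrite trmx_mul trmxK.
move=> u u0; rewrite gram_design -(pmulr_rgt0 _ (_ : 0 < n%:R^-1)) ?invr_gt0//.
have := gram_mean u; rewrite ler_norml => /andP[h _].
have h1 := coercive u; have uu : 0 < dotv u u by rewrite dotvv_gt0.
have : 0 < (c - eta) * dotv u u by rewrite mulr_gt0// subr_gt0.
lra.
Qed.

(** The observations of b are compared with those of the nearest net point: they
can differ only where the linear predictor of the net point is small compared
with the length of the covariate. *)
Lemma overlap_unit b a : dotv b b = 1 ->
  l / 2 * \sum_(i < n) dotv (x i) a ^+ 2 <= \sum_(i < n) (mis i b)%:R * dotv (x i) a ^+ 2.
Proof.
move=> b1; have [k bk] := net b1.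
have aa := dotvv_ge0 a.
have h i : (mis i (beta k))%:R * dotv (x i) a ^+ 2 - (bad i k)%:R * dotv (x i) (x i) * dotv a a
    <= (mis i b)%:R * dotv (x i) a ^+ 2.
  have CS := CauchySchwarz (x i) a.
  have sq := sqr_ge0 (dotv (x i) a).
  have xx : 0 <= dotv (x i) (x i) * dotv a a by rewrite mulr_ge0// dotvv_ge0.
  case: (boolP (mis i (beta k))) => mk; last first.
    rewrite mul0r sub0r -mulrA (@le_trans _ _ 0)//; last by rewrite mulr_ge0.
    by rewrite oppr_le0 mulr_ge0.
  case: (boolP (bad i k)) => bd.
    rewrite mulr1n mul1r mul1r (@le_trans _ _ 0)//; last by rewrite mulr_ge0.
    by rewrite subr_le0.
  rewrite mul0r mul0r subr0.
  suff -> : mis i b by [].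
  by apply: (misclassified_near (ltW d0) bk) mk; rewrite leNgt.
have hs : \sum_(i < n) (mis i (beta k))%:R * dotv (x i) a ^+ 2 -
    (\sum_(i < n) (bad i k)%:R * dotv (x i) (x i)) * dotv a a <=
    \sum_(i < n) (mis i b)%:R * dotv (x i) a ^+ 2.
  by rewrite mulr_suml -sumrB; apply: ler_sum => i _; exact: h.
have ni : 0 < n%:R^-1 :> R by rewrite invr_gt0.
rewrite -(ler_pM2l ni); move/(ler_wpM2l (ltW ni)): hs => hs.
have h1 := mis_mean k a.
have h2 : n%:R^-1 * (\sum_(i < n) (bad i k)%:R * dotv (x i) (x i)) * dotv a a <= eta * dotv a a.
  by rewrite ler_wpM2r// bad_mean.
have := gram_mean a; rewrite ler_norml => /andP[_ h3].
have h4 := coercive a.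
have h5 : l / 2 * (n%:R^-1 * \sum_(i < n) dotv (x i) a ^+ 2) <=
    l / 2 * (qform S a + eta * dotv a a).
  by rewrite ler_wpM2l ?divr_ge0 ?(ltW l0)//; lra.
have h6 : (2 * eta + l / 2 * eta) * dotv a a <= l / 2 * c * dotv a a.
  by rewrite ler_wpM2r.
have h7 : l / 2 * (c * dotv a a) <= l / 2 * qform S a.
  by rewrite ler_wpM2l// divr_ge0 ?(ltW l0).
lra.
Qed.

Lemma overlap_design : overlap (design n x) (fun i => y i) (l / 2).
Proof.
move=> a b.
have -> : \sum_i linpred (design n x) a i ^+ 2 = \sum_(i < n) dotv (x i) a ^+ 2.
  by apply: eq_bigr => i _; rewrite linpred_design.
have -> : \sum_(i < n | misclassified (y i) (linpred (design n x) b i))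
    linpred (design n x) a i ^+ 2 = \sum_(i < n) (mis i b)%:R * dotv (x i) a ^+ 2.
  rewrite big_mkcond/=; apply: eq_bigr => i _; rewrite !linpred_design -/(mis i b).
  by case: (mis i b); rewrite ?mul1r ?mul0r.
have [->|b0] := eqVneq b 0.
  rewrite (_ : \sum_(i < n) (mis i 0)%:R * _ = \sum_(i < n) dotv (x i) a ^+ 2); last first.
    apply: eq_bigr => i _; rewrite /mis dotvC (_ : dotv 0 (x i) = 0).
      by rewrite /misclassified; case: (y i); rewrite lexx mul1r.
    by rewrite -(scale0r 0) dotvZl mul0r.
  have s0 : 0 <= \sum_(i < n) dotv (x i) a ^+ 2 by apply: sumr_ge0 => i _; exact: sqr_ge0.
  by apply: ler_piMl => //; move: l1; lra.
pose t := (norm2 b)^-1.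
have t0 : 0 < t by rewrite invr_gt0 sqrtr_gt0 dotvv_gt0.
have tb : dotv (t *: b) (t *: b) = 1.
  by rewrite dotvZl dotvZr mulrA -expr2 exprVn sqr_norm2 mulVf// gt_eqF// dotvv_gt0.
have := overlap_unit a tb; under [X in _ <= X -> _]eq_bigr do
  rewrite /mis dotvZr misclassifiedZ//.
by [].
Qed.

End overlap_of_net.

(** * Overlap holds eventually, almost surely *)

Section matrix_limits.
Context {R : realType} (p : nat).

Lemma qform_outer (x u : 'cV[R]_p) : qform (x *m x^T) u = dotv x u ^+ 2.
Proof. by rewrite -{1}[x]trmxK qform_gram dotvE big_ord1 /dotv -expr2. Qed.

Lemma qform_expectation d (T : measurableType d) (P : probability T R)
    (M : T -> 'M[R]_p) a : mx_integrable P M ->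
  (\int[P]_t (qform (M t) a)%:E = (qform (mx_expectation P M) a)%:E)%E.
Proof.
move=> iM.
have iij i j : P.-integrable setT (fun t => (a i ord0 * a j ord0)%:E * (M t i j)%:E)%E.
  exact: integrableZl (iM i j).
under eq_integral do rewrite qformE -sumEFin.
rewrite integral_sum//; last first.
  move=> i; under eq_fun do rewrite -sumEFin; apply: integrable_sum => // j _.
  by under eq_fun do rewrite mulrC EFinM; exact: iij.
rewrite qformE -sumEFin; apply: eq_bigr => i _.
under eq_integral do rewrite -sumEFin.
rewrite integral_sum//; last first.
  by move=> j; under eq_fun do rewrite mulrC EFinM; exact: iij.
rewrite -sumEFin; apply: eq_bigr => j _.
under eq_integral do rewrite mulrC EFinM.
rewrite integralZl//; last exact: iM.
rewrite [RHS]EFinM [RHS]muleC; congr (_ * _)%E; rewrite mxE expectation.unlock fineK//.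
by have := integrable_fin_num measurableT (iM i j).
Qed.

Lemma cvg_qform_uniform (A : nat -> 'M[R]_p) (M : 'M[R]_p) (eta : R) : 0 < eta ->
  (forall i j, (fun n => A n i j) @ \oo --> M i j) ->
  \forall n \near \oo, forall u, `|qform (A n) u - qform M u| <= eta * dotv u u.
Proof.
move=> eta0 cA.
pose e := eta / (p%:R ^+ 2 + 1).
have pp : 0 < p%:R ^+ 2 + 1 :> R by rewrite ltr_pwDr// sqr_ge0.
have e0 : 0 < e by rewrite divr_gt0.
have : \forall n \near \oo, forall ij : 'I_p * 'I_p, `|M ij.1 ij.2 - A n ij.1 ij.2| <= e.
  apply: filter_forall => -[i j] /=.
  by have /cvgrPdist_le/(_ _ e0) := cA i j.
apply: filterS => n H u.
have -> : qform (A n) u - qform M u = qform (A n - M) u.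
  by rewrite qformDm -[in RHS]scaleN1r qformZm mulN1r.
apply: (le_trans (qform_abs_le _ _)); rewrite ler_wpM2r ?dotvv_ge0//.
apply: (@le_trans _ _ (\sum_(i < p) \sum_(j < p) e)).
  apply: ler_sum => i _; apply: ler_sum => j _.
  by rewrite mxE mxE distrC; exact: (H (i, j)).
rewrite !sumr_const !card_ord -mulrnA -mulr_natr natrM -expr2 /e mulrAC.
by rewrite ler_pdivrMr// ler_pM2l// lerDl.
Qed.

End matrix_limits.

Section eventual_overlap.
Context d (T : measurableType d) (R : realType) (P : probability T R) (p : nat).
Variables (x : nat -> {RV P >-> 'cV[R]_p}) (y : nat -> {RV P >-> bool}) (g : 'cV[R]_p -> R).
Hypotheses (iidx : iid x) (cby : conditionally_bernoulli x y g).
Hypothesis g01 : forall u, 0 < g u < 1.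
Hypothesis fourth_moment : (\int[P]_w (dotv (x 0%N w) (x 0%N w) ^+ 2)%:E < +oo)%E.

Let mZ i : measurable_fun setT (fun w => (x i w, y i w)).
Proof. exact: measurable_fun_pair. Qed.

Let mx i : measurable_fun setT (x i). Proof. exact: measurable_funP. Qed.

Let mdotxx : measurable_fun setT (fun w => dotv (x 0%N w) (x 0%N w)).
Proof. exact: measurable_dotv. Qed.

Lemma measurable_indicator d' (T' : measurableType d') (c : T' -> bool) :
  measurable_fun setT c -> measurable_fun setT (fun t => (c t)%:R : R).
Proof.
move=> mc; rewrite (_ : (fun t => _) = (fun t => if c t then 1 else 0)).
  by apply: measurable_fun_ifT => //; exact: measurable_cst.
by apply/funext => t; case: (c t).
Qed.

Lemma measurable_pair_bool d' d2 (U : measurableType d') (V : measurableType d2)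
    (h : U -> bool -> V) : (forall b, measurable_fun setT (h ^~ b)) ->
  measurable_fun setT (fun z : U * bool => h z.1 z.2).
Proof.
move=> mh; rewrite (_ : (fun z => _) =
    (fun z => if z.2 then h z.1 true else h z.1 false)); last first.
  by apply/funext => -[u []].
apply: measurable_fun_ifT; first exact: measurable_snd.
- by apply: (measurableT_comp (mh true)); exact: measurable_fst.
- by apply: (measurableT_comp (mh false)); exact: measurable_fst.
Qed.

Let second_moment : (\int[P]_w (dotv (x 0%N w) (x 0%N w))%:E < +oo)%E.
Proof.
apply: (@mean_fin_sqr _ _ _ P _ _ (fun i => x i) mx (fun u => dotv u u)) => //.
  by apply: measurable_dotv; exact: measurable_id.
exact: dotvv_ge0.
Qed.

Lemma dominated_lln (h : 'cV[R]_p -> bool -> R) :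
  (forall b, measurable_fun setT (h ^~ b)) -> (forall u b, `|h u b| <= dotv u u) ->
  {ae P, forall t, (fun n => n%:R^-1 * \sum_(i < n) h (x i t) (y i t)) @ \oo -->
    fine (\int[P]_w (h (x 0%N w) (y 0%N w))%:E)}.
Proof.
move=> mh hle; have mh' := measurable_pair_bool mh.
have mhZ : measurable_fun setT (fun w => h (x 0%N w) (y 0%N w)).
  exact: (measurableT_comp mh' (mZ 0%N)).
apply: (strong_law mZ (pairs_independent iidx cby g01) (pairs_same_law iidx cby g01) mh').
apply: le_lt_trans fourth_moment; apply: ge0_le_integral => //.
- by move=> t _; rewrite lee_fin sqr_ge0.
- by apply/measurable_EFinP; exact: measurable_funX.
- by apply/measurable_EFinP; exact: measurable_funX.
- move=> t _; rewrite lee_fin /= -[leLHS]real_normK ?num_real//.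
  by rewrite lerXn2r ?nnegrE ?dotvv_ge0.
Qed.

Lemma dominated_integrable (h : T -> R) : measurable_fun setT h ->
  (forall t, `|h t| <= dotv (x 0%N t) (x 0%N t)) -> P.-integrable setT (EFin \o h).
Proof.
move=> mh hle; apply: (@le_integrable _ _ _ P setT _ _ (fun t => (dotv (x 0%N t) (x 0%N t))%:E)).
- by [].
- exact/measurable_EFinP.
- by move=> t _; rewrite /= lee_fin (ger0_norm (dotvv_ge0 _)).
- apply/integrableP; split; first exact/measurable_EFinP.
  rewrite (eq_integral (fun t => (dotv (x 0%N t) (x 0%N t))%:E))//.
  by move=> t _ /=; rewrite (ger0_norm (dotvv_ge0 _)).
Qed.

Definition moment_mx (c : 'cV[R]_p -> bool -> bool) : 'M[R]_p :=
  mx_expectation P (fun w => (c (x 0%N w) (y 0%N w))%:R *: (x 0%N w *m (x 0%N w)^T)).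

Let scaled_outerE (a : R) (u : 'cV[R]_p) i j :
  (a *: (u *m u^T)) i j = a * (u i ord0 * u j ord0).
Proof. by rewrite !mxE big_ord1 mxE. Qed.

Let indicator_le (b : bool) (z s : R) : `|z| <= s -> `|b%:R * z| <= s.
Proof.
by move=> zs; case: b; rewrite ?mul1r// mul0r normr0; exact: le_trans zs.
Qed.

Let m_entries i j : measurable_fun setT (fun u : 'cV[R]_p => u i ord0 * u j ord0).
Proof. by apply: measurable_funM; exact: measurable_mx_entry. Qed.

Lemma moment_mx_integrable (c : 'cV[R]_p -> bool -> bool) :
  (forall b, measurable_fun setT (c ^~ b)) ->
  mx_integrable P (fun w => (c (x 0%N w) (y 0%N w))%:R *: (x 0%N w *m (x 0%N w)^T)).
Proof.
move=> mc i j; apply: dominated_integrable => [|t]; last first.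
  by rewrite scaled_outerE indicator_le// norm_entry_prod_le.
under eq_fun do rewrite scaled_outerE.
apply: measurable_funM; last exact: (measurableT_comp (m_entries i j) (mx 0%N)).
apply: measurable_indicator.
exact: (measurableT_comp (measurable_pair_bool mc) (mZ 0%N)).
Qed.

(** Entrywise convergence of the empirical moment matrices is uniform over unit
directions a, which the law of large numbers for each a would not give. *)
Lemma empirical_moments (c : 'cV[R]_p -> bool -> bool) (eta : R) : 0 < eta ->
  (forall b, measurable_fun setT (c ^~ b)) ->
  {ae P, forall t, \forall n \near \oo, forall a,
    `|n%:R^-1 * (\sum_(i < n) (c (x i t) (y i t))%:R * dotv (x i t) a ^+ 2)
      - qform (moment_mx c) a| <= eta * dotv a a}.
Proof.
move=> eta0 mc.
have : {ae P, forall t, forall ij : 'I_p * 'I_p,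
    (fun n => n%:R^-1 * \sum_(k < n) ((c (x k t) (y k t))%:R *
      (x k t ij.1 ord0 * x k t ij.2 ord0))) @ \oo --> moment_mx c ij.1 ij.2}.
  apply: filter_forall => -[i j] /=.
  have := @dominated_lln (fun u b => (c u b)%:R * (u i ord0 * u j ord0)) _ _.
  have -> : moment_mx c i j =
      fine (\int[P]_w ((c (x 0%N w) (y 0%N w))%:R * (x 0%N w i ord0 * x 0%N w j ord0))%:E).
    rewrite mxE expectation.unlock; congr (fine _).
    by apply: eq_integral => w _; rewrite /= scaled_outerE.
  apply.
  - by move=> b; apply: measurable_funM => //; exact: measurable_indicator.
  - by move=> u b; rewrite indicator_le// norm_entry_prod_le.
apply: filterS => t ct.
pose A n : 'M[R]_p := n%:R^-1 *: \sum_(k < n) (c (x k t) (y k t))%:R *: (x k t *m (x k t)^T).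
have : \forall n \near \oo, forall u, `|qform (A n) u - qform (moment_mx c) u| <= eta * dotv u u.
  apply: cvg_qform_uniform => // i j; have := ct (i, j) => /=.
  rewrite (_ : (fun n => A n i j) = (fun n => n%:R^-1 * \sum_(k < n) ((c (x k t) (y k t))%:R *
      (x k t i ord0 * x k t j ord0))))//.
  apply/funext => n; rewrite mxE summxE; congr (_ * _).
  by apply: eq_bigr => k _; rewrite scaled_outerE.
apply: filterS => n H a; apply: le_trans (H a).
rewrite le_eqVlt; apply/orP; left; apply/eqP; congr (`|_ - _|).
rewrite /A qformZm; congr (_ * _).
elim/big_rec2: _ => [|k z M _ ->]; first by rewrite /qform mul0mx /dotv mulmx0 mxE.
by rewrite qformDm qformZm qform_outer.
Qed.

Variable (l c : R).
Hypotheses (l0 : 0 < l) (l1 : l <= 1) (c0 : 0 < c).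
Let Gbar u := Num.min (g u) (1 - g u).
Let S := mx_expectation P (fun w => x 0%N w *m (x 0%N w)^T).
Hypothesis coercive : forall u, c * dotv u u <= qform S u.
Hypothesis noise : forall u, l * qform S u <=
  qform (mx_expectation P (fun w => Gbar (x 0%N w) *: (x 0%N w *m (x 0%N w)^T))) u.
Hypothesis small_ball : forall kappa : R, 0 < kappa -> exists2 delta : R, 0 < delta &
  forall a : 'cV[R]_p, a != 0 ->
    (P [set w | (`|dotv (x 0%N w) a| < delta * norm2 (x 0%N w) * norm2 a)%R] <= kappa%:E)%E.

Let mis (b u : 'cV[R]_p) (a : bool) : bool := misclassified a (dotv u b).

Let m_mis b a : measurable_fun setT (fun u => mis b u a).
Proof.
have md : measurable_fun setT (fun u : 'cV[R]_p => dotv u b).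
  by apply: measurable_dotv; [exact: measurable_id|exact: measurable_cst].
by case: a; apply: measurable_fun_ler => //; exact: measurable_cst.
Qed.

Let mGbar : measurable_fun setT Gbar.
Proof.
apply: measurable_minr; first exact: cby.1.
by apply: measurable_funB; [exact: measurable_cst|exact: cby.1].
Qed.

Let Gbar_ge0 u : 0 <= Gbar u.
Proof. by have /andP[g0 g1] := g01 u; rewrite le_min (ltW g0) subr_ge0 ltW. Qed.

Let Gbar_le1 u : Gbar u <= 1.
Proof. by have /andP[g0 g1] := g01 u; rewrite ge_min (ltW g1). Qed.

(** At least one of the two responses is misclassified by b, and either has
conditional probability at least the smaller one. *)
Lemma misclassified_moment_ge b a : l * qform S a <= qform (moment_mx (mis b)) a.
Proof.
apply: (le_trans (noise a)).
have mda : measurable_fun setT (fun u : 'cV[R]_p => dotv u a ^+ 2).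
  by apply: measurable_funX; apply: measurable_dotv; [exact: measurable_id|exact: measurable_cst].
have iG : mx_integrable P (fun w => Gbar (x 0%N w) *: (x 0%N w *m (x 0%N w)^T)).
  move=> i j; apply: dominated_integrable => [|t]; last first.
    rewrite scaled_outerE normrM ger0_norm// -[leRHS]mul1r.
    by apply: ler_pM => //; exact: norm_entry_prod_le.
  under eq_fun do rewrite scaled_outerE.
  apply: measurable_funM; last exact: (measurableT_comp (m_entries i j) (mx 0%N)).
  exact: (measurableT_comp mGbar (mx 0%N)).
rewrite -lee_fin -!qform_expectation//; last exact: moment_mx_integrable.
under eq_integral do rewrite qformZm qform_outer.
under [leRHS]eq_integral do rewrite qformZm qform_outer.
rewrite (integral_pair cby g01
  (f := fun u r => ((mis b u r)%:R * dotv u a ^+ 2)%:E%E)).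
- apply: ge0_le_integral => //.
  + by move=> w _; rewrite lee_fin mulr_ge0// sqr_ge0.
  + apply/measurable_EFinP; apply: measurable_funM.
      exact: (measurableT_comp mGbar (mx 0%N)).
    exact: (measurableT_comp mda (mx 0%N)).
  + have mq r : measurable_fun setT (fun w => (bernoulli_pmf (g (x 0%N w)) r)%:E).
      apply/measurable_EFinP; have mgx := measurableT_comp cby.1 (mx 0%N).
      by case: r => //=; apply: measurable_funB => //; exact: measurable_cst.
    have mf r : measurable_fun setT (fun w => ((mis b (x 0%N w) r)%:R * dotv (x 0%N w) a ^+ 2)%:E).
      apply/measurable_EFinP; apply: measurable_funM.
        apply: measurable_indicator; exact: (measurableT_comp (m_mis b r) (mx 0%N)).
      exact: (measurableT_comp mda (mx 0%N)).
    by apply: emeasurable_funD; exact: emeasurable_funM.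
  + move=> w _; rewrite -!EFinM -EFinD lee_fin /mis /misclassified /=.
    set t := dotv (x 0%N w) a ^+ 2; have t0 : 0 <= t by exact: sqr_ge0.
    have /andP[g0 g1] := g01 (x 0%N w).
    have h1 : Gbar (x 0%N w) * t <= g (x 0%N w) * t by rewrite ler_wpM2r// ge_min lexx.
    have h2 : Gbar (x 0%N w) * t <= (1 - g (x 0%N w)) * t.
      by rewrite ler_wpM2r// ge_min lexx orbT.
    have h3 : 0 <= g (x 0%N w) * t by rewrite mulr_ge0// ltW.
    have h4 : 0 <= (1 - g (x 0%N w)) * t by rewrite mulr_ge0// subr_ge0 ltW.
    case: (leP (dotv (x 0%N w) b) 0) => s; case: (leP 0 (dotv (x 0%N w) b)) => s';
      rewrite ?mul1r ?mul0r ?mulr0 ?addr0 ?add0r; lra.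
- move=> r; apply/measurable_EFinP; apply: measurable_funM => //.
  by apply: measurable_indicator; exact: m_mis.
- by move=> u r; rewrite lee_fin mulr_ge0// sqr_ge0.
Qed.

Let bad (delta : R) (b u : 'cV[R]_p) : bool := `|dotv u b| < delta * norm2 u * norm2 b.

Let m_bad delta b : measurable_fun setT (bad delta b).
Proof.
apply: measurable_fun_ltr.
  apply: measurableT_comp => //; apply: measurable_dotv; [exact: measurable_id|exact: measurable_cst].
apply: measurable_funM; last exact: measurable_cst.
apply: measurable_funM; first exact: measurable_cst.
apply: (measurableT_comp (continuous_measurable_fun (@sqrt_continuous R))).
by apply: measurable_dotv; exact: measurable_id.
Qed.

(** Truncation: s <= tau s^2 + 1 / (4 tau) splits the squared length between its
finite second moment and the small probability of the event. *)
Lemma bad_moment_le (eta : R) : 0 < eta -> exists2 delta, 0 < delta &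
  forall b, b != 0 ->
  fine (\int[P]_w ((bad delta b (x 0%N w))%:R * dotv (x 0%N w) (x 0%N w))%:E)%E <= eta.
Proof.
move=> eta0.
set V := fine (\int[P]_w (dotv (x 0%N w) (x 0%N w) ^+ 2)%:E)%E.
have m4 : measurable_fun setT (fun w => (dotv (x 0%N w) (x 0%N w) ^+ 2)%:E).
  by apply/measurable_EFinP; exact: measurable_funX.
have V_ge0 : (0 <= \int[P]_w (dotv (x 0%N w) (x 0%N w) ^+ 2)%:E)%E.
  by apply: integral_ge0 => w _; rewrite lee_fin sqr_ge0.
have VE : (\int[P]_w (dotv (x 0%N w) (x 0%N w) ^+ 2)%:E = V%:E)%E.
  by rewrite fineK// ge0_fin_numE.
have V0 : 0 <= V by rewrite fine_ge0.
pose tau := eta / (2 * (V + 1)).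
have V1 : 0 < V + 1 by rewrite ltr_wpDl.
have tau0 : 0 < tau by rewrite divr_gt0// mulr_gt0.
have te0 : 0 < 2 * tau * eta by rewrite mulr_gt0// mulr_gt0.
have [delta delta0 Hd] := small_ball te0.
exists delta => // b b0.
have mB : measurable_fun setT (fun w => (bad delta b (x 0%N w))%:R : R).
  by apply: measurable_indicator; exact: (measurableT_comp (m_bad delta b) (mx 0%N)).
suff : (\int[P]_w ((bad delta b (x 0%N w))%:R * dotv (x 0%N w) (x 0%N w))%:E <= eta%:E)%E.
  move=> h; rewrite -lee_fin fineK// ge0_fin_numE.
    by apply: (le_lt_trans h); rewrite ltry.
  by apply: integral_ge0 => w _; rewrite lee_fin mulr_ge0// dotvv_ge0.
apply: (@le_trans _ _ (\int[P]_w (tau%:E * (dotv (x 0%N w) (x 0%N w) ^+ 2)%:E +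
    (4 * tau)^-1%:E * ((bad delta b (x 0%N w))%:R)%:E))%E).
  apply: ge0_le_integral => //.
  - by move=> w _; rewrite lee_fin mulr_ge0// dotvv_ge0.
  - by apply/measurable_EFinP; exact: measurable_funM.
  - apply: emeasurable_funD; apply: measurable_funeM => //.
    exact/measurable_EFinP.
  - move=> w _; rewrite -!EFinM -EFinD lee_fin; set s := dotv _ _.
    have h : s <= tau * s ^+ 2 + (4 * tau)^-1.
      rewrite -subr_ge0.
      have -> : tau * s ^+ 2 + (4 * tau)^-1 - s = tau * (s - (2 * tau)^-1) ^+ 2.
        by field; rewrite gt_eqF.
      by rewrite mulr_ge0 ?sqr_ge0// ltW.
    case: (bad _ _ _); rewrite ?mul1r ?mulr1// mul0r mulr0 addr0.
    by rewrite mulr_ge0 ?sqr_ge0// ltW.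
rewrite ge0_integralD//; last 4 first.
- by move=> w _; rewrite -EFinM lee_fin mulr_ge0 ?sqr_ge0// ltW.
- exact: measurable_funeM.
- by move=> w _; rewrite -EFinM lee_fin mulr_ge0// invr_ge0 mulr_ge0// ltW.
- by apply: measurable_funeM; exact/measurable_EFinP.
rewrite ge0_integralZl_EFin//; last 2 first.
- by move=> w _; rewrite lee_fin sqr_ge0.
- exact: ltW.
rewrite ge0_integralZl_EFin//; last 2 first.
- exact/measurable_EFinP.
- by rewrite invr_ge0 mulr_ge0// ltW.
have -> : (\int[P]_w ((bad delta b (x 0%N w))%:R)%:E =
    P [set w | bad delta b (x 0%N w)])%E.
  have mE : measurable [set w | bad delta b (x 0%N w)].
    by have := measurableT_comp (m_bad delta b) (mx 0%N) measurableT (Y := [set true]) I;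
      rewrite setTI.
  rewrite -[in RHS](setIT [set w | _]) -integral_indic//; apply: eq_integral => w _.
  rewrite indicE; congr ((nat_of_bool _)%:R%:E).
  by apply/idP/idP; rewrite inE.
rewrite VE -EFinM; apply: (le_trans (leeD (lexx _) (lee_wpmul2l _ (Hd b b0)))).
  by rewrite lee_fin invr_ge0 mulr_ge0// ltW.
rewrite -EFinM -EFinD lee_fin.
have -> : (4 * tau)^-1 * (2 * tau * eta) = eta / 2 by field; rewrite gt_eqF.
have : tau * V <= eta / 2.
  rewrite /tau mulrAC ler_pdivrMr ?mulr_gt0//.
  have -> : eta / 2 * (2 * (V + 1)) = eta * (V + 1) by field.
  by rewrite ler_pM2l// lerDl.
lra.
Qed.

(** The law of large numbers is applied to each of finitely many directions, and
the net argument extends the resulting bounds to all directions. *)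
Lemma eventually_overlap : {ae P, forall w, \forall n \near \oo,
  overlap (design n (fun i => x i w)) (fun i => y i w) (l / 2) /\
  posdefmx ((design n (fun i => x i w))^T *m design n (fun i => x i w))}.
Proof.
(* The first bound keeps the Gram matrix definite; the second makes the errors of
   size eta at most half of the overlap l. *)
pose eta := Num.min (c / 2) (l * c / 6).
have eta0 : 0 < eta by rewrite lt_min !divr_gt0// mulr_gt0.
have eta_c : eta < c.
  by apply: (@le_lt_trans _ _ (c / 2)); [rewrite ge_min lexx|rewrite ltr_pdivrMr//; move: c0; lra].
have eta_l : 2 * eta + l / 2 * eta <= l / 2 * c.
  have h : eta <= l * c / 6 by rewrite ge_min lexx orbT.
  have : l * eta <= eta by rewrite ler_piMl// ltW.
  lra.
have eta2 : 0 < eta / 2 by rewrite divr_gt0.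
have [delta delta0 Hbad] := bad_moment_le eta2.
have [K [beta [beta0 net]]] := direction_net p delta0.
have E1 : {ae P, forall t, forall k : K, \forall n \near \oo, forall a,
    `|n%:R^-1 * (\sum_(i < n) (mis (beta k) (x i t) (y i t))%:R * dotv (x i t) a ^+ 2)
      - qform (moment_mx (mis (beta k))) a| <= eta * dotv a a}.
  by apply: filter_forall => k; apply: empirical_moments.
have E2 := @empirical_moments (fun _ _ => true) eta eta0 (fun=> measurable_cst _).
have E3 : {ae P, forall t, forall k : K, (fun n => n%:R^-1 * \sum_(i < n)
     ((bad delta (beta k) (x i t))%:R * dotv (x i t) (x i t))) @ \oo -->
    fine (\int[P]_w ((bad delta (beta k) (x 0%N w))%:R * dotv (x 0%N w) (x 0%N w))%:E)}.
  apply: filter_forall => k.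
  apply: (@dominated_lln (fun u _ => (bad delta (beta k) u)%:R * dotv u u)).
  - move=> _; apply: measurable_funM; first exact: measurable_indicator.
    by apply: measurable_dotv; exact: measurable_id.
  - by move=> u _; rewrite indicator_le// ger0_norm// dotvv_ge0.
apply: filterS3 E1 E2 E3 => t e1 e2 e3.
have e1' : \forall n \near \oo, forall k : K, forall a,
    `|n%:R^-1 * (\sum_(i < n) (mis (beta k) (x i t) (y i t))%:R * dotv (x i t) a ^+ 2)
      - qform (moment_mx (mis (beta k))) a| <= eta * dotv a a.
  exact: filter_forall.
have e3' : \forall n \near \oo, forall k : K, n%:R^-1 * \sum_(i < n)
     ((bad delta (beta k) (x i t))%:R * dotv (x i t) (x i t)) <= eta.
  apply: filter_forall => k.
  have /cvgrPdist_le/(_ _ eta2) := e3 k; apply: filterS => n.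
  by rewrite ler_norml => /andP[h _]; have := Hbad _ (beta0 k); move: h; lra.
have e4 : \forall n \near \oo, (0 < n)%N by exists 1%N.
have e5 := filterI (filterI e1' e2) (filterI e3' e4).
apply: filterS (e5 _ _ _) => n [[n1 n2] [n3 n4]].
have SE : moment_mx (fun _ _ => true) = S.
  apply/matrixP => i j; rewrite !mxE; congr (fine _); congr (expectation _ _).
  by apply/funext => w; rewrite scale1r.
have H1 k a : l * qform S a - eta * dotv a a <= n%:R^-1 *
    \sum_(i < n) (misclassified (y i t) (dotv (x i t) (beta k)))%:R * dotv (x i t) a ^+ 2.
  have := n1 k a; rewrite ler_norml => /andP[h _].
  by have := misclassified_moment_ge (beta k) a; move: h; rewrite /mis; lra.
have H2 a : `|n%:R^-1 * (\sum_(i < n) dotv (x i t) a ^+ 2) - qform S a| <= eta * dotv a a.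
  by have := n2 a; rewrite SE; under eq_bigr do rewrite mul1r.
split.
  exact: (overlap_design (x := fun i => x i t) (y := fun i => y i t) delta0 l0 l1 net coercive eta_l n4 H1 H2 n3).
exact: (gram_posdef coercive eta_c n4 H2).
Qed.

End eventual_overlap.

(** * The asymptotic rate *)

Section eventual_bounds.
Context {R : realType}.
Local Open Scope ereal_scope.

Lemma limn_esup_le_near (u : nat -> \bar R) (a : \bar R) :
  (\forall n \near \oo, u n <= a) -> limn_esup u <= a.
Proof.
move=> ua; apply: (@le_trans _ _ (ereal_sup (u @` [set n | u n <= a]))).
  by apply: ereal_inf_lbound; exists [set n | u n <= a].
by apply: ge_ereal_sup => _ [n un <-].
Qed.

Lemma sup_cvg0_bound (I : Type) (D : set I) (f : R -> I -> \bar R) :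
  ereal_sup [set f delta a | a in D] @[delta --> (0 : R)^'+] --> 0 ->
  forall kappa : R, (0 < kappa)%R -> exists2 delta : R, (0 < delta)%R &
    forall a, D a -> f delta a <= kappa%:E.
Proof.
move=> f0 kappa k0.
have k0E : 0 < kappa%:E by rewrite lte_fin.
have near1 : \forall delta \near (0 : R)^'+, ereal_sup [set f delta a | a in D] < kappa%:E.
  exact: f0 (open_ereal_lt' k0E).
have near2 : \forall delta \near (0 : R)^'+, (0 < delta)%R by exact: nbhs_right_gt.
near (0 : R)^'+ => delta.
have d1 : ereal_sup [set f delta a | a in D] < kappa%:E by near: delta.
exists delta => [|a Da]; first by near: delta.
by apply: le_trans (ltW d1); apply: ereal_sup_ubound; exists a.
Unshelve. all: by end_near. Qed.

End eventual_bounds.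

Section random_design.
Context d (T : measurableType d) (R : realType) (P : probability T R) (p : nat).
Variables (x : nat -> {RV P >-> 'cV[R]_p}) (y : nat -> {RV P >-> bool}).
Variables (G : R -> R) (beta_star v : 'cV[R]_p) (Q : 'M[R]_p) (l : R).
Hypotheses (p0 : (0 < p)%N) (hG : forall t, 0 < G t < 1).
Hypotheses (hx : iid x)
  (hy : conditionally_bernoulli x y (fun u => G (dotv u beta_star))).
Hypothesis hQ : posdefmx Q \/ Q = 0.
Let xxT := fun w => x 0%N w *m (x 0%N w)^T.
Hypothesis B1 : mx_integrable P xxT /\
  0 < lambda_min (mx_expectation P xxT) <= lambda_max (mx_expectation P xxT).
Hypothesis B2 : ('E_P[fun w => (norm2 (x 0%N w) ^+ 4)%R] < +oo)%E.
Hypothesis B3 : ereal_sup [set P [set w | `|dotv (x 0%N w) a| <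
                                delta * norm2 (x 0%N w) * norm2 a]
              | a in [set a : 'cV[R]_p | a != 0]]
      @[delta --> 0^'+] --> 0%E.
Let Gbar := fun t => Num.min (G t) (1 - G t).
Let xxTG := fun w => Gbar (dotv (x 0%N w) beta_star) *: xxT w.
Hypothesis l0 : 0 < l.
Hypothesis B4 : l < lambda_min (invsqrtmx (mx_expectation P xxT) *m
  mx_expectation P xxTG *m invsqrtmx (mx_expectation P xxT)).

Let outer_sym (u : 'cV[R]_p) i j : (u *m u^T) i j = (u *m u^T) j i.
Proof. by rewrite !mxE !big_ord1 !mxE mulrC. Qed.

Lemma prior_precision_psd : possemidefmx Q.
Proof.
case: hQ => [|->]; first exact: posdef_psd.
by split=> [|u]; [rewrite trmx0|rewrite /qform mul0mx /dotv mulmx0 mxE].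
Qed.

(** The covariates have eventual overlap fraction min (l, 1) / 2; the minimum
only guards against an l above 1. *)
Lemma chain_rates_eventually : {ae P, forall w, \forall n \near \oo,
  let X := design n (fun i => x i w) in let Y := fun i : 'I_n => y i w in
  let rho := Num.sqrt (1 - Num.min l 1 / 2 / 8) in
  rho_psi X Y Q v <= rho /\ rho_TV X Y Q v <= rho}.
Proof.
pose S := mx_expectation P xxT.
pose l' := Num.min l 1.
have l'0 : 0 < l' by rewrite lt_min l0 ltr01.
have l'1 : l' <= 1 by rewrite ge_min lexx orbT.
have symS : S^T = S.
  by apply/matrixP => i j; rewrite !mxE; congr (fine _); congr (expectation _ _);
    apply/funext => w; exact: outer_sym.
have symM : (mx_expectation P xxTG)^T = mx_expectation P xxTG.
  apply/matrixP => i j; rewrite !mxE; congr (fine _); congr (expectation _ _).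
  by apply/funext => w; rewrite /xxTG [LHS]mxE [RHS]mxE outer_sym.
have [_ /andP[c0 _]] := B1.
have coer := lambda_min_rayleigh symS (lexx (lambda_min S)).
have pS : posdefmx S.
  split=> // u u0; apply: lt_le_trans (coer u); rewrite mulr_gt0// dotvv_gt0//.
have noise u : l' * qform S u <= qform (mx_expectation P xxTG) u.
  apply: le_trans (whitened_lambda_min p0 l0 pS symM B4 u).
  by rewrite ler_wpM2r ?ge_min ?lexx//; exact: (posdef_psd pS).2.
have fourth : (\int[P]_w (dotv (x 0%N w) (x 0%N w) ^+ 2)%:E < +oo)%E.
  move: B2; rewrite expectation.unlock.
  by under eq_integral do rewrite (exprM _ 2 2) sqr_norm2.
have g01 (u : 'cV[R]_p) : 0 < G (dotv u beta_star) < 1 by exact: hG.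
have sb := sup_cvg0_bound B3.
have := eventually_overlap hx hy g01 fourth l'0 l'1 c0 coer noise sb.
apply: filterS => w; apply: filterS => n [ov pX] /=.
have e0 : 0 < l' / 2 by rewrite divr_gt0.
have e1 : l' / 2 <= 1 by rewrite ler_pdivrMr// mul1r (le_trans l'1)// ler1n.
by split; [exact: rho_psi_le prior_precision_psd pX _ e0 e1 ov|
           exact: rho_TV_le prior_precision_psd pX _ e0 e1 ov].
Qed.

End random_design.
Theorem proposition21 (R : realType) (G : R -> R)
  (hG : forall t, 0 < G t < 1)
  (d : nat -> measure_display) (Omega : forall p, measurableType (d p))
  (P : forall p, probability (Omega p) R)
  (beta_star : forall p, 'cV[R]_p)
  (x : forall p, nat -> {RV (P p) >-> 'cV[R]_p})
  (y : forall p, nat -> {RV (P p) >-> bool})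
  (Q : forall p, 'M[R]_p) (v : forall p, 'cV[R]_p)
  (hx : forall p, (0 < p)%N -> iid (x p))
  (hy : forall p, (0 < p)%N ->
    conditionally_bernoulli (x p) (y p) (fun u => G (dotv u (beta_star p))))
  (hQ : forall p, (0 < p)%N -> posdefmx (Q p) \/ Q p = 0)
  (B1 : forall p, (0 < p)%N ->
    let xxT := fun w => x p 0%N w *m (x p 0%N w)^T in
    mx_integrable (P p) xxT /\
    0 < lambda_min (mx_expectation (P p) xxT)
      <= lambda_max (mx_expectation (P p) xxT))
  (B2 : forall p, (0 < p)%N ->
    ('E_(P p)[fun w => (norm2 (x p 0%N w) ^+ 4)%R] < +oo)%E)
  (B3 : forall p, (0 < p)%N ->
    ereal_sup [set P p [set w | `|dotv (x p 0%N w) a| <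
                                delta * norm2 (x p 0%N w) * norm2 a]
              | a in [set a : 'cV[R]_p | a != 0]]
      @[delta --> 0^'+] --> 0%E)
  (B4 : exists2 l : R, 0 < l & forall p, (0 < p)%N ->
    let Gbar := fun t => Num.min (G t) (1 - G t) in
    let xxT := fun w => x p 0%N w *m (x p 0%N w)^T in
    let xxTG := fun w =>
      Gbar (dotv (x p 0%N w) (beta_star p)) *: xxT w in
    let S := invsqrtmx (mx_expectation (P p) xxT) in
    l < lambda_min (S *m mx_expectation (P p) xxTG *m S)) :
  let X p n w := design n (fun i => x p i w) in
  let Y p n w := fun i : 'I_n => y p i w in
  (exists2 rho : R, rho < 1 & forall p, (0 < p)%N ->
    {ae P p, forall w,
      (limn_esup (fun n => (rho_psi (X p n w) (Y p n w) (Q p) (v p))%:E)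
         <= rho%:E)%E}) /\
  (exists2 rho : R, rho < 1 & forall p, (0 < p)%N ->
    {ae P p, forall w,
      (limn_esup (fun n => (rho_TV (X p n w) (Y p n w) (Q p) (v p))%:E)
         <= rho%:E)%E}).
Proof.
have [l l0 Bl] := B4.
pose rho : R := Num.sqrt (1 - Num.min l 1 / 2 / 8).
have rho1 : rho < 1.
  have m0 : 0 < Num.min l 1 by rewrite lt_min l0 ltr01.
  have m1 : Num.min l 1 <= 1 by rewrite ge_min lexx orbT.
  by rewrite -[ltRHS]sqrtr1 ltr_sqrt//; lra.
split; exists rho => // p p0;
  have := chain_rates_eventually (v p) p0 hG (hx p p0) (hy p p0) (hQ p p0) (B1 p p0) (B2 p p0)
    (B3 p p0) l0 (Bl p p0);
  apply: filterS => w near_w; apply: limn_esup_le_near;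
  by apply: filterS near_w => n [h1 h2]; rewrite lee_fin.
Qed.
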